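(* Let $\mathbb{K}$ be a field, let $r\leq d$ be integers, and let $(\Delta,\Gamma)$ be a pure relative simplicial complex (or, more generally, a pure relative simplicial poset) of dimension $d$. If for each vertex $v$ of $\Delta$ the link $(\mathrm{lk}(v,\Delta),\mathrm{lk}(v,\Gamma))$ satisfies Serre's condition $(S_r)$ over $\mathbb{K}$, then $$h_i(\Delta,\Gamma)\ \geq\ \binom{d+1}{i}\left(\sum_{j=1}^i(-1)^{i-j}\mu_{j-1}(\Delta,\Gamma;\mathbb{K})+(-1)^i f_{-1}(\Delta,\Gamma)\right)\quad\text{for all } 0\le i\leq r.$$ In particular, if $(\Delta,\Gamma)$ is Buchsbaum over $\mathbb{K}$, then these inequalities hold for all $0\le i\leq d$.
   Context: Simplicial posets. A simplicial poset is a finite poset $(\Delta,\preceq)$ with a unique minimal element $\emptyset$ such that every interval $[\emptyset,F]$ is a Boolean lattice. Every finite simplicial complex is a simplicial poset under inclusion. Elements are called faces; the dimension of $F$ is the rank of $[\emptyset,F]$ minus $1$; vertices are faces of dimension $0$; $V(F)$ is the set of vertices $v\preceq F$. A simplicial poset is the face poset of a regular CW complex $|\Delta|$ whose closed cells are simplices. For a set $W$ of vertices, $\Delta_W=\{F\in\Delta: V(F)\subseteq W\}$. The link of a face $F\in\Delta$ is $\mathrm{lk}(F,\Delta)=\{G\in\Delta: F\preceq G\}$, a simplicial poset with minimal element $F$ (for complexes, this is isomorphic to the usual link); $\mathrm{lk}(F,\Delta)=\emptyset$ (void) if $F\notin\Delta$. Relative simplicial posets. A relative simplicial poset is a pair $(\Delta,\Gamma)$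 with $\Delta$ a simplicial poset and $\Gamma\subseteq\Delta$ a (possibly void) lower ideal; it is a relative simplicial complex when $\Delta$ is a simplicial complex. Its faces are the elements of $\Delta\setminus\Gamma$, its dimension is the maximum dimension of its faces, and it is pure if all maximal elements of $\Delta\setminus\Gamma$ have the same dimension. Let $f_i(\Delta,\Gamma)$ be the number of $i$-dimensional faces of $\Delta\setminus\Gamma$; thus $f_{-1}(\Delta,\Gamma)$ is $1$ if $\Gamma=\emptyset$ (void) and $0$ otherwise. If $\dim(\Delta,\Gamma)=d$, then $h_i(\Delta,\Gamma)=\sum_{j=0}^i(-1)^{i-j}\binom{d+1-j}{i-j}f_{j-1}(\Delta,\Gamma)$ for $0\le i\le d+1$. Homology. $\tilde H_i(\Delta,\Gamma;\mathbb{K})$ is the reduced homology of the pair, computed from the quotient of the augmented cellular chain complexes (with the empty face in degree $-1$, the void poset having zero chain complex); $\tilde b_i(\Delta,\Gamma;\mathbb{K})=\dim_{\mathbb{K}}\tilde H_i(\Delta,\Gamma;\mathbb{K})$. $\mu$-numbers. Let $V$ be the vertex set of $\Delta$, $n=|V|$, and let $\mathcal{S}_V$ be the set of linear orderings of $V$. For $\varsigma=(v_1,\dots,v_n)\in\mathcal{S}_V$ let $$\mu_i^\varsigma(\Delta,\Gamma;\mathbb{K})=\sum_{k=1}^n\tilde b_{i-1}\big(\mathrm{lk}(v_k,\Delta_{\{v_1,\dots,v_k\}}),\mathrm{lk}(v_k,\Gamma_{\{v_1,\dots,v_k\}});\mathbb{K}\big),\qquad \mu_i(\Delta,\Gamma;\mathbb{K})=\frac1{n!}\sum_{\varsigma\in\mathcal{S}_V}\mu_i^\varsigma(\Delta,\Gamma;\mathbb{K}).$$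 Serre's condition. A relative simplicial poset $(\Delta,\Gamma)$ satisfies Serre's condition $(S_r)$ over $\mathbb{K}$ if for every face $F\in\Delta$ (including the empty face), $\tilde H_i(\mathrm{lk}(F,\Delta),\mathrm{lk}(F,\Gamma);\mathbb{K})=0$ for all $i<\min\{r-1,\dim(\mathrm{lk}(F,\Delta),\mathrm{lk}(F,\Gamma))\}$. Buchsbaum. A pure relative simplicial poset is Buchsbaum over $\mathbb{K}$ if all its vertex links $(\mathrm{lk}(v,\Delta),\mathrm{lk}(v,\Gamma))$, $v$ a vertex of $\Delta$, are Cohen–Macaulay over $\mathbb{K}$; equivalently, a $d$-dimensional $(\Delta,\Gamma)$ is Buchsbaum over $\mathbb{K}$ if and only if it is pure and all its vertex links satisfy $(S_d)$ over $\mathbb{K}$. *)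

(* Defs.v *)
From HB Require Import structures.
From mathcomp Require Import all_boot all_order all_algebra.

Set Implicit Arguments.
Unset Strict Implicit.
Unset Printing Implicit Defensive.

Import Order.TTheory GRing.Theory Num.Theory.
Local Open Scope ring_scope.

(* A finite poset is given as a subset [D] of a [finPOrderType], with the
   induced order, so that links, induced subposets and lower ideals of [D] are
   again subsets of the same type. The void poset is [set0]. *)

Section SimplicialPosets.
Context {disp : Order.disp_t} {T : finPOrderType disp}.
Implicit Types (D Gm W C I : {set T}) (F G v : T).

Definition minimal_in D F : Prop :=
  F \in D /\ forall G, G \in D -> (G <= F)%O -> G = F.

Definition maximal_in D F : Prop :=
  F \in D /\ forall G, G \in D -> (F <= G)%O -> G = F.

Definition boolean_lattice I : Prop :=
  exists (n : nat) (f : {set 'I_n} -> T),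
    (forall A B : {set 'I_n}, (f A <= f B)%O = (A \subset B)) /\
    f @: [set: {set 'I_n}] = I.

Definition simplicial_poset D : Prop :=
  exists b : T,
    [/\ minimal_in D b,
        forall c, minimal_in D c -> c = b
      & forall F, F \in D ->
          boolean_lattice [set G in D | (b <= G)%O && (G <= F)%O]].

Definition relative_simplicial_poset D Gm : Prop :=
  [/\ simplicial_poset D, Gm \subset D
    & forall F G, G \in Gm -> F \in D -> (F <= G)%O -> F \in Gm].

Definition chain C : bool :=
  [forall F in C, forall G in C, (F >=< G)%O].

(* The rank of the interval below [F]: the largest length of a chain, a chain
   with k elements having length k - 1. *)
Definition face_rank D F : nat :=
  (\max_(C : {set T} | (C \subset [set G in D | (G <= F)%O]) && chain C)
     #|C|).-1.

Definition face_dim D F : int := (face_rank D F)%:Z - 1.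

Definition vertices D : {set T} := [set v in D | face_dim D v == 0].

Definition vertices_of D F : {set T} := [set v in vertices D | (v <= F)%O].

Definition induced D W : {set T} := [set F in D | vertices_of D F \subset W].

(* If [D] is a lower ideal (of some larger simplicial poset) and [F] is not in
   [D], then this is the void poset. *)
Definition lk F D : {set T} := [set G in D | (F <= G)%O].

(* The dimension is -1 by convention if there are no faces, i.e. [D = Gm]. *)
Definition rel_dim D Gm : int := (\max_(F in D :\: Gm) face_rank D F)%:Z - 1.

Definition rel_pure D Gm : Prop :=
  forall F G, maximal_in (D :\: Gm) F -> maximal_in (D :\: Gm) G ->
    face_dim D F = face_dim D G.

Definition rel_faces D Gm (i : int) : {set T} :=
  [set F in D :\: Gm | face_dim D F == i].

Definition fnum D Gm (i : int) : nat := #|rel_faces D Gm i|.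

Definition hnum D Gm (i : nat) : int :=
  \sum_(0 <= j < i.+1)
    (-1) ^+ (i - j) * 'C(`|(rel_dim D Gm + 1)%R|%N - j, i - j)%:R
      * (fnum D Gm (j%:Z - 1))%:R.

Section Homology.
Variable K : fieldType.

(* The cellular incidence number of a face [F] and a face [G] with
   dim F = dim G - 1, for the orientation of the cells given by the
   enumeration order of [T] on vertices: if [F <= G], it is (-1)^p, where p is
   the position (counted from 0) among the vertices of [G] of the only vertex
   of [G] that is not a vertex of [F], so the sum has exactly one term. *)
Definition incidence D G F : K :=
  if (F <= G)%O then
    \sum_(v in vertices_of D G :\: vertices_of D F)
      (-1) ^+ #|[set w in vertices_of D G | (enum_rank w < enum_rank v)%N]|
  else 0.

(* Relative chains of degree i are row vectors indexed by the i-dimensional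
   faces of the pair, and the boundary map is right multiplication by
   [boundary D Gm i (i - 1)]. The second degree is a separate argument only to
   make consecutive boundary maps composable without casts. *)
Definition boundary D Gm (i j : int) :
    'M[K]_(#|rel_faces D Gm i|, #|rel_faces D Gm j|) :=
  \matrix_(a, b) incidence D (enum_val a) (enum_val b).

(* The row space of this matrix is a complement of the space of boundaries in
   the space of cycles, i.e. a copy of the quotient. *)
Definition red_homology D Gm (i : int) : 'M[K]_#|rel_faces D Gm i| :=
  (kermx (boundary D Gm i (i - 1)) :\: boundary D Gm (i + 1) i)%MS.

Definition betti D Gm (i : int) : nat := \rank (red_homology D Gm i).

Definition orderings D : {set #|vertices D|.-tuple T} :=
  [set s : #|vertices D|.-tuple T | perm_eq s (enum (vertices D))].

Definition mu_ordering D Gm (s : #|vertices D|.-tuple T) (i : int) : nat :=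
  (\sum_(k < #|vertices D|)
     let W := [set v in take k.+1 s] in
     betti (lk (tnth s k) (induced D W)) (lk (tnth s k) (induced Gm W))
       (i - 1))%N.

Definition mu D Gm (i : int) : rat :=
  (#|vertices D|`!)%:R^-1 * \sum_(s in orderings D) (mu_ordering Gm s i)%:R.

Definition serre (r : int) D Gm : Prop :=
  forall F, F \in D -> forall i : int,
    i < Num.min (r - 1) (rel_dim (lk F D) (lk F Gm)) ->
    red_homology (lk F D) (lk F Gm) i = 0.

Definition cohen_macaulay D Gm : Prop :=
  forall F, F \in D -> forall i : int,
    i < rel_dim (lk F D) (lk F Gm) ->
    red_homology (lk F D) (lk F Gm) i = 0.

Definition buchsbaum D Gm : Prop :=
  rel_pure D Gm /\
  forall v, v \in vertices D -> cohen_macaulay (lk v D) (lk v Gm).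

End Homology.
End SimplicialPosets.

(* Main.v *)
(* The numbers g_i = h_i / C(d+1,i) satisfy g_(i+1) + g_i = sum over the vertices v of
   h_i(lk v) / ((d+1) C(d,i)), so the theorem reduces to one inequality for each
   vertex link L.  As a set of n vertices occurs with weight
   beta(m,n) = n!(m-n)!/(m+1)! before a given vertex in a random ordering, that
   inequality compares, with weights beta, the alternating sums
   T_i(C) = sum_(q <= i) (-1)^(i-q) dim H^(q-1)(C) of the induced subcomplexes
   L_W with the h-numbers of L.

   For a space U with one functional for each label, let C_n(U) be the complex
   with terms the sums over the faces F of size q of the exterior powers
   Lambda^(n-q) U_F, where U_F is the common kernel of the labels of F; its
   differential contracts by one more label.  If U = K^V, C_n(U) is the sum of
   the cochain complexes of the L_W with #|W| = n.  For a generic hyperplane U'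
   of U the sequence C_n(U') -> C_n(U) -> C_(n-1)(U') is exact, so
   T_i(C_n(U)) <= T_i(C_n(U')) + T_i(C_(n-1)(U')), and dim U can be lowered to
   d = dim L + 1.  There (S_r) makes C_n(U) exact in the positions q < n, q < r,
   and T_i(C_n(U)) becomes (-1)^(i-n) h_n(L) for n <= i and 0 for n > i.

   For the exactness, Lambda^(n-q) U_F is resolved by the spaces Lambda^n U_A,
   A a set of labels of F.  In the resulting double complex the other
   differential only sees the cohomology of the links of the faces A with
   constant coefficients, which vanishes by (S_r), whereas Lambda^n U_A = 0 as
   soon as n + #|A| > d.  Generic functionals exist after replacing K by K(X). *)

Require Import Defs.
From HB Require Import structures.
From mathcomp Require Import all_boot all_order all_algebra.
From mathcomp Require Import ring zify.

Set Implicit Arguments.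
Unset Strict Implicit.
Unset Printing Implicit Defensive.

Import Order.TTheory GRing.Theory Num.Theory.
Local Open Scope ring_scope.

(** * Signs and exterior algebra *)

(** The induced subcomplexes [L_W] need not satisfy (S_r), so they are not bounded one at a time;
    only sums over all [W] of one size are controlled. Collecting these in [C_n(K^V)] makes them one
    member of a family indexed by subspaces [U]. (S_r) becomes usable at dim U = d: there Lambda^n
    U_A is nonzero only for n + #|A| <= d, and for q < n this lies in the range q + #|A| < d in
    which the links have no cohomology. Lowering [U] gives an inequality because [T_i] is a sum of
    dimensions minus one rank, that of the differential leaving position [i]: in a short exact
    sequence dimensions are additive and such ranks superadditive. The weights fit both ends.
    beta(m,n) is the integral of x^n (1-x)^(m-n) over [0,1], so 1 = x + (1-x) yields the recursion
    that absorbs the two terms produced by each cut. When dimension [d] is reached, beta(d,n) equals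
    both 1/((n+1) C(d+1,n+1)) and 1/((d+1-n) C(d+1,n)), which turns (n+1) h_(n+1) + (d+1-n) h_n into
    g_(n+1) + g_n. *)

Lemma sum_antisym (V : zmodType) (I : finType) (P : pred I) (f : I -> I -> V) :
  (forall x, P x -> f x x = 0) ->
  (forall x y, P x -> P y -> f x y = - f y x) ->
  \sum_(x | P x) \sum_(y | P y) f x y = 0.
Proof.
move=> fxx fC.
(* Each pair is matched with its mirror image across the diagonal: equating the sum with its
   opposite would prove nothing in characteristic 2, which is also why the diagonal has its own
   hypothesis. *)
pose lt (x y : I) := (enum_rank x < enum_rank y)%N.
have split x : P x -> \sum_(y | P y) f x y =
    \sum_(y | P y && lt y x) f x y + \sum_(y | P y && lt x y) f x y.
  move=> Px; rewrite (bigID (fun y => lt y x)) /=; congr (_ + _).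
  rewrite (bigID (fun y => lt x y)) /= addrC big1 ?add0r => [|y].
    by apply: eq_bigl => y; rewrite /lt -andbA; case: ltngtP; rewrite ?andbF.
  rewrite /lt -!leqNgt -andbA => /andP[Py].
  by rewrite -eqn_leq => /eqP/val_inj/enum_rank_inj->; apply: fxx.
rewrite (eq_bigr _ split) big_split /=.
rewrite (exchange_big_dep P) => [|x y _ /andP[]] //=.
rewrite -big_split /= big1 // => y Py.
rewrite [X in X + _](eq_bigl (fun x => P x && lt y x)); last by move=> x; rewrite Py.
rewrite -big_split /= big1 // => x /andP[Px _].
by rewrite fC // addNr.
Qed.

Section Signs.
Variables (K : fieldType) (E : finType).
Implicit Types (x y : E) (S X A B : {set E}).

Definition eta x y : K := if (enum_rank y < enum_rank x)%N then -1 else 1.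

Lemma eta_sq x y : eta x y * eta x y = 1.
Proof. by rewrite /eta; case: ifP => _; rewrite ?mulrNN mulr1. Qed.

Lemma etaxx x : eta x x = 1.
Proof. by rewrite /eta ltnn. Qed.

Lemma eta_anti x y : x != y -> eta x y = - eta y x.
Proof.
rewrite /eta; case: ltngtP => [||/val_inj/enum_rank_inj->];
  by rewrite ?opprK ?eqxx.
Qed.

(** The sign of sorting [x] into [S] from the front; [dsg] sorts from the back. As [eta x x = 1],
    neither depends on whether [x] lies in [S]. *)
Definition sg x S : K := \prod_(y in S) eta x y.
Definition dsg x S : K := \prod_(y in S) eta y x.

Lemma sgU1 x y S : y \notin S -> sg x (y |: S) = eta x y * sg x S.
Proof. by move=> yS; rewrite /sg big_setU1. Qed.

Lemma sgD1 x y S : y \in S -> sg x S = eta x y * sg x (S :\ y).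
Proof. by move=> yS; rewrite /sg (big_setD1 y). Qed.

Lemma dsgD1 x y S : y \in S -> dsg x S = eta y x * dsg x (S :\ y).
Proof. by move=> yS; rewrite /dsg (big_setD1 y). Qed.

Lemma sg_sq x S : sg x S * sg x S = 1.
Proof. by rewrite /sg -big_split big1 //= => y _; rewrite eta_sq. Qed.

Lemma dsg_sq x S : dsg x S * dsg x S = 1.
Proof. by rewrite /dsg -big_split big1 //= => y _; rewrite eta_sq. Qed.

Lemma sgU x A B : [disjoint A & B] -> sg x (A :|: B) = sg x A * sg x B.
Proof. by move=> dAB; rewrite /sg -bigU //=; apply: eq_bigl => z; rewrite in_setU. Qed.

Lemma dsgU x A B : [disjoint A & B] -> dsg x (A :|: B) = dsg x A * dsg x B.
Proof. by move=> dAB; rewrite /dsg -bigU //=; apply: eq_bigl => z; rewrite in_setU. Qed.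

Lemma sg_swap x y S : x != y -> x \notin S -> y \notin S ->
  sg x S * sg y (x |: S) = - (sg y S * sg x (y |: S)).
Proof.
move=> xy xS yS; rewrite !sgU1 // (eta_anti xy); ring.
Qed.

Lemma dsg_swap x y X : x != y -> x \in X -> y \in X ->
  dsg x X * dsg y (X :\ x) = - (dsg y X * dsg x (X :\ y)).
Proof.
move=> xy xX yX.
have yXx : y \in X :\ x by rewrite !inE eq_sym xy.
have xXy : x \in X :\ y by rewrite !inE xy.
rewrite (dsgD1 x xX) (dsgD1 y yX) (dsgD1 x xXy) (dsgD1 y yXx) (dsgD1 x yXx) (dsgD1 y xXy).
have -> : X :\ x :\ y = X :\ y :\ x by rewrite setDDl setUC -setDDl.
by rewrite !etaxx (eta_anti xy); ring.
Qed.

End Signs.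

Arguments sg {K E}.
Arguments dsg {K E}.
Arguments eta {K E}.

(** * Contraction and exterior multiplication *)

Section Exterior.
Variables (K : fieldType) (E : finType).
Implicit Types (x y : E) (S X A : {set E}) (phi psi u : E -> K).

(* The exterior algebra on the basis [E], in coordinates: [w S] is the
   coefficient of the product of the elements of [S]. *)
Local Notation Lam := {ffun {set E} -> K^o}.
Implicit Types w : Lam.

Definition con phi w : Lam :=
  [ffun S => \sum_(x in ~: S) phi x * sg x S * w (x |: S)].

Definition wed u w : Lam :=
  [ffun S : {set E} => \sum_(x in S) u x * sg x (S :\ x) * w (S :\ x)].

Lemma con_is_linear phi : linear (con phi).
Proof.
move=> a w1 w2; apply/ffunP=> S; rewrite !ffunE scaler_sumr.
rewrite -big_split /=; apply: eq_bigr => x _; rewrite !ffunE.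
by rewrite mulrDr; congr (_ + _); exact: mulrCA.
Qed.
HB.instance Definition _ phi :=
  GRing.isLinear.Build K Lam Lam _ (con phi) (con_is_linear phi).

Lemma wed_is_linear u : linear (wed u).
Proof.
move=> a w1 w2; apply/ffunP=> S; rewrite !ffunE scaler_sumr.
rewrite -big_split /=; apply: eq_bigr => x _; rewrite !ffunE.
by rewrite mulrDr; congr (_ + _); exact: mulrCA.
Qed.
HB.instance Definition _ u :=
  GRing.isLinear.Build K Lam Lam _ (wed u) (wed_is_linear u).

Lemma con_conE phi psi w S : con phi (con psi w) S =
  \sum_(x in ~: S) \sum_(y in ~: S)
    (if y == x then 0 else phi x * psi y * (sg x S * sg y (x |: S))
       * w (y |: (x |: S))).
Proof.
rewrite ffunE; apply: eq_bigr => x xS; rewrite ffunE big_distrr /=.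
rewrite [RHS](bigD1 x) //= eqxx add0r.
rewrite (eq_bigl (fun y => (y \in ~: S) && (y != x))) => [|y]; last first.
  by rewrite !inE negb_or andbC.
by apply: eq_bigr => y /andP[_ /negPf->]; ring.
Qed.

Lemma con_sq phi w : con phi (con phi w) = 0.
Proof.
apply/ffunP=> S; rewrite con_conE ffunE sum_antisym // => [x|x y]; first by rewrite eqxx.
rewrite !inE => xS yS; rewrite eq_sym; case: eqVneq => [|xy]; first by rewrite oppr0.
by rewrite (sg_swap K xy xS yS) setUCA; ring.
Qed.

Lemma con_anti phi psi w : con phi (con psi w) = - con psi (con phi w).
Proof.
apply/ffunP=> S; rewrite [in RHS]ffunE !con_conE exchange_big /=.
rewrite -sumrN; apply: eq_bigr => x; rewrite inE => xS; rewrite -sumrN.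
apply: eq_bigr => y; rewrite inE => yS.
rewrite eq_sym; case: eqVneq => [|xy]; first by rewrite oppr0.
by rewrite (sg_swap K xy yS xS) setUCA; ring.
Qed.

(** The terms where [con] removes what [wed] has added give the scalar; the mixed terms [g x y]
    occur twice with opposite signs. If phi(u) = 1, this makes [wed u] a contracting homotopy for
    [con phi]. The lifting, splitting and vanishing statements on exterior powers below come from it
    by a suitable choice of [u]. *)
Lemma con_wed phi u w :
  con phi (wed u w) + wed u (con phi w) = (\sum_x phi x * u x) *: w.
Proof.
apply/ffunP=> S; rewrite !ffunE.
pose g x y := phi x * sg x S * (u y * sg y (S :\ y) * eta y x) * w (x |: S :\ y).
have -> : \sum_(x in ~: S) phi x * sg x S * wed u w (x |: S) =
  (\sum_(x in ~: S) phi x * u x) * w S + \sum_(x in ~: S) \sum_(y in S) g x y.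
  rewrite big_distrl -big_split /=; apply: eq_bigr => x; rewrite inE => xS.
  rewrite ffunE big_setU1 //= mulrDr; congr (_ + _).
    rewrite setU1K //.
    by rewrite -[RHS]mulr1 -(sg_sq K x S); ring.
  rewrite big_distrr /=; apply: eq_bigr => y yS; rewrite /g.
  have xy : x != y by apply: contraNneq xS => ->.
  have -> : (x |: S) :\ y = x |: S :\ y.
    by apply/setP=> z; rewrite !inE; case: (eqVneq z x) => //= ->; rewrite xy.
  by rewrite (sgU1 K y (_ : x \notin S :\ y)) ?inE ?(negPf xS) ?andbF //; ring.
have -> : \sum_(y in S) u y * sg y (S :\ y) * con phi w (S :\ y) =
  (\sum_(x in S) phi x * u x) * w S - \sum_(x in ~: S) \sum_(y in S) g x y.
  rewrite big_distrl /= exchange_big -sumrB /=; apply: eq_bigr => y yS.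
  rewrite ffunE (bigD1 y) ?inE ?eqxx //= mulrDr; congr (_ + _).
    by rewrite setD1K // -[RHS]mulr1 -(sg_sq K y (S :\ y)); ring.
  rewrite big_distrr -sumrN /=.
  rewrite (eq_bigl (fun x => x \in ~: S)) => [|x]; last first.
    by rewrite !inE; case: eqVneq => [->|]; rewrite ?yS ?andbT.
  apply: eq_bigr => x; rewrite inE => xS; rewrite /g.
  have xy : x != y by apply: contraNneq xS => ->.
  by rewrite (sgD1 K x yS) (eta_anti K xy); rewrite -[LHS]mulr1 -(eta_sq K y x); ring.
rewrite addrACA subrr addr0 -mulrDl; congr (_ * _).
by rewrite [RHS](bigID (mem S)) addrC /=; congr (_ + _); apply: eq_bigl => x; rewrite inE.
Qed.

Lemma con_supp phi w S : con phi w S != 0 ->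
  exists2 x, x \notin S & w (x |: S) != 0.
Proof.
rewrite ffunE => nz; have [x /andP[xS]|none] := pickP (fun x => (x \notin S) && (w (x |: S) != 0)).
  by exists x.
case/eqP: nz; apply: big1 => x; rewrite inE => xS.
by move/negbT: (none x); rewrite xS negbK => /eqP->; rewrite mulr0.
Qed.

Lemma wed_supp u w S : wed u w S != 0 ->
  exists2 x, (x \in S) && (u x != 0) & w (S :\ x) != 0.
Proof.
rewrite ffunE => nz.
have [x /and3P[xS ux wx]|none] := pickP (fun x => [&& x \in S, u x != 0 & w (S :\ x) != 0]).
  by exists x; rewrite ?xS.
case/eqP: nz; apply: big1 => x xS; move/negbT: (none x); rewrite xS /= negb_and !negbK.
by case/orP=> /eqP->; rewrite ?mulr0 ?mul0r.
Qed.

Definition ecoord x : E -> K := fun y => (y == x)%:R.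

Lemma conxE x w S :
  con (ecoord x) w S = if x \in S then 0 else sg x S * w (x |: S).
Proof.
rewrite ffunE; case: ifPn => xS.
  apply: big1 => y; rewrite inE /ecoord => yS.
  by case: eqVneq yS => [->|]; rewrite ?xS ?mul0r.
rewrite (bigD1 x) ?inE //= big1 => [|y /andP[_ /negPf yx]].
  by rewrite /ecoord eqxx mul1r addr0.
by rewrite /ecoord yx !mul0r.
Qed.

End Exterior.
Arguments ecoord {K E}.

(** * Coordinate subspaces and Vandermonde systems *)

Section CoordinateSubspace.
Variables (K : fieldType) (I : finType).
Implicit Types (P : pred I) (f : {ffun I -> K^o}).

Definition mask P f : {ffun I -> K^o} := [ffun i => if P i then f i else 0].

Lemma mask_is_linear P : linear (mask P).
Proof.
move=> a f g; apply/ffunP=> i; rewrite !ffunE.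
by case: ifP => _ //; rewrite scaler0 addr0.
Qed.
HB.instance Definition _ P := GRing.isLinear.Build K _ _ _ (mask P) (mask_is_linear P).

Definition coord_space P : {vspace {ffun I -> K^o}} := lker (linfun (mask (predC P))).

Lemma coord_spaceP P f : reflect (forall i, f i != 0 -> P i) (f \in coord_space P).
Proof.
rewrite memv_ker lfunE /=; apply: (iffP eqP) => [fP i|fP].
  by apply: contraNT => Pi; move/ffunP/(_ i): fP; rewrite !ffunE /= Pi => ->.
apply/ffunP=> i; rewrite !ffunE /=; case: ifP => // nPi.
by apply/eqP; apply: contraTT nPi => /fP ->.
Qed.

Lemma dim_coord_space P : \dim (coord_space P) = #|P|.
Proof.
pose ext (g : {ffun {i | P i} -> K^o}) : {ffun I -> K^o} :=
  [ffun i => if insub i is Some j then g j else 0].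
have ext_lin : linear ext.
  move=> a f g; apply/ffunP=> i; rewrite !ffunE; case: insub => [j|]; rewrite ?ffunE //.
  by rewrite scaler0 addr0.
pose extL := GRing.isLinear.Build K _ _ _ ext ext_lin.
pose extl : {linear {ffun {i | P i} -> K^o} -> {ffun I -> K^o}} := HB.pack ext extL.
have -> : coord_space P = limg (linfun extl).
  apply/vspaceP=> f; apply/coord_spaceP/memv_imgP => [fP|[g _ ->] i].
    exists [ffun j => f (val j)]; first exact: memvf.
    apply/ffunP=> i; rewrite lfunE /= ffunE; case: insubP => [j Pi <-|nPi].
      by rewrite ffunE.
    by apply/eqP; apply: contraTT nPi => /fP ->.
  by rewrite lfunE /= ffunE; case: insubP => [//|_]; rewrite eqxx.
rewrite limg_dim_eq; first by rewrite dimvf /dim /= card_sig muln1.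
apply/eqP; rewrite -subv0; apply/subvP=> g; rewrite memv_cap memv_ker memv0 lfunE => /andP[_ /eqP/ffunP g0].
apply/eqP/ffunP=> j; move: (g0 (val j)); rewrite !ffunE.
by case: insubP => [i Pi /val_inj<- //|]; rewrite (valP j).
Qed.

End CoordinateSubspace.

(** Genericity enters only here: with distinct nodes the first [N] powers are independent on any [N]
    points, so the system is solved on [N] points of [Y] and [u] is zero elsewhere. *)
Lemma vandermonde_solve (K : fieldType) (E : finType) (t : E -> K) (N : nat)
    (Y : {set E}) (c : nat -> K) :
  injective t -> (N <= #|Y|)%N ->
  exists u : E -> K, (forall x, u x != 0 -> x \in Y) /\
    forall l, (l < N)%N -> \sum_x t x ^+ l * u x = c l.
Proof.
move=> t_inj NY.
pose g (i : 'I_N) : E := enum_val (widen_ord NY i).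
have g_inj : injective g by move=> i j /enum_val_inj/(congr1 val) /= /val_inj.
pose M := Vandermonde N (\row_(j < N) t (g j)).
have Mu : M \in unitmx.
  rewrite unitmxE unitfE det_Vandermonde; apply/prodf_neq0=> i _.
  apply/prodf_neq0=> j ij; rewrite !mxE subr_eq0; apply: contraTneq ij.
  by move/t_inj/g_inj->; rewrite ltnn.
pose s := invmx M *m (\col_(i < N) c i).
pose u x := \sum_(i | g i == x) s i 0.
exists u; split=> [x|l lN].
  rewrite /u; apply: contraNT => xY; rewrite big1 // => i /eqP gx.
  by rewrite -gx enum_valP in xY.
have <- : (M *m s) (Ordinal lN) 0 = c l by rewrite mulKVmx // mxE.
rewrite mxE (partition_big g xpredT) //=; apply: eq_bigr => x _.
by rewrite /u big_distrr /=; apply: eq_bigr => i /eqP <-; rewrite !mxE.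
Qed.

(** * Complexes with labelled vertices *)

Section LabelledComplex.
Variables (K : fieldType) (P E : finType).
(* [X H] is the set of labels of the face [H], and [rm H x] is the face of [H]
   opposite to the vertex labelled [x]; it may lie outside [L], which stands for
   the set of faces of a relative complex. *)
Variables (L : {set P}) (X : P -> {set E}) (rm : P -> E -> P).
Variables (Xv : {set E}) (t : E -> K) (d N : nat).
Hypothesis rmX : forall H x, H \in L -> x \in X H -> X (rm H x) = X H :\ x.
Hypothesis rmC : forall H x y, H \in L -> x \in X H -> y \in X H -> x != y ->
  rm (rm H x) y = rm (rm H y) x.
(** Convexity of [L]: with it, cochains extended by zero outside [L] still have a differential of
    square zero. *)
Hypothesis rmL : forall H x y, H \in L -> x \in X H -> y \in X H -> x != y ->
  rm (rm H x) y \in L -> rm H x \in L.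
Hypothesis XXv : forall H, H \in L -> X H \subset Xv.
Hypothesis Xd : forall H, H \in L -> (#|X H| <= d)%N.
(** [N] is the number of hyperplane cuts that leave a space of dimension [d]. *)
Hypothesis XvN : #|Xv| = (N + d)%N.
Hypothesis t_inj : injective t.

Local Notation Lam := {ffun {set E} -> K^o}.
Implicit Types (w : Lam) (A S Y : {set E}) (H : P) (n p q l : nat) (x y : E).

(** * Exterior powers of common kernels *)

Definition wt l : E -> K := fun x => t x ^+ l.

(* Degree [n] of the exterior algebra of the common kernel of the coordinates
   outside [Xv], of those in [A] and of the first [p] weights. *)
Definition LamV n A p : {vspace Lam} :=
  (coord_space K (fun S => (S \subset (Xv :\: A)%SET) && (#|S| == n))
   :&: \bigcap_(l < p) lker (linfun (con (wt l))))%VS.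

Lemma LamVP n A p w : reflect
  ((forall S, w S != 0 -> S \subset Xv :\: A /\ #|S| = n) /\
   (forall l, (l < p)%N -> con (wt l) w = 0)) (w \in LamV n A p).
Proof.
rewrite memv_cap; apply: (iffP andP) => -[h1 h2]; split.
- by move=> S /(coord_spaceP _ _ h1)/andP[-> /eqP].
- move=> l lp; move: h2; rewrite memvE => /subv_bigcapP/(_ (Ordinal lp) isT).
  by rewrite -memvE memv_ker lfunE => /eqP.
- by apply/coord_spaceP=> S /h1[-> ->]; rewrite /= eqxx.
- rewrite memvE; apply/subv_bigcapP=> l _; rewrite -memvE memv_ker lfunE.
  by rewrite /= h2 // ltn_ord.
Qed.

Lemma LamVS n A A' p w : A \subset A' -> w \in LamV n A' p -> w \in LamV n A p.
Proof.
move=> AA' /LamVP[h1 h2]; apply/LamVP; split=> // S /h1[sS ->]; split=> //.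
exact: subset_trans sS (setDS _ AA').
Qed.

Lemma con_LamV phi n A p w : w \in LamV n A p -> con phi w \in LamV n.-1 A p.
Proof.
move=> /LamVP[h1 h2]; apply/LamVP; split=> [S /con_supp[x xS /h1[]]|l lp].
  rewrite subUset => /andP[_ ->]; rewrite cardsU1 xS => <-; split=> //.
by rewrite con_anti h2 // linear0 oppr0.
Qed.

Lemma con_coord_LamV x n A p w :
  w \in LamV n A p -> con (ecoord x) w \in LamV n.-1 (x |: A) p.
Proof.
move=> wV; have /LamVP[h1 h2] := con_LamV (ecoord x) wV.
apply/LamVP; split=> // S wS; have [sS ->] := h1 _ wS; split=> //.
apply/subsetP=> y yS; have := subsetP sS y yS; rewrite !inE negb_or => /andP[-> ->].
by rewrite !andbT; apply: contraNneq wS => <-; rewrite conxE yS.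
Qed.

Lemma con_coord0 x n A p w : x \in A -> w \in LamV n A p -> con (ecoord x) w = 0.
Proof.
move=> xA /LamVP[h1 _]; apply/ffunP=> S; rewrite conxE ffunE; case: ifP => // _.
apply/eqP; apply: contraTT xA; rewrite mulf_eq0 negb_or => /andP[_ /h1[]].
by rewrite subUset sub1set !inE => /andP[/andP[]].
Qed.

Lemma wed_LamV u n A p w : (forall x, u x != 0 -> x \in Xv :\: A) ->
  (forall l, (l < p)%N -> \sum_x wt l x * u x = 0) ->
  w \in LamV n A p -> wed u w \in LamV n.+1 A p.
Proof.
move=> su u0 /LamVP[h1 h2]; apply/LamVP; split=> [S /wed_supp[x /andP[xS /su xX] /h1[sS <-]]|l lp].
  rewrite -{1}(setD1K xS) subUset sub1set xX sS; split=> //.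
  by rewrite (cardsD1 x S) xS.
have := con_wed (wt l) u w.
by rewrite h2 // linear0 addr0 u0 // scale0r.
Qed.

(** The labels of a face stay independent on the common kernel of all [N] weights: the unit vector
    at [x] is corrected outside [X H], where at least [N] points are left for the [N] equations. *)
Lemma dual_label H x : H \in L -> x \in X H ->
  exists u : E -> K, [/\ forall y, u y != 0 -> y \in Xv :\: (X H :\ x), u x = 1
    & forall l, (l < N)%N -> \sum_y wt l y * u y = 0].
Proof.
move=> HL xX.
have NY : (N <= #|Xv :\: X H|)%N.
  by rewrite cardsD (setIidPr (XXv HL)) XvN; have := Xd HL; lia.
have [u [su u0]] := vandermonde_solve (fun l => - t x ^+ l) t_inj NY.
have ux : u x = 0 by apply/eqP; apply: contraTT xX => /su; rewrite inE => /andP[].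
exists (fun y => (y == x)%:R + u y); split=> [y||l lN].
- rewrite /=; case: (eqVneq y x) => [-> _|yx]; first by rewrite !inE eqxx (subsetP (XXv HL)).
  by rewrite add0r => /su; rewrite !inE negb_and => /andP[-> ->]; rewrite orbT.
- by rewrite eqxx ux addr0.
under eq_bigr do rewrite mulrDr.
rewrite big_split /= u0 // (bigD1 x) //= eqxx mulr1 big1 ?addr0 ?subrr // => y /negPf->.
by rewrite mulr0.
Qed.

Lemma dual_weight A p : A \subset Xv -> (#|A| <= d)%N -> (p < N)%N ->
  exists u : E -> K, (forall y, u y != 0 -> y \in Xv :\: A) /\
    forall l, (l < N)%N -> \sum_y wt l y * u y = (l == p)%:R.
Proof.
move=> AXv Ad pN; apply: vandermonde_solve => //.
by rewrite cardsD (setIidPr AXv) XvN; lia.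
Qed.

(** The common kernel of [A] and of the first [p] weights has dimension #|Xv| - #|A| - p, and
    exterior powers beyond the dimension vanish. No basis is chosen: wedging with a vector dual to
    the last weight raises the degree and releases that weight, and contraction recovers [w]. *)
Lemma LamV_eq0 n A w : A \subset Xv -> (#|A| <= d)%N -> (d < n + #|A|)%N ->
  w \in LamV n A N -> w = 0.
Proof.
move=> AXv Ad nA.
suff: forall p n w, (p <= N)%N -> (#|Xv| < n + #|A| + p)%N -> w \in LamV n A p -> w = 0.
  by apply=> //; rewrite XvN; lia.
elim=> [|p IH] {nA}n {}w pN nA wV.
  case/LamVP: wV => h1 _; apply/ffunP=> S; rewrite ffunE; apply/eqP.
  apply: contraTT nA => /h1[/subset_leq_card]; rewrite cardsD (setIidPr AXv).
  have := subset_leq_card AXv; lia.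
have [u [su u1]] := dual_weight AXv Ad pN.
have wVp : w \in LamV n A p.
  by case/LamVP: wV => h1 h2; apply/LamVP; split=> // l lp; apply: h2; lia.
have ww0 : wed u w = 0.
  apply: (IH n.+1) => //; [lia|lia|].
  by apply: wed_LamV => // l lp; rewrite u1 ?(ltn_eqF lp) //; lia.
have := con_wed (wt p) u w; rewrite ww0 linear0 add0r u1 // eqxx scale1r => <-.
by case/LamVP: wV => _ h2; rewrite h2 // linear0.
Qed.

(** * Rows of the double complex: resolution by the labels of a face *)

Definition bdry Y (y : {set E} -> Lam) A : Lam :=
  \sum_(x in Y :\: A) sg x A *: y (x |: A).

Lemma bdryU1 x Y (y : {set E} -> Lam) A : x \notin Y -> A \subset Y ->
  bdry (x |: Y) y A = sg x A *: y (x |: A) + bdry Y y A.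
Proof.
move=> xY AY; have xA : x \notin A by apply: contra xY; apply: (subsetP AY).
rewrite /bdry (bigD1 x) ?inE ?eqxx ?xA //=; congr (_ + _); apply: eq_bigl => z.
rewrite !inE; case: (eqVneq z x) => [->|_]; by rewrite ?(negPf xY) ?andbF ?andbT //=.
Qed.

Lemma bdryU1x x Y (y : {set E} -> Lam) A : x \notin Y -> A \subset Y ->
  bdry (x |: Y) y (x |: A) = \sum_(z in Y :\: A) sg z (x |: A) *: y (z |: (x |: A)).
Proof.
move=> xY AY; rewrite /bdry; apply: eq_bigl => z; rewrite !inE negb_or.
by case: (eqVneq z x) => [->|_]; rewrite ?(negPf xY) ?andbF.
Qed.

(* Exactness, for a family [Y] of independent coordinates, of the complex
   resolving the contraction by all of [Y]; the projection [con x \o wed u]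
   splits off one coordinate at a time. *)
Lemma row_exact H n Y (y : {set E} -> Lam) : H \in L -> Y \subset X H ->
  (forall A, y A \in LamV n A N) ->
  (forall S, Y \subset S -> y set0 S = 0) ->
  (forall A, A \subset Y -> bdry Y y A = 0) ->
  exists c : {set E} -> Lam, (forall A, c A \in LamV n A N) /\
    forall A, A \subset Y -> y A = bdry Y c A.
Proof.
move=> HL; move: {2}#|Y| (erefl #|Y|) => k.
elim: k Y y => [|k IH] Y y cY YX yV y0 py.
  exists (fun=> 0); split=> [A|A]; first exact: mem0v.
  move/eqP: cY; rewrite cards_eq0 => /eqP Y0; rewrite Y0 subset0 => /eqP->.
  rewrite /bdry set0D big_set0; apply/ffunP=> S; rewrite y0 ?ffunE //.
  by rewrite Y0 sub0set.
have [x xY] : exists x, x \in Y by apply/set0Pn; rewrite -card_gt0 cY.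
pose Z := Y :\ x.
have xZ : x \notin Z by rewrite !inE eqxx.
have YZ : Y = x |: Z by rewrite setD1K.
have ZX : Z \subset X H by apply: subset_trans YX; apply: subD1set.
have xA A : A \subset Z -> x \notin A by move=> AZ; apply: contra xZ; apply: (subsetP AZ).
have [u [su ux u0]] := dual_label HL (subsetP YX _ xY).
have suA A : A \subset Z -> forall z, u z != 0 -> z \in Xv :\: A.
  move=> AZ z /su; rewrite !inE => /andP[nz ->]; rewrite andbT.
  apply: contra nz => zA; have := subsetP AZ z zA; rewrite !inE => /andP[-> zY].
  exact: (subsetP YX).
(* [pi] projects onto forms annihilated by the coordinate [x], [rho] onto a complement made of
   multiples of [u]. Since [rho] kills [LamV n (x |: A) N], the [rho] part of [y] satisfies the
   hypotheses for [Z]. *)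
pose rho (w : Lam) : Lam := wed u (con (ecoord x) w).
pose pi (w : Lam) : Lam := con (ecoord x) (wed u w).
have pirho w : w = pi w + rho w.
  rewrite /pi /rho con_wed (bigD1 x) //= big1 => [|z /negPf zx].
    by rewrite /ecoord eqxx ux mulr1 addr0 scale1r.
  by rewrite /ecoord zx mul0r.
have rhorho w : rho (rho w) = rho w.
  by rewrite [in RHS](pirho w) /rho linearD linearD /= /pi con_sq linear0 add0r.
have rhoV A w : A \subset Z -> w \in LamV n A N -> rho w \in LamV n A N.
  move=> AZ wV; have [n0|n_gt0] := posnP n.
    rewrite /rho (_ : con _ _ = 0) ?linear0 ?mem0v //.
    apply/ffunP=> S; rewrite [RHS]ffunE; apply/eqP; rewrite -[_ == _]negbK.
    apply/negP=> /con_supp[z zS].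
    by case/LamVP: wV => h _ /h[_ /eqP]; rewrite n0 cards_eq0 -subset0 subUset sub1set inE.
  by rewrite -(prednK n_gt0); apply: wed_LamV; [exact: suA | by [] | exact: (con_LamV _ wV)].
have piV A w : A \subset Z -> w \in LamV n A N -> pi w \in LamV n (x |: A) N.
  by move=> AZ wV; apply: (@con_coord_LamV x n.+1); apply: wed_LamV => //; exact: suA.
have rho0 A w : w \in LamV n (x |: A) N -> rho w = 0.
  by move=> wV; rewrite /rho (con_coord0 _ wV) ?linear0 // setU11.
pose y' A := if A \subset Z then rho (y A) else 0.
have rhoS (J : {set E}) (f : E -> K) (g : E -> Lam) :
  rho (\sum_(z in J) f z *: g z) = \sum_(z in J) f z *: rho (g z).
  by rewrite /rho !linear_sum; apply: eq_bigr => z _; rewrite !linearZ.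
have piS (J : {set E}) (f : E -> K) (g : E -> Lam) :
  pi (\sum_(z in J) f z *: g z) = \sum_(z in J) f z *: pi (g z).
  by rewrite /pi !linear_sum; apply: eq_bigr => z _; rewrite !linearZ.
have zAZ A z : A \subset Z -> z \in Z :\: A -> z |: A \subset Z.
  by move=> AZ; rewrite inE subUset sub1set AZ => /andP[_ ->].
have cZk : #|Z| = k by have := cardsD1 x Y; rewrite xY cY => -[].
have y'V A : y' A \in LamV n A N by rewrite /y'; case: ifP => [AZ|_]; rewrite ?mem0v // rhoV.
have y'0 S : Z \subset S -> y' set0 S = 0.
  move=> ZS; rewrite /y' sub0set; apply/eqP; rewrite -[_ == _]negbK; apply/negP.
  case/wed_supp=> z /andP[zS uz]; rewrite conxE; case: ifP => [|xS]; rewrite ?eqxx // y0 ?mulr0 ?eqxx //.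
  rewrite YZ setUS //; apply/subsetP=> a aZ; rewrite !inE (subsetP ZS) // andbT.
  by apply: contraTneq aZ => ->; move: (suA Z (subxx _) z uz); rewrite inE => /andP[].
have py' A : A \subset Z -> bdry Z y' A = 0.
  move=> AZ; rewrite /bdry.
  rewrite (eq_bigr (fun z => sg z A *: rho (y (z |: A)))) => [|z zA]; last first.
    by rewrite /y' zAZ.
  rewrite -rhoS -/(bdry Z y A).
  have /eqP := py A (subset_trans AZ (subD1set _ _)).
  rewrite {1}YZ bdryU1 // addrC addr_eq0 => /eqP->.
  rewrite /rho !linearN !linearZ /= -/(rho _) (@rho0 A) ?oppr0 //; exact: scaler0.
have [c' [c'V yc']] := IH Z y' cZk ZX y'V y'0 py'.
(* On sets avoiding [x] the primitive is the [rho] part of the inductive one, on sets containing [x]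
   it is the [pi] part of [y] itself; [pirho] recombines the two. *)
pose c (B : {set E}) := if B \subset Z then rho (c' B) else
  if (x \in B) && (B :\ x \subset Z) then sg x (B :\ x) *: pi (y (B :\ x)) else 0.
have cZ A : A \subset Z -> c A = rho (c' A) by rewrite /c => ->.
have cx A : A \subset Z -> c (x |: A) = sg x A *: pi (y A).
  move=> AZ; rewrite /c setU1K ?xA // AZ setU11 /= subUset sub1set.
  by rewrite (negPf xZ).
exists c; split=> A.
  rewrite /c; case: ifP => [AZ|_]; first by rewrite rhoV.
  case: ifP => [/andP[xA' AZ]|_]; last by rewrite mem0v.
  by rewrite -{3}(setD1K xA'); apply/memvZ/piV.
move=> AY; have [xA'|xA'] := boolP (x \in A); last first.
  have AZ : A \subset Z by rewrite subsetD1 AY.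
  rewrite YZ bdryU1 // cx // scalerA sg_sq scale1r [LHS]pirho; congr (_ + _).
  rewrite /bdry (eq_bigr (fun z => sg z A *: rho (c' (z |: A)))) => [|z zA].
    by rewrite -rhoS -rhorho; have := yc' A AZ; rewrite /y' AZ => ->.
  by rewrite cZ ?zAZ.
rewrite -(setD1K xA'); set B := A :\ x.
have BZ : B \subset Z by rewrite setSD.
rewrite YZ bdryU1x //.
have -> : \sum_(z in Z :\: B) sg z (x |: B) *: c (z |: (x |: B)) =
    - (sg x B *: pi (bdry Z y B)).
  rewrite /bdry piS scaler_sumr -sumrN; apply: eq_bigr => z zB.
  rewrite setUCA cx ?zAZ // !scalerA -scaleNr; congr (_ *: _).
  case/setDP: zB => zZ zB; have zx : z != x by apply: contraNneq xZ => <-.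
  rewrite (@sgU1 _ _ z x) ?xA // (@sgU1 _ _ x z) // (eta_anti K zx).
  by rewrite -[RHS]mulr1 -(eta_sq K x z); ring.
have /eqP := py B (subset_trans BZ (subD1set _ _)).
rewrite {1}YZ bdryU1 ?xA // addrC addr_eq0 => /eqP->.
rewrite /pi !linearN !linearZ /= opprK scalerA sg_sq scale1r.
by rewrite {1}[y _]pirho (@rho0 B) ?addr0.
Qed.

(** * Columns of the double complex and its exactness *)

Definition cobd (y : P -> {set E} -> Lam) H A : Lam :=
  \sum_(x in X H :\: A) dsg x (X H) *: y (rm H x) A.

Lemma setDU1 Y A x : Y :\: (x |: A) = (Y :\: A) :\ x.
Proof. by apply/setP=> z; rewrite !inE negb_or -andbA. Qed.

Lemma setD1D Y A x : (Y :\ x) :\: A = (Y :\: A) :\ x.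
Proof. by apply/setP=> z; rewrite !inE andbCA. Qed.

Lemma sum_setD1 (V : zmodType) Y x (f : E -> V) :
  \sum_(z in Y :\ x) f z = \sum_(z in Y) (if z == x then 0 else f z).
Proof.
rewrite [RHS](bigID (fun z => z == x)) /= [X in _ = X + _]big1 => [|z /andP[_ ->] //].
rewrite add0r.
rewrite (eq_bigl (fun z => (z \in Y) && (z != x))) => [|z]; last by rewrite !inE andbC.
by apply: eq_bigr => z /andP[_ /negPf->].
Qed.

Lemma cobd_cobd (y : P -> {set E} -> Lam) H A : H \in L -> cobd (cobd y) H A = 0.
Proof.
move=> HL; pose f x z : Lam := if z == x then 0 else
  dsg x (X H) *: (dsg z (X H :\ x) *: y (rm (rm H x) z) A).
rewrite /cobd (eq_bigr (fun x => \sum_(z in X H :\: A) f x z)) => [|x]; last first.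
  case/setDP=> xX _; rewrite (rmX HL xX) setD1D sum_setD1 scaler_sumr.
  by apply: eq_bigr => z _; rewrite /f; case: eqVneq => // _; rewrite scaler0.
apply: sum_antisym => [x _|x z /setDP[xX _] /setDP[zX _]]; first by rewrite /f eqxx.
rewrite /f eq_sym; case: eqVneq => [|xz]; first by rewrite oppr0.
by rewrite !scalerA (dsg_swap K xz xX zX) (rmC HL xX zX xz) scaleNr.
Qed.

Lemma bdry_bdry Y (y : {set E} -> Lam) A : bdry Y (bdry Y y) A = 0.
Proof.
pose f x z : Lam := if z == x then 0 else
  sg x A *: (sg z (x |: A) *: y (z |: (x |: A))).
rewrite {1}/bdry (eq_bigr (fun x => \sum_(z in Y :\: A) f x z)) => [|x xY]; last first.
  rewrite /bdry setDU1 sum_setD1 scaler_sumr.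
  by apply: eq_bigr => z _; rewrite /f; case: eqVneq => // _; rewrite scaler0.
apply: sum_antisym => [x _|x z /setDP[_ xA] /setDP[_ zA]]; first by rewrite /f eqxx.
rewrite /f eq_sym; case: eqVneq => [|xz]; first by rewrite oppr0.
by rewrite !scalerA (sg_swap K xz xA zA) setUCA scaleNr.
Qed.

(** The sign of [bdry] sees only the label set [A] and that of [cobd] only the face, so the two
    differentials commute rather than anticommute. *)
Lemma bdry_cobd (y : P -> {set E} -> Lam) H A : H \in L ->
  bdry (X H) (cobd y H) A = cobd (fun G => bdry (X G) (y G)) H A.
Proof.
move=> HL; pose f x z : Lam := if z == x then 0 else
  (sg x A * dsg z (X H)) *: y (rm H z) (x |: A).
transitivity (\sum_(x in X H :\: A) \sum_(z in X H :\: A) f x z).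
  apply: eq_bigr => x xX; rewrite /cobd setDU1 sum_setD1 scaler_sumr.
  by apply: eq_bigr => z _; rewrite /f; case: eqVneq; rewrite ?scaler0 ?scalerA.
rewrite exchange_big; apply: eq_bigr => z /setDP[zX _].
rewrite /bdry (rmX HL zX) setD1D sum_setD1 scaler_sumr.
apply: eq_bigr => x _; rewrite /f eq_sym; case: eqVneq; rewrite ?scaler0 // => _.
by rewrite scalerA mulrC.
Qed.

Lemma bdryB Y (y1 y2 : {set E} -> Lam) A : bdry Y (fun B => y1 B - y2 B) A = bdry Y y1 A - bdry Y y2 A.
Proof. by rewrite /bdry -sumrB; apply: eq_bigr => x _; rewrite scalerBr. Qed.

Lemma eq_bdry Y (y1 y2 : {set E} -> Lam) A : (forall x, x \in Y :\: A -> y1 (x |: A) = y2 (x |: A)) ->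
  bdry Y y1 A = bdry Y y2 A.
Proof. by move=> y12; apply: eq_bigr => x /y12->. Qed.

Variable r : nat.
(* Vanishing of the cohomology, with constant coefficients, of the link of a
   face with labels [A], in the form of an explicit primitive. *)
Hypothesis col_exact : forall A q, (q < r)%N -> (q + #|A| < d)%N ->
  exists c : P -> P -> K, (forall H G, c H G != 0 -> H \in L) /\
    forall y : P -> K, (forall H, H \notin L -> y H = 0) ->
    (forall H, H \in L -> A \subset X H -> #|X H| = (q + #|A|).+1 ->
       \sum_(x in X H :\: A) dsg x (X H) * y (rm H x) = 0) ->
    forall H, H \in L -> A \subset X H -> #|X H| = (q + #|A|)%N ->
       y H = \sum_(x in X H :\: A) dsg x (X H) * \sum_G c (rm H x) G * y G.

Definition cochain n (y : P -> {set E} -> Lam) :=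
  (forall H A, y H A \in LamV n A N) /\ forall H A, H \notin L -> y H A = 0.

(** The primitive in [col_exact] is a fixed matrix; applied coefficientwise it produces linear
    combinations of the values of [y], which therefore stay in the subspace [LamV n A N]. *)
Lemma col_exact_Lam n q A (y : P -> Lam) : (q < r)%N -> (q + #|A| < d)%N ->
  (forall H, y H \in LamV n A N) -> (forall H, H \notin L -> y H = 0) ->
  (forall H, H \in L -> A \subset X H -> #|X H| = (q + #|A|).+1 ->
     \sum_(x in X H :\: A) dsg x (X H) *: y (rm H x) = 0) ->
  exists z : P -> Lam, [/\ forall H, z H \in LamV n A N,
    forall H, H \notin L -> z H = 0
    & forall H, H \in L -> A \subset X H -> #|X H| = (q + #|A|)%N ->
       y H = \sum_(x in X H :\: A) dsg x (X H) *: z (rm H x)].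
Proof.
move=> qr qd yV yL dy; have [c [cL cE]] := col_exact qr qd.
exists (fun H => \sum_G c H G *: y G); split=> [H|H HL|H HL AX cX].
- by apply: memv_suml => G _; apply: memvZ.
- by apply: big1 => G _; rewrite (_ : c H G = 0) ?scale0r //; apply/eqP; apply: contraNT HL => /cL.
apply/ffunP=> S; rewrite sum_ffunE (cE (fun G => y G S)) => [||G GL AG cG|||] //.
- by apply: eq_bigr => x _; rewrite ffunE sum_ffunE; congr (_ * _); apply: eq_bigr => G _; rewrite ffunE.
- by move=> G GL; rewrite yL // ffunE.
- by have /ffunP/(_ S) := dy G GL AG cG; rewrite sum_ffunE ffunE => {2}<-; apply: eq_bigr => x _; rewrite ffunE.
Qed.

(* Descending induction on [s]: the partial primitives are corrected one
   column of the double complex after the other, until [LamV n A N] vanishes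
   for [d < n + #|A|]. *)
Lemma double_complex_exact n q s (y : P -> {set E} -> Lam) : (q < n)%N -> (q < r)%N -> cochain n y ->
  (if s is s'.+1 then
     forall H A, H \in L -> A \subset X H -> #|A| = s' -> #|X H| = (q + s).+1 ->
       bdry (X H) (cobd y H) A = 0
   else forall H S, H \in L -> #|X H| = q.+1 -> X H \subset S -> cobd y H set0 S = 0) ->
  exists (x c : P -> {set E} -> Lam), [/\ cochain n x, cochain n c &
    forall H A, H \in L -> A \subset X H -> #|A| = s -> #|X H| = (q + s)%N ->
      y H A = cobd x H A + bdry (X H) (c H) A].
Proof.
move=> qn qr; move: {2}(d.+1 - n - s)%N (erefl (d.+1 - n - s)%N) => k.
have coch0 : cochain n (fun _ _ => 0) by split=> // H A; apply: mem0v.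
elim: k s y => [|k IH] s y ks [yV yL] dy.
  (* Here [d < n + s], so every relevant [y H A] is zero. *)
  exists (fun _ _ => 0), (fun _ _ => 0); split=> // H A HL AX cA cX.
  rewrite (LamV_eq0 (subset_trans AX (XXv HL)) _ _ (yV H A)) ?cA.
  - by rewrite /cobd /bdry !big1 ?addr0 // => x _; rewrite scaler0.
  - by have := Xd HL; lia.
  - by have := Xd HL; lia.
(* On each face, the coboundary of column [s] is a cycle of the row, hence the boundary of some [y1]
   in column [s.+1]. *)
have /fin_all_exists [c cP] : forall H, exists c : {set E} -> Lam,
    (forall A, c A \in LamV n A N) /\ (H \in L -> #|X H| = (q + s).+1 ->
    forall A, A \subset X H -> #|A| = s -> cobd y H A = bdry (X H) c A).
  move=> H; have [/andP[HL /eqP cX]|nH] := boolP ((H \in L) && (#|X H| == (q + s).+1)); last first.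
    exists (fun=> 0); split=> [A|HL cX]; first exact: mem0v.
    by rewrite HL cX eqxx in nH.
  pose eta' A := if #|A| == s then cobd y H A else 0.
  have eV A : eta' A \in LamV n A N.
    rewrite /eta'; case: ifP => _; rewrite ?mem0v //.
    by apply: memv_suml => x _; apply: memvZ.
  have e0 S : X H \subset S -> eta' set0 S = 0.
    move=> XS; rewrite /eta' cards0; case: eqP => [s0|_]; last by rewrite ffunE.
    by move: dy cX; rewrite -s0 => dy cX; apply: dy; rewrite // cX addn0.
  have ep A : A \subset X H -> bdry (X H) eta' A = 0.
    move=> AX; have [cA|cA] := eqVneq #|A|.+1 s.
      case: s cX {ks} cA @eta' dy eV e0 => // s' cX [cA] eta' dy _ _.
      rewrite -[RHS](dy H A) //; apply: eq_bdry => x /setDP[_ xA].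
      by rewrite /eta' cardsU1 xA cA eqxx.
    apply: big1 => x /setDP[_ xA]; rewrite /eta' cardsU1 xA add1n (negPf cA).
    by rewrite scaler0.
  have [c [cV cE]] := row_exact HL (subxx _) eV e0 ep.
  by exists c; split=> // _ _ A AX cA; rewrite -cE // /eta' cA eqxx.
pose y1 H A := if (H \in L) && (#|X H| == (q + s).+1) then c H A else 0.
have y1E H A : H \in L -> A \subset X H -> #|A| = s -> #|X H| = (q + s).+1 ->
    cobd y H A = bdry (X H) (y1 H) A.
  move=> HL AX cA cX; have [_ /(_ HL cX A AX cA)->] := cP H.
  by apply: eq_bdry => x _; rewrite /y1 HL cX eqxx.
have y1c : cochain n y1.
  split=> H A; rewrite /y1; first by case: ifP => _; rewrite ?mem0v //; have [] := cP H.
  by move/negPf->.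
have pdy1 H A : H \in L -> A \subset X H -> #|A| = s -> #|X H| = (q + s.+1).+1 ->
    bdry (X H) (cobd y1 H) A = 0.
  move=> HL AX cA cX.
  rewrite bdry_cobd // -[RHS](cobd_cobd y A HL); apply: eq_bigr => x /setDP[xX xA]; congr (_ *: _).
  have Xx := rmX HL xX.
  (* If [rm H x] lies outside [L], then by convexity so does every face reached by removing another
     label, and both sides vanish. *)
  have [xL|xL] := boolP (rm H x \in L).
    rewrite -y1E // Xx; first by rewrite subsetD1 AX.
    by have := cardsD1 x (X H); rewrite xX; lia.
  rewrite [LHS]big1 => [|z _]; last by rewrite /y1 (negPf xL) scaler0.
  rewrite [RHS]big1 // => z; rewrite Xx => /setDP[/setD1P[zx zX] _].
  by rewrite yL ?scaler0 //; apply: contra xL; apply: rmL => //; rewrite eq_sym.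
have ks1 : (d.+1 - n - s.+1 = k)%N by lia.
have [x1 [c1 [[x1V x1L] [c1V c1L] y1xc]]] := IH s.+1 y1 ks1 y1c pdy1.
(* Subtracting the boundary of [x1] closes the column: [cobd y'] is the boundary of [y1 - cobd x1],
   which by induction is itself the boundary of [c1]. *)
pose y' H A := y H A - bdry (X H) (x1 H) A.
have pV (f : P -> {set E} -> Lam) H A : (forall H A, f H A \in LamV n A N) -> bdry (X H) (f H) A \in LamV n A N.
  by move=> fV; apply: memv_suml => x _; apply: memvZ; apply: LamVS (fV _ _); apply: subsetUr.
have y'V H A : y' H A \in LamV n A N by apply: rpredB => //; apply: pV.
have y'L H A : H \notin L -> y' H A = 0.
  by move=> HL; rewrite /y' yL // /bdry big1 ?subr0 // => x _; rewrite x1L ?scaler0.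
have dy' H A : H \in L -> A \subset X H -> #|A| = s -> #|X H| = (q + s).+1 -> cobd y' H A = 0.
  move=> HL AX cA cX.
  have -> : cobd y' H A = cobd y H A - cobd (fun G => bdry (X G) (x1 G)) H A.
    by rewrite /cobd -sumrB; apply: eq_bigr => x _; rewrite scalerBr.
  rewrite y1E // -bdry_cobd // -bdryB -[RHS](bdry_bdry (X H) (c1 H) A).
  apply: eq_bdry => x /setDP[xX xA].
  rewrite y1xc //; first by rewrite addrAC subrr add0r.
  - by rewrite subUset sub1set xX.
  - by rewrite cardsU1 xA cA.
  - by rewrite cX addnS.
have /fin_all_exists [x xP] : forall A, exists x : P -> Lam, [/\ forall H, x H \in LamV n A N,
    forall H, H \notin L -> x H = 0 &
    #|A| = s -> forall H, H \in L -> A \subset X H -> #|X H| = (q + s)%N ->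
      y' H A = \sum_(z in X H :\: A) dsg z (X H) *: x (rm H z)].
  move=> A; have [cA|cA] := eqVneq #|A| s; last first.
    by exists (fun=> 0); split=> // [H|/eqP]; rewrite ?mem0v ?(negPf cA).
  (* The measure is positive, so [n + s <= d]; together with [q < n] this puts the column in the
     range of [col_exact]. *)
  have qd : (q + #|A| < d)%N by lia.
  have dyA H : H \in L -> A \subset X H -> #|X H| = (q + #|A|).+1 -> cobd y' H A = 0.
    by rewrite cA => *; apply: dy'.
  have [x [xV xL xE]] := @col_exact_Lam n q A (y'^~ A) qr qd (y'V^~ A) (y'L^~ A) dyA.
  by exists x; split=> // _ H HL AX cX; apply: xE => //; rewrite cX cA.
exists (fun H A => x A H), x1; split=> //.
  by split=> H A; have [] := xP A => // xV xL _; apply: xL.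
move=> H A HL AX cA cX; have [_ _ /(_ cA H HL AX cX)] := xP A.
by rewrite /y' => /eqP; rewrite subr_eq => /eqP.
Qed.

(* Contraction by the product of the labels in [Y]. *)
Definition kappa Y w : Lam := [ffun S : {set E} =>
  if [disjoint S & Y] then (\prod_(x in Y) sg x S) * w (S :|: Y) else 0].

Lemma kappa_is_linear Y : linear (kappa Y).
Proof.
move=> a w1 w2; apply/ffunP=> S; rewrite !ffunE; case: ifP => _.
  by rewrite mulrDr; congr (_ + _); exact: mulrCA.
by rewrite scaler0 addr0.
Qed.
HB.instance Definition _ Y := GRing.isLinear.Build K Lam Lam _ (kappa Y) (kappa_is_linear Y).

Lemma kappa_set0 w : kappa set0 w = w.
Proof.
apply/ffunP=> S; rewrite ffunE big_set0 setU0 mul1r.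
by rewrite -setI_eq0 setI0 eqxx.
Qed.

Lemma con_kappa x Y w : x \in Y ->
  con (ecoord x) (kappa (Y :\ x) w) = dsg x Y *: kappa Y w.
Proof.
move=> xY; apply/ffunP=> S; rewrite conxE !ffunE.
have dU : [disjoint S & Y] = (x \notin S) && [disjoint S & Y :\ x].
  rewrite -{1}(setD1K xY) -!setI_eq0 setIUr setU_eq0; congr (_ && _).
  by rewrite setI_eq0 disjoint_sym disjoints1.
rewrite dU; case: ifPn => [_|xS] /=; first by rewrite scaler0.
have -> : [disjoint x |: S & Y :\ x] = [disjoint S & Y :\ x].
  by rewrite -!setI_eq0 setIUl (_ : [set x] :&: _ = set0) ?set0U //; apply/setP=> z; rewrite !inE; case: eqVneq.
case: ifP => _; last by rewrite mulr0 scaler0.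
rewrite (_ : x |: S :|: Y :\ x = S :|: Y); last first.
  by rewrite -[in RHS](setD1K xY) setUCA setUA.
rewrite -[_ *: _]/(_ * _) (big_setD1 x xY) /= !mulrA; congr (_ * _).
rewrite (dsgD1 K x xY) etaxx mul1r -mulrA mulrCA; congr (_ * _).
by rewrite /dsg -big_split; apply: eq_bigr => z _; rewrite sgU1.
Qed.

Lemma kappaD1 x Y w : x \in Y ->
  kappa Y w = dsg x Y *: con (ecoord x) (kappa (Y :\ x) w).
Proof. by move=> xY; rewrite con_kappa // scalerA dsg_sq scale1r. Qed.

Lemma kappa_LamV n Y w : w \in LamV n set0 N -> kappa Y w \in LamV (n - #|Y|) Y N.
Proof.
move=> wV; move: {2}#|Y| (erefl #|Y|) => k; elim: k Y => [|k IH] Y cY.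
  by move/eqP: cY; rewrite cards_eq0 => /eqP->; rewrite kappa_set0 cards0 subn0.
have [x xY] : exists x, x \in Y by apply/set0Pn; rewrite -card_gt0 cY.
have cYx : #|Y :\ x| = k by have := cardsD1 x Y; rewrite xY cY => -[].
rewrite (kappaD1 _ xY); apply: memvZ.
by have := con_coord_LamV x (IH _ cYx); rewrite setD1K // cYx cY -subnS.
Qed.

(** Contraction by [x] is undone by wedging with a vector dual to [x]; as this vector avoids the
    other labels of [H], labels can be treated one at a time. *)
Lemma kappa_surj H n Y w : H \in L -> Y \subset X H -> w \in LamV n Y N ->
  exists2 y : Lam, y \in LamV (n + #|Y|) set0 N & kappa Y y = w.
Proof.
move=> HL; move: {2}#|Y| (erefl #|Y|) => k; elim: k Y n w => [|k IH] Y n w cY YX wV.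
  exists w; last by move/eqP: cY; rewrite cards_eq0 => /eqP->; rewrite kappa_set0.
  by rewrite cY addn0; apply: LamVS wV; apply: sub0set.
have [x xY] : exists x, x \in Y by apply/set0Pn; rewrite -card_gt0 cY.
have cYx : #|Y :\ x| = k by have := cardsD1 x Y; rewrite xY cY => -[].
have [u [su ux u0]] := dual_label HL (subsetP YX _ xY).
have wuV : wed u w \in LamV n.+1 (Y :\ x) N.
  apply: wed_LamV => // [z /su|]; last by apply: LamVS wV; apply: subD1set.
  rewrite !inE => /andP[zX ->]; rewrite andbT; apply: contra zX => /andP[->].
  exact: (subsetP YX).
have [||y yV yk] := IH (Y :\ x) n.+1 (dsg x Y *: wed u w) cYx.
- by apply: subset_trans YX; apply: subD1set.
- exact: memvZ.
exists y; first by rewrite cY addnS -addSn -cYx.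
rewrite (kappaD1 _ xY) yk linearZ /= scalerA dsg_sq scale1r.
have := con_wed (ecoord x) u w.
rewrite (con_coord0 xY wV) linear0 addr0 => ->.
rewrite (bigD1 x) //= big1 => [|z /negPf zx]; rewrite /ecoord ?zx ?mul0r //.
by rewrite eqxx ux mul1r addr0 scale1r.
Qed.

(** Up to sign, the coefficient of [w] at [S] is that of [kappa Y w] at [S :\: Y]. Thus the
    condition on [set0] in [row_exact] says that the row is continued by [kappa]. *)
Lemma kappa_eq0 Y w S : kappa Y w = 0 -> Y \subset S -> w S = 0.
Proof.
have dSY : [disjoint S :\: Y & Y] by rewrite disjoint_sym disjoints_subset; apply/subsetP=> z; rewrite !inE => ->.
move=> /ffunP/(_ (S :\: Y)) + YS; rewrite !ffunE dSY.
rewrite (_ : _ :|: Y = S); last first.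
  by apply/setP=> z; rewrite !inE; have := subsetP YS z; case: (z \in Y) => [/(_ isT)->|_]; rewrite ?orbF.
move/eqP; rewrite mulf_eq0 => /orP[/eqP p0|/eqP //].
have /eqP : (\prod_(x in Y) sg x (S :\: Y)) * (\prod_(x in Y) sg x (S :\: Y)) = 1 :> K.
  by rewrite -big_split big1 // => x _; apply: sg_sq.
by rewrite p0 mul0r eq_sym oner_eq0.
Qed.

(** * Exactness of [C_n] after all cuts *)

Definition delta (f : P -> Lam) H : Lam :=
  \sum_(x in X H) con (ecoord x) (f (rm H x)).

(** [kappa] maps the column of [set0] to [C_n] as a chain map, because the sign chosen in [cobd] is
    the one that [con_kappa] produces. *)
Lemma kappa_cobd (y : P -> {set E} -> Lam) H : H \in L ->
  kappa (X H) (cobd y H set0) = delta (fun G => kappa (X G) (y G set0)) H.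
Proof.
move=> HL; rewrite /cobd setD0 linear_sum; apply: eq_bigr => x xX.
by rewrite linearZ /= (rmX HL xX) con_kappa.
Qed.

(** Lift [f] through [kappa] to the column of [set0], solve in the double complex, and push the
    primitive down again. *)
Lemma delta_exact n q (f : P -> Lam) : (q < n)%N -> (q < r)%N ->
  (forall H, H \in L -> #|X H| = q -> f H \in LamV (n - q) (X H) N) ->
  (forall H, ~~ ((H \in L) && (#|X H| == q)) -> f H = 0) ->
  (forall H, H \in L -> #|X H| = q.+1 -> delta f H = 0) ->
  exists g : P -> Lam, [/\
    forall H, H \in L -> #|X H|.+1 = q -> g H \in LamV (n - #|X H|) (X H) N,
    forall H, ~~ ((H \in L) && (#|X H|.+1 == q)) -> g H = 0
    & forall H, H \in L -> f H = delta g H].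
Proof.
move=> qn qr fV f0 df.
have /fin_all_exists [y yP] : forall H, exists y : Lam, y \in LamV n set0 N /\
    if (H \in L) && (#|X H| == q) then kappa (X H) y = f H else y = 0.
  move=> H; have [/andP[HL /eqP cX]|_] := boolP (_ && _); last by exists 0; rewrite mem0v.
  have [y] := kappa_surj HL (subxx _) (fV H HL cX).
  by rewrite cX subnK ?(ltnW qn) // => yV yk; exists y.
pose y0 H A : Lam := if A == set0 then y H else 0.
have yc : cochain n y0.
  split=> H A; rewrite /y0.
    by case: eqP => [->|_]; [have [] := yP H | exact: mem0v].
  by move=> HL; case: eqP => // _; have [_] := yP H; rewrite (negPf HL).
have ky H : H \in L -> kappa (X H) (y H) = f H.
  move=> HL; have [_] := yP H; rewrite HL /=; case: eqP => // cX ->.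
  by rewrite linear0 f0 // HL; apply/eqP.
have dy0 H : H \in L -> forall z, z \in X H -> rm H z \notin L -> f (rm H z) = 0.
  by move=> HL z zX nL; apply: f0; rewrite (negPf nL).
have kdy H : H \in L -> kappa (X H) (cobd y0 H set0) = delta f H.
  move=> HL; rewrite kappa_cobd //; apply: eq_bigr => x xX; congr con; rewrite /y0 eqxx.
  have [xL|xL] := boolP (rm H x \in L); first exact: ky.
  by rewrite dy0 //; have [_] := yP (rm H x); rewrite (negPf xL) => ->; rewrite linear0.
have [H S HL cX XS|x [c [[xV xL] [cV cL] yxc]]] := double_complex_exact (s := 0) qn qr yc.
  by apply: kappa_eq0 XS; rewrite kdy // df.
exists (fun H => if (H \in L) && (#|X H|.+1 == q) then kappa (X H) (x H set0) else 0).
split=> [H HL cX|H /negPf->//|H HL].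
  by rewrite HL cX eqxx; apply: kappa_LamV.
have [cX|cX] := eqVneq #|X H| q; last first.
  rewrite f0 ?HL // /delta big1 // => z zX; case: ifP => [/andP[_]|_]; last exact: linear0.
  have := cardsD1 z (X H); rewrite zX (rmX HL zX) add1n => <- /eqP cX'.
  by rewrite cX' eqxx in cX.
have := yxc H set0 HL (sub0set _) (cards0 _); rewrite addn0 => /(_ cX).
rewrite {1}/y0 eqxx => yE; rewrite -ky // yE linearD /= kappa_cobd //.
(* The [bdry] term dies under [kappa]: its summand for [z] contains no [z] to be contracted. *)
rewrite [X in _ + X](_ : _ = 0) ?addr0; last first.
  rewrite /bdry setD0 linear_sum big1 // => z zX; rewrite linearZ /=.
  rewrite (_ : kappa _ _ = 0) ?scaler0 //.
  apply/ffunP=> S; rewrite !ffunE; case: ifP => // _; apply/eqP.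
  rewrite mulf_eq0 -[X in _ || X]negbK; apply/orP; right; apply/negP.
  have /LamVP[h _] := cV H (z |: set0) => /h[/subsetP/(_ z)].
  by rewrite !inE zX orbT eqxx => /(_ isT).
apply: eq_bigr => z zX; congr con.
have := cardsD1 z (X H); rewrite zX -(rmX HL zX) add1n cX => <-; rewrite eqxx andbT.
by case: ifPn => // zL; rewrite xL // linear0.
Qed.

(** * The complexes [C_n] and the cut by one hyperplane *)

Local Notation Om := {ffun P * {set E} -> K^o}.
Implicit Types z : Om.

Definition slice z H : Lam := [ffun S => z (H, S)].

Definition conO phi z : Om := [ffun HS => con phi (slice z HS.1) HS.2].

Definition deltaO z : Om :=
  [ffun HS => if HS.1 \in L then delta (slice z) HS.1 HS.2 else 0].

Lemma slice_is_linear H : linear (slice^~ H).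
Proof. by move=> a z1 z2; apply/ffunP=> S; rewrite !ffunE. Qed.

Lemma sliceP z1 z2 : (forall H, slice z1 H = slice z2 H) -> z1 = z2.
Proof. by move=> z12; apply/ffunP=> -[H S]; have /ffunP/(_ S) := z12 H; rewrite !ffunE. Qed.

Lemma slice_conO phi z H : slice (conO phi z) H = con phi (slice z H).
Proof. by apply/ffunP=> S; rewrite ffunE [LHS]ffunE. Qed.

Lemma slice_deltaO z H :
  slice (deltaO z) H = if H \in L then delta (slice z) H else 0.
Proof.
by apply/ffunP=> S; rewrite ffunE [LHS]ffunE /=; case: ifP => // _; rewrite ffunE.
Qed.

Lemma conO_is_linear phi : linear (conO phi).
Proof.
by move=> a z1 z2; apply: sliceP => H; rewrite slice_is_linear !slice_conO slice_is_linear linearP.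
Qed.
HB.instance Definition _ phi := GRing.isLinear.Build K Om Om _ (conO phi) (conO_is_linear phi).

Lemma deltaO_is_linear : linear deltaO.
Proof.
move=> a z1 z2; apply: sliceP => H; rewrite slice_is_linear !slice_deltaO.
case: ifP => _; last by rewrite scaler0 addr0.
rewrite /delta scaler_sumr -big_split /=; apply: eq_bigr => x _.
by rewrite slice_is_linear linearP.
Qed.
HB.instance Definition _ := GRing.isLinear.Build K Om Om _ deltaO deltaO_is_linear.

Lemma deltaO_conO phi z : deltaO (conO phi z) = - conO phi (deltaO z).
Proof.
apply: sliceP => H; rewrite slice_deltaO.
have -> : slice (- conO phi (deltaO z)) H = - con phi (slice (deltaO z) H).
  by rewrite -slice_conO; apply/ffunP=> S; rewrite !ffunE.
rewrite slice_deltaO; case: ifP => _; last by rewrite linear0 oppr0.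
rewrite /delta linear_sum -sumrN; apply: eq_bigr => x _.
by rewrite slice_conO con_anti.
Qed.

(* The term of position [q] of the complex [C_n] for the common kernel of the
   first [p] weights: the cochains with [slice z H] in [LamV (n - q) (X H) p]. *)
Definition Zsp n q p : {vspace Om} :=
  (coord_space K (fun HS : P * {set E} => [&& HS.1 \in L, #|X HS.1| == q,
      HS.2 \subset (Xv :\: X HS.1)%SET & (#|HS.2| + q == n)%N])
   :&: \bigcap_(l < p) lker (linfun (conO (wt l))))%VS.

Lemma ZspP n q p z : reflect
  ((forall H S, z (H, S) != 0 -> [/\ H \in L, #|X H| = q, S \subset Xv :\: X H
       & (#|S| + q)%N = n]) /\
   (forall l, (l < p)%N -> conO (wt l) z = 0)) (z \in Zsp n q p).
Proof.
rewrite memv_cap; apply: (iffP andP) => -[h1 h2]; split.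
- by move=> H S /(coord_spaceP _ _ h1)/and4P[? /eqP ? ? /eqP].
- move=> l lp; move: h2; rewrite memvE => /subv_bigcapP/(_ (Ordinal lp) isT).
  by rewrite -memvE memv_ker lfunE => /eqP.
- by apply/coord_spaceP=> -[H S] /h1[/= -> -> -> ->]; rewrite !eqxx.
- rewrite memvE; apply/subv_bigcapP=> l _; rewrite -memvE memv_ker lfunE.
  by rewrite /= h2 // ltn_ord.
Qed.

Lemma slice_LamV n q p z H : z \in Zsp n q p -> H \in L -> #|X H| = q ->
  slice z H \in LamV (n - q) (X H) p.
Proof.
move=> /ZspP[h1 h2] HL cX; apply/LamVP; split=> [S|l lp].
  by rewrite ffunE => /h1[_ _ -> <-]; rewrite addnK.
by rewrite -slice_conO h2 //; apply/ffunP=> S; rewrite !ffunE.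
Qed.

Lemma Zsp_slice n q p z : (q <= n)%N ->
  (forall H, H \in L -> #|X H| = q -> slice z H \in LamV (n - q) (X H) p) ->
  (forall H, ~~ ((H \in L) && (#|X H| == q)) -> slice z H = 0) -> z \in Zsp n q p.
Proof.
move=> qn zV z0; have zLam H : slice z H \in LamV (n - q) (X H) p.
  have [/andP[HL /eqP cX]|nH] := boolP ((H \in L) && (#|X H| == q)); first exact: zV.
  by rewrite z0 ?mem0v.
apply/ZspP; split=> [H S nz|l lp].
  have zHS : slice z H S != 0 by rewrite ffunE.
  have [/andP[HL /eqP cX]|nH] := boolP ((H \in L) && (#|X H| == q)); last first.
    by rewrite z0 // ffunE eqxx in zHS.
  by have /LamVP[/(_ _ zHS)[-> ->] _] := zLam H; rewrite subnK.
apply: sliceP => H; rewrite slice_conO; have /LamVP[_ -> //] := zLam H.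
by apply/ffunP=> S; rewrite !ffunE.
Qed.

Lemma deltaO_Zsp n q p z : z \in Zsp n q p -> deltaO z \in Zsp n q.+1 p.
Proof.
move=> /ZspP[h1 h2]; apply/ZspP; split=> [H S|l lp]; last first.
  by apply/eqP; rewrite -oppr_eq0 -deltaO_conO h2 // linear0.
rewrite ffunE /=; case: ifP; rewrite ?eqxx // => HL; rewrite sum_ffunE => nz.
have [x xX] : exists2 x, x \in X H & con (ecoord x) (slice z (rm H x)) S != 0.
  apply/exists_inP; apply: contraNT nz => /exists_inPn nz; apply/eqP.
  by apply: big1 => x /nz; rewrite negbK => /eqP.
rewrite conxE; case: ifPn; rewrite ?eqxx // => xS.
rewrite mulf_eq0 negb_or ffunE => /andP[_ /h1[xL]].
have := cardsD1 x (X H); rewrite xX (rmX HL xX) => -> <-.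
rewrite cardsU1 xS => + <-; rewrite subUset => /andP[_ sS]; split=> //; last by lia.
apply/subsetP=> y yS; have := subsetP sS y yS; rewrite !inE => /andP[+ ->].
by rewrite !andbT; apply: contra => ->; rewrite andbT; apply: contraNneq xS => <-.
Qed.

Lemma deltaO_sq n q p z : z \in Zsp n q p -> deltaO (deltaO z) = 0.
Proof.
move=> /ZspP[h1 _]; have zL H : H \notin L -> slice z H = 0.
  by move=> nH; apply/ffunP=> S; rewrite !ffunE; apply/eqP; apply: contraNT nH => /h1[].
apply: sliceP => H; rewrite slice_deltaO (_ : slice 0 H = 0); last by apply/ffunP=> S; rewrite !ffunE.
case: ifP => // HL; pose f x y : Lam := if y == x then 0 else
  con (ecoord x) (con (ecoord y) (slice z (rm (rm H x) y))).
rewrite /delta (eq_bigr (fun x => \sum_(y in X H) f x y)) => [|x xX]; last first.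
  rewrite slice_deltaO; case: ifPn => xL.
    rewrite /delta (rmX HL xX) sum_setD1 linear_sum; apply: eq_bigr => y _ /=.
    by rewrite /f; case: ifP => _; rewrite ?linear0.
  rewrite linear0 big1 // => y yX; rewrite /f; case: eqVneq => // yx.
  rewrite zL ?linear0 //; apply: contra xL; apply: rmL => //; by rewrite eq_sym.
apply: sum_antisym => [x _|x y xX yX]; first by rewrite /f eqxx.
rewrite /f eq_sym; case: eqVneq => [|xy]; first by rewrite oppr0.
by rewrite con_anti (rmC HL xX yX xy).
Qed.

Lemma conO_Zsp n q p z : z \in Zsp n.+1 q p -> conO (wt p) z \in Zsp n q p.+1.
Proof.
move=> /ZspP[h1 h2]; apply/ZspP; split=> [H S|l].
  rewrite ffunE /= => /con_supp[x xS]; rewrite ffunE => /h1[-> ->].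
  by rewrite subUset cardsU1 xS => /andP[_ ->] [].
have anti : conO (wt l) (conO (wt p) z) = - conO (wt p) (conO (wt l) z).
  apply: sliceP => H; rewrite !slice_conO con_anti -!slice_conO.
  by apply/ffunP=> S; rewrite !ffunE.
rewrite ltnS leq_eqVlt => /orP[/eqP lp|lp]; last by rewrite anti h2 // linear0 oppr0.
rewrite lp; apply: sliceP => H; rewrite !slice_conO con_sq.
by apply/ffunP=> S; rewrite !ffunE.
Qed.

Lemma Zsp0 q p z : z \in Zsp 0 q p -> conO (wt p) z = 0.
Proof.
move=> /ZspP[h1 _]; apply/ffunP=> -[H S]; rewrite [RHS]ffunE; apply/eqP.
rewrite -[_ == _]negbK; apply/negP; rewrite ffunE => /con_supp[x xS]; rewrite ffunE => /h1[_ _ _].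
by rewrite cardsU1 xS.
Qed.

Lemma conO_ker n q p : (Zsp n q p :&: lker (linfun (conO (wt p))))%VS = Zsp n q p.+1.
Proof.
apply/vspaceP=> z; rewrite memv_cap memv_ker lfunE /=.
apply/andP/ZspP => [[/ZspP[h1 h2] /eqP h3]|[h1 h2]].
  by split=> // l; rewrite ltnS leq_eqVlt => /orP[/eqP->|/h2].
by split; [apply/ZspP; split=> // l lp; apply: h2; lia | rewrite h2].
Qed.

(** On each face a preimage is the wedge with a vector dual to the weight [p] and orthogonal to the
    earlier ones. With [conO_ker] this is the short exact sequence of the hyperplane cut. *)
Lemma conO_img n q p : (p < N)%N ->
  (linfun (conO (wt p)) @: Zsp n.+1 q p)%VS = Zsp n q p.+1.
Proof.
move=> pN; apply/vspaceP=> z; apply/memv_imgP/idP => [[z' z'Z ->]|zZ].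
  by rewrite lfunE; apply: conO_Zsp.
have [nq|qn] := ltnP n q.
  exists 0; rewrite ?mem0v // linear0; apply/ffunP=> -[H S]; rewrite [RHS]ffunE; apply/eqP.
  by apply: contraTT nq => nz; have /ZspP[/(_ _ _ nz)[_ _ _ <-] _] := zZ; rewrite -leqNgt leq_addl.
have /fin_all_exists [u uP] : forall H, exists u : E -> K, H \in L ->
   (forall y, u y != 0 -> y \in Xv :\: X H) /\
    forall l, (l < N)%N -> \sum_y wt l y * u y = (l == p)%:R.
  move=> H; have [HL|_] := boolP (H \in L); last by exists (fun=> 0).
  by have [u] := dual_weight (XXv HL) (Xd HL) pN; exists u.
pose z' : Om := [ffun HS => if (HS.1 \in L) && (#|X HS.1| == q) then
   wed (u HS.1) (slice z HS.1) HS.2 else 0].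
have sz' H : slice z' H = if (H \in L) && (#|X H| == q) then wed (u H) (slice z H) else 0.
  by apply/ffunP=> S; rewrite ffunE [LHS]ffunE /=; case: ifP => // _; rewrite ffunE.
exists z'.
  apply: Zsp_slice => [|H HL cX|H /negPf nH]; [lia| |by rewrite sz' nH].
  have [su u1] := uP H HL; rewrite sz' HL cX eqxx subSn //; apply: wed_LamV => //.
    by move=> l lp; rewrite u1 ?(ltn_eqF lp) //; lia.
  apply/LamVP; have /LamVP[h1 h2] := slice_LamV zZ HL cX; split=> // l lp.
  by apply: h2; lia.
rewrite lfunE; apply: sliceP => H; rewrite slice_conO sz'.
have [/andP[HL /eqP cX]|nH] := boolP ((H \in L) && (#|X H| == q)).
  have [_ u1] := uP H HL; have := con_wed (wt p) (u H) (slice z H).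
  have /LamVP[_ h2] := slice_LamV zZ HL cX.
  by rewrite h2 // linear0 addr0 u1 // eqxx scale1r.
rewrite linear0; apply/ffunP=> S; rewrite !ffunE; apply/eqP; apply: contraNT nH => nz.
by have /ZspP[/(_ _ _ nz)[-> -> _ _] _] := zZ; rewrite eqxx.
Qed.

Lemma dim_Zsp_step n q p : (p < N)%N ->
  \dim (Zsp n.+1 q p) = (\dim (Zsp n.+1 q p.+1) + \dim (Zsp n q p.+1))%N.
Proof. by move=> pN; rewrite -(limg_ker_dim (linfun (conO (wt p)))) conO_ker conO_img. Qed.

Lemma Zsp0_step q p : Zsp 0 q p.+1 = Zsp 0 q p.
Proof.
rewrite -conO_ker; apply/capv_idPl/subvP=> z zZ.
by rewrite memv_ker lfunE /= (Zsp0 zZ).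
Qed.

Definition rk n q p := \dim (linfun deltaO @: Zsp n q p).

(** [conO] anticommutes with [deltaO], so it maps the middle image onto the image in the quotient
    term, with a kernel containing the image of the subcomplex. A nonzero connecting map makes the
    inequality strict. *)
Lemma rk_step n q p : (p < N)%N -> (rk n.+1 q p.+1 + rk n q p.+1 <= rk n.+1 q p)%N.
Proof.
move=> pN; rewrite /rk -[leqRHS](limg_ker_dim (linfun (conO (wt p)))).
apply: leq_add; apply: dimvS; apply/subvP=> z; last first.
  case/memv_imgP=> y; rewrite -conO_img // => /memv_imgP[x xZ ->] ->.
  rewrite !lfunE /= deltaO_conO memvN; apply/memv_imgP; exists (deltaO x); last by rewrite lfunE.
  by apply/memv_imgP; exists x; rewrite ?lfunE.
case/memv_imgP=> y yZ ->; rewrite memv_cap memv_ker !lfunE /=.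
move: yZ; rewrite -conO_ker memv_cap memv_ker lfunE /= => /andP[yZ /eqP y0].
apply/andP; split; first by apply/memv_imgP; exists y; rewrite ?lfunE.
by rewrite -oppr_eq0 -deltaO_conO y0 linear0.
Qed.

Lemma rk_exact n q : (q < n)%N -> (q < r)%N ->
  \dim (Zsp n q N) = ((if q is q'.+1 then rk n q' N else 0) + rk n q N)%N.
Proof.
move=> qn qr; rewrite -(limg_ker_dim (linfun deltaO) (Zsp n q N)).
set U := (_ :&: _)%VS; suff -> : \dim U = if q is q'.+1 then rk n q' N else 0%N by [].
have Uex z : z \in U -> exists g : P -> Lam, [/\
    forall H, H \in L -> #|X H|.+1 = q -> g H \in LamV (n - #|X H|) (X H) N,
    forall H, ~~ ((H \in L) && (#|X H|.+1 == q)) -> g H = 0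
    & forall H, H \in L -> slice z H = delta g H].
  rewrite memv_cap memv_ker lfunE /= => /andP[zZ /eqP z0].
  apply: delta_exact => // [H HL cX|H nH|H HL cX]; first exact: slice_LamV.
    apply/ffunP=> S; rewrite !ffunE; apply/eqP; apply: contraNT nH => nz.
    by have /ZspP[/(_ _ _ nz)[-> -> _ _] _] := zZ; rewrite eqxx.
  by have := slice_deltaO z H; rewrite z0 HL => <-; apply/ffunP=> S; rewrite !ffunE.
have Uz z H : z \in U -> H \notin L -> slice z H = 0.
  rewrite memv_cap => /andP[/ZspP[h _] _] nH; apply/ffunP=> S; rewrite !ffunE.
  by apply/eqP; apply: contraNT nH => /h[].
case: q @U qn qr Uex Uz => [|q] U qn qr Uex Uz.
  apply/eqP; rewrite dimv_eq0 -subv0; apply/subvP=> z zU; rewrite memv0; apply/eqP.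
  have [g [_ g0 zg]] := Uex z zU; apply: sliceP => H.
  rewrite (_ : slice 0 H = 0); last by apply/ffunP=> S; rewrite !ffunE.
  have [HL|/(Uz z H zU)-> //] := boolP (H \in L).
  by rewrite zg // /delta big1 // => x _; rewrite g0 ?andbF // linear0.
congr (\dim _); apply/vspaceP=> z; apply/idP/memv_imgP => [zU|[y yZ ->]]; last first.
  by rewrite /U memv_cap memv_ker !lfunE /= deltaO_Zsp //= (deltaO_sq yZ).
have [g [gV g0 zg]] := Uex z zU; pose y : Om := [ffun HS => g HS.1 HS.2].
have sy H : slice y H = g H by apply/ffunP=> S; rewrite !ffunE.
exists y.
  apply: Zsp_slice => [|H HL cX|H nH]; first lia.
    by rewrite sy -cX gV // cX.
  by rewrite sy g0 // eqSS.
rewrite lfunE; apply: sliceP => H; rewrite slice_deltaO.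
case: ifPn => [HL|/(Uz z H zU) //].
by rewrite zg //; apply: eq_bigr => x _; rewrite sy.
Qed.

(** * Dimensions, truncated alternating sums and weights *)

Definition fL q := #|[set H in L | #|X H| == q]|.

(** Without weights one counts the sets [S] in [Xv :\: X H]; each further weight is one application
    of Pascal's rule through [dim_Zsp_step]. *)
Lemma dim_Zsp n q p : (p <= N)%N ->
  \dim (Zsp n q p) = (fL q * (if (q <= n)%N then 'C(N - p + d - q, n - q) else 0))%N.
Proof.
elim: p n => [|p IH] n pN.
  rewrite /Zsp big_ord0 capvf dim_coord_space -sum1_card.
  rewrite (eq_bigl (fun HS : P * {set E} => ((HS.1 \in L) && (#|X HS.1| == q)) &&
     ((HS.2 \subset Xv :\: X HS.1) && (#|HS.2| + q == n)%N))) => [|HS]; last by rewrite -andbA.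
  rewrite -(pair_big_dep (fun H => (H \in L) && (#|X H| == q))
     (fun H S => (S \subset Xv :\: X H) && (#|S| + q == n)%N) (fun _ _ => 1%N)) /=.
  rewrite /fL -sum_nat_const; apply: eq_big => [H|H /andP[HL /eqP cX]]; first by rewrite inE.
  rewrite sum1dep_card; case: leqP => qn.
    have -> : (N - 0 + d - q)%N = #|Xv :\: X H|.
      by rewrite cardsD (setIidPr (XXv HL)) XvN cX subn0.
    rewrite -cards_draws; apply: eq_card => S.
    by rewrite !inE -{1}(subnK qn) eqn_add2r.
  by apply: eq_card0 => S; rewrite !inE; apply/negP=> /andP[_ /eqP]; lia.
elim: n => [|n IHn]; first by rewrite Zsp0_step IH ?(ltnW pN) // sub0n !bin0.
have := dim_Zsp_step n q pN; rewrite IH ?(ltnW pN) // IHn.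
have [f0|f_gt0] := posnP (fL q); first by rewrite f0 !mul0n addn0.
(* Some face has [q] labels, so the subtraction of [q] below is not truncated. *)
have qd : (q <= d)%N.
  by have /card_gt0P[H] := f_gt0; rewrite inE => /andP[/Xd + /eqP <-].
have [qn|nq|->] := ltngtP q n.+1.
- rewrite ltnS in qn; rewrite qn.
  have -> : (N - p + d - q = (N - p.+1 + d - q).+1)%N by lia.
  by rewrite subSn // binS mulnDr => /addIn.
- by rewrite leqNgt (ltnW nq) /= muln0 addn0 => <-.
- by rewrite ltnn subnn !bin0 muln0 addn0 => <-.
Qed.

(* By telescoping, the alternating sum of the dimensions of the cohomology of
   [C_n] in the positions up to [I]. *)
Definition tau I p n : rat :=
  \sum_(0 <= q < I.+1) (-1) ^+ (I - q) * (\dim (Zsp n q p))%:R - (rk n I p)%:R.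

Lemma tau_step I p n : (p < N)%N -> tau I p n.+1 <= tau I p.+1 n.+1 + tau I p.+1 n.
Proof.
move=> pN; rewrite /tau; under eq_bigr do rewrite dim_Zsp_step // natrD mulrDr.
rewrite big_split /= addrACA lerD2l -opprD lerN2 -natrD ler_nat.
exact: rk_step.
Qed.

Lemma tau0_step I p : tau I p.+1 0 = tau I p 0.
Proof. by rewrite /tau /rk Zsp0_step; under eq_bigr do rewrite Zsp0_step. Qed.

(** Beyond the dimension N - p + d of the space all terms are zero, and only a rank with a minus
    sign could remain. *)
Lemma tau_top I p s : (p <= N)%N -> (N - p + d < s)%N -> tau I p s <= 0.
Proof.
move=> pN sp; rewrite /tau big1 ?sub0r ?oppr_le0 ?ler0n // => q _.
rewrite dim_Zsp //; have [qd|dq] := leqP q d.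
  by case: ifP => _; rewrite ?bin_small ?muln0 ?mulr0 //; lia.
suff -> : fL q = 0%N by rewrite mul0n mulr0.
apply/eqP; rewrite cards_eq0; apply/eqP/setP=> H; rewrite !inE; apply/negP.
by case/andP=> /Xd + /eqP; lia.
Qed.

Lemma tau_exact I n : (I < n)%N -> (I < r)%N -> tau I N n = 0.
Proof.
rewrite /tau; elim: I => [|I IH] In Ir.
  by rewrite big_nat1 subnn mul1r rk_exact // subrr.
rewrite big_nat_recr //= subnn mul1r rk_exact // natrD addrA addrK.
rewrite [X in X + _](_ : _ = - \sum_(0 <= q < I.+1) (-1) ^+ (I - q) * (\dim (Zsp n q N))%:R).
  by apply/eqP; rewrite addrC subr_eq0 eq_sym -subr_eq0 IH ?(ltnW In) ?(ltnW Ir).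
rewrite -sumrN; apply: eq_big_nat => q qI.
by rewrite subSn ?exprS ?mulN1r ?mulNr //; lia.
Qed.

Definition beta s n : rat := (n`! * (s - n)`!)%:R / (s.+1)`!%:R.

Lemma beta_rec s n : (n <= s)%N -> beta s n = beta s.+1 n + beta s.+1 n.+1.
Proof.
move=> ns; rewrite /beta subSS subSn // -mulrDl -natrD.
have -> : (n`! * (s - n).+1`! + n.+1`! * (s - n)`! = s.+2 * (n`! * (s - n)`!))%N.
  rewrite !factS mulnCA -!mulnA -mulnDl; congr (_ * _)%N; lia.
rewrite [s.+2`!]factS !(natrM _ s.+2) -mulf_div divff ?mul1r //.
by rewrite pnatr_eq0.
Qed.

Lemma beta_ge0 s n : 0 <= beta s n.
Proof. by rewrite divr_ge0 ?ler0n. Qed.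

(** After [tau_step], each [tau I p.+1 n] is collected from two neighbouring terms, and [beta_rec]
    adds their weights to the one for the smaller space. The unmatched top term is nonpositive by
    [tau_top]. *)
Lemma sum_beta_tau_step I p : (p < N)%N ->
  \sum_(0 <= n < (N - p + d).+1) beta (N - p + d) n * tau I p n <=
  \sum_(0 <= n < (N - p.+1 + d).+1) beta (N - p.+1 + d) n * tau I p.+1 n.
Proof.
move=> pN; have -> : (N - p + d = (N - p.+1 + d).+1)%N by lia.
set s := (N - p.+1 + d)%N.
rewrite big_nat_recl //.
apply: (@le_trans _ _ (beta s.+1 0 * tau I p.+1 0 +
   \sum_(0 <= n < s.+1) beta s.+1 n.+1 * (tau I p.+1 n.+1 + tau I p.+1 n))).
  rewrite tau0_step lerD2l; apply: ler_sum => n _.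
  by apply: ler_wpM2l; [exact: beta_ge0 | exact: tau_step].
under eq_bigr do rewrite mulrDr.
rewrite big_split /= addrA -(big_nat_recl s.+1 0 (fun n => beta s.+1 n * tau I p.+1 n)) //.
rewrite big_nat_recr //= addrAC -big_split /=.
rewrite (eq_big_nat _ _ (F2 := fun n => beta s n * tau I p.+1 n)) => [|n ns]; last first.
  by rewrite -mulrDl -beta_rec //; lia.
rewrite gerDl; apply: mulr_ge0_le0; first exact: beta_ge0.
by apply: tau_top; rewrite // /s; lia.
Qed.

Definition hL n : rat :=
  \sum_(0 <= q < n.+1) (-1) ^+ (n - q) * 'C(d - q, n - q)%:R * (fL q)%:R.

Lemma sum_beta_tau_le I : (I < r)%N -> (I <= d)%N ->
  \sum_(0 <= n < (N + d).+1) beta (N + d) n * tau I 0 n <=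
  \sum_(0 <= n < I.+1) beta d n * ((-1) ^+ (I - n) * hL n).
Proof.
move=> Ir Id.
apply: (@le_trans _ _ (\sum_(0 <= n < d.+1) beta d n * tau I N n)).
  have : forall p, (p <= N)%N ->
     \sum_(0 <= n < (N + d).+1) beta (N + d) n * tau I 0 n <=
     \sum_(0 <= n < (N - p + d).+1) beta (N - p + d) n * tau I p n.
    elim=> [|p IH] pN; first by rewrite subn0.
    exact: le_trans (IH (ltnW pN)) (sum_beta_tau_step _ pN).
  by move/(_ N (leqnn N)); rewrite subnn add0n.
rewrite (big_cat_nat (n := I.+1)) //= [X in _ + X]big_nat_cond [X in _ + X]big1 ?addr0; last first.
  by move=> n /andP[/andP[In _] _]; rewrite tau_exact ?mulr0.
rewrite !big_nat; apply: ler_sum => n /andP[_ nI]; apply: ler_wpM2l; first exact: beta_ge0.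
(* Dropping the rank only increases the right side. Positions [q > n] would need exterior powers of
   negative degree, so what is left is [hL n] up to sign. *)
rewrite /tau lerBlDr ler_wpDr ?ler0n // (big_cat_nat (n := n.+1)) //= [X in _ + X]big_nat_cond [X in _ + X]big1 ?addr0.
  rewrite /hL big_distrr /=; rewrite le_eqVlt; apply/orP; left; apply/eqP/eq_big_nat => q qn.
  rewrite dim_Zsp // subnn add0n; have -> : (q <= n)%N by lia.
  rewrite natrM mulrA [X in _ = X](_ : _ = ((-1) ^+ (I - n) * (-1) ^+ (n - q)) * (fL q)%:R * 'C(d - q, n - q)%:R); last by ring.
  by rewrite -exprD; congr (_ ^+ _ * _ * _); lia.
move=> q /andP[/andP[nq _] _]; rewrite dim_Zsp //; have -> : (q <= n)%N = false by lia.
by rewrite muln0 mulr0.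
Qed.

(* The copy in [Zsp #|W| q 0] of the cochains of the subcomplex induced on [W]. *)
Definition Wsp (W : {set E}) q : {vspace Om} := coord_space K (fun HS : P * {set E} =>
  [&& HS.1 \in L, #|X HS.1| == q, X HS.1 \subset W & HS.2 == (W :\: X HS.1)%SET]).

(** A coordinate (H, S) belongs to W = S :|: X H, and the image of a sum is the sum of the images.
    An upper bound is what is needed, since [tau] contains this rank negatively. *)
Lemma rk0_le n q : (rk n q 0 <=
  \sum_(W : {set E} | (W \subset Xv) && (#|W| == n)) \dim (linfun deltaO @: Wsp W q))%N.
Proof.
have sZ : (Zsp n q 0 <= \sum_(W : {set E} | (W \subset Xv) && (#|W| == n)) Wsp W q)%VS.
  apply/subvP=> z /ZspP[h _].
  have -> : z = \sum_(W : {set E} | (W \subset Xv) && (#|W| == n))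
      mask (fun HS : P * {set E} => (HS.2 \subset Xv :\: X HS.1) && (HS.2 :|: X HS.1 == W)) z.
    apply/ffunP=> -[H S]; rewrite sum_ffunE.
    have [z0|nz] := eqVneq (z (H, S)) 0.
      by rewrite z0 big1 // => W _; rewrite ffunE z0; case: ifP.
    have [HL cX sS cS] := h _ _ nz.
    have dS : [disjoint S & X H] by move: sS; rewrite subsetD => /andP[].
    rewrite (bigD1 (S :|: X H)) /=; last first.
      rewrite subUset (XXv HL) cardsU (disjoint_setI0 dS) cards0 subn0 cX cS eqxx !andbT.
      by apply: subset_trans sS (subsetDl _ _).
    rewrite ffunE /= sS eqxx /= big1 ?addr0 // => W /andP[_ nW].
    by rewrite ffunE /= eq_sym (negPf nW) andbF.
  apply: memv_sumr => W _; apply/coord_spaceP=> -[H S]; rewrite ffunE /=.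
  case: ifP; rewrite ?eqxx // => /andP[sS /eqP <-] /h[-> -> _ _]; rewrite eqxx subsetUr /=.
  rewrite setDUl setDv setU0; apply/eqP/esym/setDidPl.
  by move: sS; rewrite subsetD => /andP[].
rewrite /rk; apply: leq_trans (dimvS (limgS _ sZ)) _.
by rewrite limg_sum dimv_leq_sum.
Qed.
End LabelledComplex.

(** * Simplicial posets and their links *)

Section SimplicialPosetTheory.
Context {disp : Order.disp_t} {T : finPOrderType disp}.
Implicit Types (S C Y : {set T}) (F G H v w x y : T).

(** Cardinality is injective on a chain, which bounds its length; adding the elements of [A :\: A0]
    one at a time attains the bound. *)
Lemma max_chain_boolean n (f : {set 'I_n} -> T) (A0 A : {set 'I_n}) S :
  (forall B B' : {set 'I_n}, (f B <= f B')%O = (B \subset B')) -> A0 \subset A ->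
  (forall G, reflect (exists2 B : {set 'I_n}, (A0 \subset B) && (B \subset A) & G = f B) (G \in S)) ->
  (\max_(C : {set T} | (C \subset S) && chain C) #|C|)%N = (#|A| - #|A0|).+1.
Proof.
move=> fE sA SP; have f_inj : injective f.
  by move=> B B' fBC; apply/eqP; rewrite eqEsubset -!fE fBC lexx.
apply/eqP; rewrite eqn_leq; apply/andP; split.
  apply/bigmax_leqP=> C /andP[CS /forall_inP chC].
  pose C' := [set B | f B \in C].
  have -> : #|C| = #|C'|.
    rewrite -(card_imset _ f_inj); apply: eq_card => G; apply/idP/imsetP => [GC|[B]].
      by have /SP[B _ GB] := subsetP CS _ GC; exists B => //; rewrite inE -GB.
    by rewrite inE => + ->.
  have C'P B : B \in C' -> (A0 \subset B) && (B \subset A).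
    by rewrite inE => /(subsetP CS)/SP[B' + /f_inj->].
  pose g (B : {set 'I_n}) : 'I_(#|A| - #|A0|).+1 := inord (#|B| - #|A0|).
  rewrite -[leqRHS]card_ord -(card_in_imset (f := g)) ?max_card // => B1 B2 B1C B2C H0.
  have C'c B : B \in C' -> (#|A0| <= #|B| <= #|A|)%N.
    by move=> /C'P/andP[sB sBA]; rewrite !subset_leq_card.
  have /andP[a1 a2] := C'c _ B1C; have /andP[b1 b2] := C'c _ B2C.
  have cB : #|B1| = #|B2|.
    move/(congr1 val): H0; rewrite /= !inordK ?ltnS ?leq_sub2r // => cB.
    by rewrite -(subnK a1) cB subnK.
  rewrite !inE in B1C B2C.
  have /forall_inP/(_ _ B2C) := chC _ B1C.
  rewrite /Order.comparable !fE => /orP[] sB.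
    by apply/eqP; rewrite eqEcard sB cB /=.
  by apply/esym/eqP; rewrite eqEcard sB cB /=.
pose s := enum (A :\: A0).
have sz : size s = (#|A| - #|A0|)%N by rewrite -cardE cardsD (setIidPr sA).
pose B (j : 'I_(#|A| - #|A0|).+1) := A0 :|: [set x in take j s].
have Bmono (i j : 'I_(#|A| - #|A0|).+1) : (i <= j)%N -> B i \subset B j.
  move=> ij; apply: setUS; apply/subsetP=> x; rewrite !inE.
  by rewrite -(cat_take_drop i (take j s)) take_takel // mem_cat => ->.
have cardB j : #|B j| = (#|A0| + j)%N.
  rewrite /B cardsU (_ : _ :&: _ = set0) ?cards0 ?subn0.
    rewrite cardsE (card_uniqP _) ?take_uniq ?enum_uniq // size_takel //.
    by rewrite sz -ltnS ltn_ord.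
  apply/setP=> x; rewrite !inE; apply/negP=> /andP[xA /mem_take].
  by rewrite mem_enum inE xA.
have B_inj : injective (f \o B).
  by move=> i j /f_inj/(congr1 (fun D : {set _} => #|D|)); rewrite !cardB => /addnI/val_inj.
rewrite -[leqLHS]card_ord -cardsT -(card_imset _ B_inj).
set C := [set _ | _ in _].
apply: (@leq_bigmax_cond _ (fun C : {set T} => (C \subset S) && chain C) (fun C : {set T} => #|C|) C).
apply/andP; split.
  apply/subsetP=> _ /imsetP[j _ ->]; apply/SP; exists (B j) => //.
  rewrite subsetUl subUset sA; apply/subsetP=> x; rewrite inE => /mem_take.
  by rewrite mem_enum inE => /andP[].
apply/forall_inP=> _ /imsetP[i _ ->]; apply/forall_inP=> _ /imsetP[j _ ->].
by rewrite /Order.comparable /= !fE; case/orP: (leq_total i j) => /Bmono->; rewrite ?orbT.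
Qed.

Variables (D Gm : {set T}).
Hypothesis hD : simplicial_poset D.
Hypothesis GmD : Gm \subset D.
Hypothesis Gm_lower : forall F G, G \in Gm -> F \in D -> (F <= G)%O -> F \in Gm.
Local Notation V := (vertices_of D).

Lemma face_boolean F : F \in D -> exists n (f : {set 'I_n} -> T),
  [/\ forall A B : {set 'I_n}, (f A <= f B)%O = (A \subset B),
      f setT = F & forall G, G \in D -> (G <= F)%O -> exists A, G = f A] /\
      forall A, f A \in D.
Proof.
case: hD => b [[bD bmin] buniq bool] FD.
have bF G : G \in D -> (b <= G)%O.
  move=> GD; have [n [f [fE fI]]] := bool G GD.
  have : f set0 \in f @: setT by apply: imset_f.
  by rewrite fI inE => /andP[_ /andP[/le_trans]]; apply.
have [n [f [fE fI]]] := bool F FD; exists n, f.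
have fP A : (f A \in D) && (f A <= F)%O.
  have : f A \in f @: setT by apply: imset_f.
  by rewrite fI inE => /and3P[-> _ ->].
have surj G : G \in D -> (G <= F)%O -> exists A, G = f A.
  move=> GD GF; have : G \in f @: setT by rewrite fI inE GD bF.
  by case/imsetP=> A _ ->; exists A.
split; last by move=> A; case/andP: (fP A).
split=> //; have [A FA] := surj F FD (lexx _).
by apply/le_anti; rewrite {2}FA fE subsetT andbT; case/andP: (fP setT).
Qed.

Lemma verticesP v : reflect (v \in D /\ face_rank D v = 1%N) (v \in vertices D).
Proof.
rewrite inE /face_dim subr_eq0; apply: (iffP andP) => -[vD]; first by case/eqP.
by move=> ->.
Qed.

Lemma vertices_ofP F v :
  reflect [/\ v \in D, face_rank D v = 1%N & (v <= F)%O] (v \in V F).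
Proof.
rewrite /vertices_of in_set; apply: (iffP andP) => [[/verticesP[? ?] ?]|[? ? ?]] //.
by split=> //; apply/verticesP.
Qed.

Lemma face_labels F : F \in D -> exists n (f : {set 'I_n} -> T) (l : 'I_n -> T),
  [/\ forall A B : {set 'I_n}, (f A <= f B)%O = (A \subset B),
      f setT = F, forall G, G \in D -> (G <= F)%O -> exists A, G = f A &
      [/\ forall A, f A \in D, injective l, forall A, V (f A) = l @: A &
      forall A, face_rank D (f A) = #|A| ] ].
Proof.
move=> FD; have [n [f [[fE fT fS] fD]]] := face_boolean FD.
have rkA B : face_rank D (f B) = #|B|.
  rewrite /face_rank (@max_chain_boolean n f set0 B) ?sub0set //= ?cards0 ?subn0 // => H.
  apply: (iffP idP) => [|[B' /andP[_ sB] ->]]; rewrite inE; last by rewrite fD fE.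
  case/andP=> HD HB; have [|B' HB'] := fS H HD.
    by apply: le_trans HB _; rewrite -fT fE subsetT.
  by exists B'; rewrite // sub0set /= -fE -HB'.
have f_inj : injective f.
  by move=> A B fAB; apply/eqP; rewrite eqEsubset -!fE fAB lexx.
exists n, f, (fun i => f [set i]); split=> //; split=> // [i j /f_inj/set1_inj //|A].
apply/setP=> v; apply/vertices_ofP/imsetP => [[vD rv vA]|[i iA ->]].
  have [B vB] : exists B, v = f B.
    by apply: fS => //; apply: le_trans vA _; rewrite -fT fE subsetT.
  move: rv; rewrite vB rkA => /eqP/cards1P[i Bi]; exists i; last by rewrite Bi.
  by move: vA; rewrite vB fE Bi sub1set.
by rewrite rkA cards1 fE sub1set.
Qed.

Lemma face_rank_interval (D' : {set T}) F G : F \in D -> G \in D -> (F <= G)%O ->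
  (forall H, (H \in D') && (H <= G)%O = [&& H \in D, F <= H & H <= G]%O) ->
  face_rank D' G = (face_rank D G - face_rank D F)%N /\ (face_rank D F <= face_rank D G)%N.
Proof.
move=> FD GD FG D'E; have [n [f [l [fE fT fS [fD _ _ rkA]]]]] := face_labels GD.
have [A FA] := fS F FD FG.
subst G F; rewrite !rkA subset_leq_card ?subsetT //; split=> //.
rewrite /face_rank (@max_chain_boolean n f A setT) ?subsetT // => H.
rewrite inE D'E; apply: (iffP idP) => [/and3P[HD FH HG]|[B /andP[AB _] ->]].
  by have [B HB] := fS H HD HG; exists B; rewrite // subsetT andbT -fE -HB.
by rewrite fD !fE subsetT AB.
Qed.

Lemma face_rankE F : F \in D -> face_rank D F = #|V F|.
Proof.
move=> FD; have [n [f [l [_ <- _ [_ l_inj -> ->]]]]] := face_labels FD.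
by rewrite card_imset.
Qed.

Lemma vertices_ofS F G : (F <= G)%O -> V F \subset V G.
Proof.
move=> FG; apply/subsetP=> v /vertices_ofP[vD rv vF]; apply/vertices_ofP.
by split=> //; apply: le_trans FG.
Qed.

(** The common upper face [H] matters: distinct faces of a simplicial poset may have the same
    vertices, and only inside one Boolean interval do vertex sets determine the order. *)
Lemma vertices_of_le F G H : F \in D -> G \in D -> H \in D ->
  (F <= H)%O -> (G <= H)%O -> (F <= G)%O = (V F \subset V G).
Proof.
move=> FD GD HD; have [n [f [l [fE _ fS [_ l_inj VE _]]]]] := face_labels HD.
case/(fS F FD)=> A -> /(fS G GD)[B ->]; rewrite fE !VE.
apply/idP/idP => [/imsetS //|/subsetP sAB]; apply/subsetP=> i iA.
by have /imsetP[j jB /l_inj->] := sAB _ (imset_f l iA).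
Qed.

Definition res F (Y : {set T}) : T :=
  odflt F [pick G | [&& G \in D, (G <= F)%O & V G == Y]].

Lemma resP F Y : F \in D -> Y \subset V F ->
  [/\ res F Y \in D, (res F Y <= F)%O & V (res F Y) = Y].
Proof.
move=> FD YF; rewrite /res; case: pickP => [G /and3P[-> -> /eqP //]|none].
have [n [f [l [fE fT _ [fD l_inj VE _]]]]] := face_labels FD.
have /negP[] := none (f (l @^-1: Y)); rewrite fD -fT fE subsetT VE /=.
apply/eqP/setP=> v; apply/imsetP/idP => [[i + ->]|vY]; first by rewrite inE.
have := subsetP YF v vY; rewrite -fT VE => /imsetP[i _ vi]; exists i => //.
by rewrite inE -vi.
Qed.

Lemma face_eq F G H : F \in D -> G \in D -> H \in D ->
  (F <= H)%O -> (G <= H)%O -> V F = V G -> F = G.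
Proof.
move=> FD GD HD FH GH VFG; apply/le_anti.
by rewrite (@vertices_of_le F G H) // (@vertices_of_le G F H) // VFG subxx.
Qed.

Lemma res_eq F G Y : F \in D -> G \in D -> (G <= F)%O -> V G = Y -> res F Y = G.
Proof.
move=> FD GD GF VG; have [||rD rF VR] := @resP F Y => //.
  by rewrite -VG vertices_ofS.
by apply: (@face_eq _ _ F); rewrite // VR.
Qed.

Definition rm H x := res H (V H :\ x).

Lemma rmP H x : H \in D -> [/\ rm H x \in D, (rm H x <= H)%O & V (rm H x) = V H :\ x].
Proof. by move=> HD; apply: resP; rewrite // subD1set. Qed.

Lemma vertices_of_vertex v : v \in vertices D -> V v = [set v].
Proof.
case/verticesP=> vD rv; have : #|V v| == 1%N by rewrite -face_rankE ?rv.
case/cards1P=> w Vw; have : v \in V v by apply/vertices_ofP.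
by rewrite Vw inE => /eqP->.
Qed.

(* Membership rules that do not unfold [vertices_of]. *)
Let in_labels := (in_setU1, in_setD1, in_setD, in_setU, in_setC, in_set1).

(** * Relative links of induced subposets *)

Section Link.
Variables (F : T) (W : {set T}).
Hypothesis FD : F \in D.
Local Notation D1 := (lk F (induced D W)).
Local Notation G1 := (lk F (induced Gm W)).

Lemma vertices_of_ideal H : H \in Gm -> vertices_of Gm H = V H.
Proof.
move=> HG; apply/setP=> v; rewrite !in_set /face_dim.
have [vG|vG] := boolP (v \in Gm); last first.
  rewrite /=; apply/esym/negP=> /andP[/andP[vD _] vH].
  by case/negP: vG; apply: Gm_lower HG vD vH.
rewrite (subsetP GmD _ vG) /= (_ : face_rank Gm v = face_rank D v) //.
rewrite /face_rank (_ : [set _ in Gm | _] = [set G in D | (G <= v)%O]) //.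
apply/setP=> G; rewrite !inE; apply/andP/andP => -[GD Gv]; split=> //.
  exact: (subsetP GmD).
exact: Gm_lower vG GD Gv.
Qed.

Lemma link_facesP H : (H \in D1 :\: G1) = [&& H \in D, H \notin Gm, (F <= H)%O & V H \subset W].
Proof.
rewrite !inE; case: (boolP (H \in Gm)) => HG /=.
  rewrite vertices_of_ideal // (subsetP GmD _ HG) /=.
  by case: (_ \subset _); rewrite //= ?andbF // andNb.
by case: (H \in D) => //=; rewrite andbC.
Qed.

Lemma face_rank_link H : H \in D -> (F <= H)%O -> V H \subset W ->
  face_rank D1 H = (#|V H| - #|V F|)%N /\ (#|V F| <= #|V H|)%N.
Proof.
move=> HD FH HW; rewrite -!face_rankE //; apply: face_rank_interval => // G.
rewrite !inE; apply/andP/and3P => [[/andP[/andP[-> _] ->] ->]|[-> -> GH]] //.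
by rewrite GH (subset_trans (vertices_ofS GH)).
Qed.

Lemma rel_facesP q H : (H \in rel_faces D1 G1 (q%:Z - 1)) =
  [&& H \in D, H \notin Gm, (F <= H)%O, V H \subset W & #|V H| == (q + #|V F|)%N].
Proof.
rewrite in_set link_facesP -!andbA; case HD: (H \in D) => //=; case: (_ \notin _) => //=.
case FH: (F <= H)%O => //=; case HW: (_ \subset _) => //=.
have [rk le] := face_rank_link HD FH HW.
rewrite /face_dim (inj_eq (addIr _)) rk eqz_nat.
by rewrite -(eqn_add2r #|V F|) subnK.
Qed.

(** The vertices of the link of [F] are the faces covering [F]. The cover adding [x] has to be taken
    inside [H], since several covers may have the same vertices. *)
Definition edge H x := res H (x |: V F).

Lemma edgeP H x : H \in D -> (F <= H)%O -> x \in V H ->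
  [/\ edge H x \in D, (edge H x <= H)%O & V (edge H x) = x |: V F].
Proof. by move=> HD FH xH; apply: resP; rewrite // subUset sub1set xH vertices_ofS. Qed.

Lemma edge_inj H : H \in D -> (F <= H)%O ->
  {in V H :\: V F &, injective (edge H)}.
Proof.
move=> HD FH x y /setDP[xH xF] /setDP[yH yF] exy.
have [_ _ Vx] := edgeP HD FH xH; have [_ _ Vy] := edgeP HD FH yH.
have : x \in V (edge H y) by rewrite -exy Vx setU11.
by rewrite Vy !in_labels (negPf xF) orbF => /eqP.
Qed.

Lemma edge_rm H x y : H \in D -> (F <= H)%O -> x \in V H :\: V F ->
  y \in V H -> y != x -> edge (rm H x) y = edge H y.
Proof.
move=> HD FH /setDP[xH xF] yH yx.
have [rD rH Vr] := rmP x HD.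
have Frm : (F <= rm H x)%O by rewrite (@vertices_of_le _ _ H) // Vr subsetD1 vertices_ofS.
have yr : y \in V (rm H x) by rewrite Vr !in_labels yx.
have [eD er Ve] := edgeP rD Frm yr.
by apply/esym/res_eq => //; apply: le_trans er rH.
Qed.

Lemma vertices_of_link H : H \in D -> (F <= H)%O -> V H \subset W ->
  vertices_of D1 H = [set edge H x | x in V H :\: V F].
Proof.
move=> HD FH HW; apply/setP=> w; rewrite in_set; apply/andP/imsetP => [[wV wH]|[x xH ->]].
  move: wV; rewrite !in_set => /andP[/andP[/andP[wD wW] Fw]].
  have [rk le] := face_rank_link wD Fw wW.
  rewrite /face_dim rk subr_eq0 => /eqP[c1].
  have /cards1P[x wx] : #|V w :\: V F| == 1%N.
    by rewrite cardsD (setIidPr (vertices_ofS Fw)) c1.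
  have : x \in V w :\: V F by rewrite wx set11.
  case/setDP=> xw xF; exists x; first by rewrite in_setD xF (subsetP (vertices_ofS wH)).
  apply/esym/res_eq => //; rewrite -(setID (V w) (V F)) wx (setIidPr (vertices_ofS Fw)).
  by rewrite setUC.
case/setDP: xH => xH xF; have [eD eH Ve] := edgeP HD FH xH.
have Fe : (F <= edge H x)%O by rewrite (@vertices_of_le _ _ H) // Ve subsetUr.
have eW : V (edge H x) \subset W by apply: subset_trans HW; apply: vertices_ofS.
have [rk le] := face_rank_link eD Fe eW.
by split=> //; rewrite !in_set eD eW Fe /= /face_dim rk Ve cardsU1 xF addnK subrr eqxx.
Qed.

Variable K : fieldType.
Local Notation inc := (incidence K D1).

Lemma rm_link H x : H \in D -> (F <= H)%O -> V H \subset W -> x \in V H :\: V F ->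
  [/\ rm H x \in D, (rm H x <= H)%O, V (rm H x) = V H :\ x, (F <= rm H x)%O & V (rm H x) \subset W].
Proof.
move=> HD FH HW /setDP[xH xF]; have [rD rH Vr] := rmP x HD; split=> //.
  by rewrite (@vertices_of_le _ _ H) // Vr subsetD1 vertices_ofS.
by rewrite Vr; apply: subset_trans HW; apply: subD1set.
Qed.

Lemma incidence_rm H x : H \in D -> (F <= H)%O -> V H \subset W -> x \in V H :\: V F ->
  inc H (rm H x) = \prod_(y in V H :\: V F) eta (edge H x) (edge H y).
Proof.
move=> HD FH HW xB; have [rD rH Vr Fr rW] := rm_link HD FH HW xB.
rewrite /incidence rH (_ : _ :\: _ = [set edge H x]); last first.
  rewrite !vertices_of_link // Vr; apply/setP=> w; rewrite in_setD in_set1.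
  apply/andP/eqP => [[nw /imsetP[y yB wy]]|->].
    apply: contraNeq nw => nwx; apply/imsetP; exists y; last first.
      rewrite edge_rm //; first by case/setDP: yB.
      by apply: contraNneq nwx => <-; rewrite wy.
    move: yB; rewrite !in_labels => /andP[-> ->]; rewrite !andbT /=.
    by apply: contraNneq nwx => <-; rewrite wy.
  split; last exact: imset_f.
  apply/imsetP=> -[y]; rewrite !in_labels => /and3P[yF yx yH].
  rewrite edge_rm // => /(edge_inj HD FH); rewrite !in_labels yF yH => xy.
  by case/setDP: (xB) => xH xF; rewrite -xy ?eqxx ?xH ?xF // in yx.
rewrite big_set1 vertices_of_link //.
rewrite -(big_imset (fun w => eta (edge H x) w) (edge_inj HD FH)) /=.
rewrite /eta -big_mkcondr -prodr_const; apply: eq_bigl => w.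
by rewrite in_set.
Qed.

(** For a symmetric [rho] the product runs over unordered pairs, so removing [x] from [B] removes
    exactly the pairs containing [x]. In [orient], [rho] compares two orders and is symmetric
    because both signs change together. *)
Lemma prod_pairs_setD1 (rho : T -> T -> K) (B : {set T}) x : x \in B ->
  (forall a c, a \in B -> c \in B -> a != c -> rho a c = rho c a) -> rho x x = 1 ->
  \prod_(a in B) \prod_(c in B | (enum_rank c < enum_rank a)%N) rho a c =
  (\prod_(c in B) rho x c) *
  \prod_(a in B :\ x) \prod_(c in B :\ x | (enum_rank c < enum_rank a)%N) rho a c.
Proof.
move=> xB rhoC rhox; rewrite (big_setD1 x) //=.
have -> : \prod_(a in B :\ x) \prod_(c in B | (enum_rank c < enum_rank a)%N) rho a c =
  (\prod_(a in B :\ x | (enum_rank x < enum_rank a)%N) rho x a) *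
  \prod_(a in B :\ x) \prod_(c in B :\ x | (enum_rank c < enum_rank a)%N) rho a c.
  rewrite big_mkcondr -big_split /=; apply: eq_bigr => a /setD1P[ax aB].
  case: ifP => xa.
    rewrite (bigD1 x) /= ?xB // rhoC //; congr (_ * _); apply: eq_bigl => c.
    by rewrite !in_labels andbC andbA.
  rewrite mul1r; apply: eq_bigl => c; rewrite !in_labels; case: (eqVneq c x) => [->|//].
  by rewrite xa andbF.
rewrite mulrA; congr (_ * _); rewrite [RHS](big_setD1 x) //= rhox mul1r.
rewrite [RHS](bigID (fun c => enum_rank c < enum_rank x)%N) /=; congr (_ * _).
  by apply: eq_bigl => c; rewrite !in_labels; case: eqVneq => // ->; rewrite ltnn andbF.
apply: eq_bigl => c; rewrite !in_labels -leqNgt ltn_neqAle; case: eqVneq => //= cx.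
rewrite (_ : _ != _) //; apply: contra cx => /eqP/val_inj/enum_rank_inj->.
exact: eqxx.
Qed.

(* Turns the orientation of the link by its own vertices [edge H x] into the
   one by the labels [x]. *)
Definition orient (A : {set T}) H : K :=
  (\prod_(a in V H :\: V F) \prod_(c in V H :\: V F | (enum_rank c < enum_rank a)%N)
     (eta (edge H a) (edge H c) * eta c a)) * \prod_(a in V H :\: V F) dsg a A.

Lemma orient_sq A H : orient A H * orient A H = 1.
Proof.
have sq1 (I : finType) (P : pred I) (f : I -> K) : (forall i, f i * f i = 1) ->
    (\prod_(i | P i) f i) * (\prod_(i | P i) f i) = 1.
  by move=> ff; rewrite -big_split big1 //= => i _; apply: ff.
rewrite /orient mulrACA sq1 => [|a]; last first.
  by apply: sq1 => c; rewrite mulrACA !eta_sq mulr1.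
by rewrite mul1r sq1 // => a; apply: dsg_sq.
Qed.

(** Rescaling each face by its sign [orient A] turns the incidence numbers of the link into the
    signs of [cobd]; the factor [dsg a A] accounts for the labels in [A], which the link does not
    see. *)
Lemma incidence_orient (A : {set T}) H x : A \subset V F ->
  H \in D -> (F <= H)%O -> V H \subset W -> x \in V H :\: V F ->
  inc H (rm H x) = orient A H * orient A (rm H x) * dsg x ((V H :\: V F) :|: A).
Proof.
move=> AF HD FH HW xB; have [rD rH Vr Fr rW] := rm_link HD FH HW xB.
have VrF : V (rm H x) :\: V F = (V H :\: V F) :\ x.
  by rewrite Vr; apply/setP=> z; rewrite !in_labels andbCA.
have -> : orient A H = (\prod_(c in V H :\: V F) (eta (edge H x) (edge H c) * eta c x))
    * dsg x A * orient A (rm H x).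
  rewrite /orient VrF (prod_pairs_setD1 xB) => [|a c aB cB ac|]; last first.
  - by rewrite !etaxx mulr1.
  - have eac : edge H a != edge H c by apply: contraNneq ac => /(edge_inj HD FH aB cB)->.
    by rewrite (eta_anti K eac) (eta_anti K (_ : c != a)) ?mulrNN // eq_sym.
  rewrite [\prod_(a in _) dsg a A](big_setD1 x) //= -!mulrA. congr (_ * _).
  rewrite [RHS]mulrCA; congr (_ * _).
  apply: eq_bigr => a /setD1P[ax aB]; apply: eq_bigr => c /andP[/setD1P[cx cB] _].
  by rewrite !edge_rm //; [case/setDP: cB | case/setDP: aB].
rewrite incidence_rm // -[X in _ = X * _]mulrA orient_sq mulr1 big_split /=.
rewrite dsgU; last first.
  by rewrite disjoints_subset; apply/subsetP=> z; rewrite !in_labels => /andP[zF _]; apply: contra zF; apply: (subsetP AF).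
rewrite -[\prod_(i in _) eta i x]/(dsg x (V H :\: V F)).
set p := \prod_(i in _) _; have := dsg_sq K x A; have := dsg_sq K x (V H :\: V F).
move: (dsg x A) (dsg x _) => a b bb aa.
by transitivity (p * (b * b) * (a * a)); [rewrite bb aa !mulr1 | ring].
Qed.

Lemma sum_incidence q H (phi : T -> K) : H \in D -> (F <= H)%O -> V H \subset W ->
  #|V H| = (q.+1 + #|V F|)%N ->
  \sum_(G in rel_faces D1 G1 (q%:Z - 1)) inc H G * phi G =
  \sum_(x in V H :\: V F) inc H (rm H x) * (if rm H x \in Gm then 0 else phi (rm H x)).
Proof.
move=> HD FH HW cH; set R := rel_faces _ _ _; set B := V H :\: V F.
have rmR x : x \in B -> (rm H x \in R) = (rm H x \notin Gm).
  move=> xB; have [rD rH Vr Fr rW] := rm_link HD FH HW xB.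
  rewrite rel_facesP rD Fr rW Vr /=; case: (_ \in Gm) => //=.
  by have := cardsD1 x (V H); case/setDP: xB => -> _; rewrite cH => /eqP; rewrite addSn add1n eqSS eq_sym.
transitivity (\sum_(G in R) \sum_(x in B | rm H x == G) inc H G * phi G); last first.
  rewrite (exchange_big_dep (mem B)) /=; last by move=> ? ? _ /andP[].
  apply: eq_bigr => x xB; rewrite (eq_bigl (fun G => (G == rm H x) && (rm H x \in R))); last first.
    by move=> G; rewrite xB eq_sym /=; case: eqVneq => [->|]; rewrite ?andbT ?andbF.
  rewrite rmR //; case: (_ \in Gm) => /=.
    by rewrite mulr0 big_pred0 // => G; rewrite andbF.
  by rewrite (big_pred1 (rm H x)) // => G; rewrite andbT.
apply: eq_bigr => G GR; have := GR; rewrite rel_facesP => /and5P[GD GG FG GW /eqP cG].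
have [GH|nGH] := boolP (G <= H)%O; last first.
  rewrite big1 => [|x]; first by rewrite /incidence (negPf nGH) mul0r.
  by move=> /andP[xB /eqP rG]; case/negP: nGH; rewrite -rG; have [] := rmP x HD.
have /cards1P[x xE] : #|V H :\: V G| == 1%N.
  by rewrite cardsD (setIidPr (vertices_ofS GH)) cH cG addSn subSnn.
have : x \in V H :\: V G by rewrite xE set11.
case/setDP=> xH xG; have xB : x \in B.
  by rewrite in_setD xH andbT; apply: contra xG; apply: (subsetP (vertices_ofS FG)).
have VG : V H :\ x = V G.
  by rewrite -xE setDDr setDv set0U; apply/setIidPr/vertices_ofS.
rewrite (big_pred1 x) // => y; apply/andP/eqP => [[yB /eqP rG]|->].
  case/setDP: (yB) => yH _; have [_ _] := rmP y HD; rewrite rG -VG => /setP/(_ y).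
  by rewrite !in_labels eqxx yH andbT /= => /negbFE/eqP.
by split=> //; apply/eqP/res_eq.
Qed.

Definition bd_rank q := \rank (boundary K D1 G1 (q%:Z - 1) (q%:Z - 1 - 1)).

Lemma rel_faces_neg H : H \in rel_faces D1 G1 (0%:Z - 1 - 1) -> False.
Proof. by rewrite in_set /face_dim => /andP[_ /eqP]; lia. Qed.

Lemma bd_rank0 : bd_rank 0 = 0%N.
Proof.
apply/eqP; rewrite -leqn0; apply: leq_trans (rank_leq_col _) _.
rewrite leqn0 cards_eq0; apply/eqP/setP=> H; rewrite in_set0; apply/negP.
exact: rel_faces_neg.
Qed.

Lemma boundary_boundary q :
  boundary K D1 G1 (q.+1%:Z - 1) (q%:Z - 1) *m boundary K D1 G1 (q%:Z - 1) (q%:Z - 1 - 1) = 0.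
Proof.
apply/matrixP=> a b; rewrite !mxE.
have := enum_valP a; set H := enum_val a; rewrite rel_facesP => /and5P[HD HG FH HW /eqP cH].
have := enum_valP b; set E := enum_val b => EV.
transitivity (\sum_(G in rel_faces D1 G1 (q%:Z - 1)) inc H G * inc G E).
  by rewrite [RHS]big_enum_val /=; apply: eq_bigr => i _; rewrite !mxE.
(* For [q = 0] the target degree is -2, where there are no faces. *)
rewrite sum_incidence //; case: q => [|q] in a b H HD HG FH HW cH E EV *.
  by have := rel_faces_neg EV.
have EV' : E \in rel_faces D1 G1 (q%:Z - 1) by rewrite (_ : q%:Z - 1 = q.+1%:Z - 1 - 1) //; lia.
have /and5P[_ EG _ _ _] : [&& E \in D, E \notin Gm, (F <= E)%O, V E \subset W & #|V E| == (q + #|V F|)%N].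
  by rewrite -rel_facesP.
set B := V H :\: V F.
(* The ways of reaching [E] by removing first [x], then [y]; exchanging the two removals changes the
   sign. *)
pose f x y : K := if y == x then 0 else
  if rm (rm H x) y == E then inc H (rm H x) * inc (rm H x) (rm (rm H x) y) else 0.
have VrB x : x \in B -> V (rm H x) :\: V F = B :\ x.
  move=> xB; have [_ _ -> _ _] := rm_link HD FH HW xB.
  by apply/setP=> z; rewrite !in_labels andbCA.
rewrite (eq_bigr (fun x => \sum_(y in B) f x y)) => [|x xB]; last first.
  have [rD rH Vr Fr rW] := rm_link HD FH HW xB.
  have cr : #|V (rm H x)| = (q.+1 + #|V F|)%N.
    by have := cardsD1 x (V H); case/setDP: (xB) => -> _; rewrite cH -Vr !addSn => -[->].
  have incE : inc (rm H x) E = \sum_(y in B :\ x) (if rm (rm H x) y == E then inc (rm H x) (rm (rm H x) y) else 0).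
    have <- : \sum_(G in rel_faces D1 G1 (q%:Z - 1)) inc (rm H x) G * (G == E)%:R = inc (rm H x) E.
      rewrite (bigD1 E) //= eqxx mulr1 big1 ?addr0 // => G /andP[_ /negPf->].
      by rewrite mulr0.
    rewrite sum_incidence // VrB //; apply: eq_bigr => y _.
    case: eqVneq => [->|_]; first by rewrite (negPf EG) mulr1.
    by case: ifP; rewrite mulr0.
  rewrite incE sum_setD1 -[X in _ * (if _ then X else _)]/0.
  case: ifP => [rG|_].
    rewrite mulr0 big1 // => y _; rewrite /f; case: ifP => // _; case: eqP => // rE.
    case/negP: EG; rewrite -rE; have [r2D r2 _] := rmP y rD.
    exact: Gm_lower rG r2D r2.
  rewrite big_distrr; apply: eq_bigr => y _ /=; rewrite /f; case: ifP; rewrite ?mulr0 //.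
  by case: ifP; rewrite ?mulr0.
apply: sum_antisym => [x _|x y xB yB]; first by rewrite /f eqxx.
rewrite /f eq_sym; case: eqVneq => [|xy]; first by rewrite oppr0.
have rC : rm (rm H x) y = rm (rm H y) x.
  have [rD rH Vr Fr rW] := rm_link HD FH HW xB; have [rD' rH' Vr' _ _] := rm_link HD FH HW yB.
  have [r2D r2 V2] := rmP y rD; have [r2D' r2' V2'] := rmP x rD'.
  apply: (@face_eq _ _ H) => //; [exact: le_trans rH|exact: le_trans rH'|].
  by rewrite V2 V2' Vr Vr' !setDDl setUC.
rewrite rC; case: ifP; rewrite ?oppr0 // => _.
have incs x' y' : x' \in B -> y' \in B -> y' != x' ->
    inc H (rm H x') * inc (rm H x') (rm (rm H x') y') =
    orient set0 H * orient set0 (rm (rm H x') y') * (dsg x' B * dsg y' (B :\ x')).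
  move=> xB' yB' yx; have [rD rH Vr Fr rW] := rm_link HD FH HW xB'.
  rewrite (@incidence_orient set0) ?sub0set // (@incidence_orient set0 (rm H x')) ?sub0set //.
    rewrite VrB // !setU0 -/B; have := orient_sq set0 (rm H x').
    set o := orient _ (rm H x'); set o1 := orient _ H; set o2 := orient _ (rm (rm _ _) _).
    set p := dsg x' B; set p' := dsg y' _; move: o o1 o2 p p' => o o1 o2 p p' oo.
    transitivity (o1 * o2 * (p * p') * (o * o)); first ring.
    by rewrite oo mulr1.
  by rewrite VrB // in_setD1 yx.
rewrite -[in LHS]rC incs 1?eq_sym // incs // rC (dsg_swap K xy xB yB).
by rewrite mulrN.
Qed.

Lemma betti_bd_rank q :
  (betti K D1 G1 (q%:Z - 1) + bd_rank q + bd_rank q.+1 = #|rel_faces D1 G1 (q%:Z - 1)|)%N.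
Proof.
rewrite /betti /red_homology /bd_rank.
have -> : q%:Z - 1 + 1 = q.+1%:Z - 1 by lia.
have -> : q.+1%:Z - 1 - 1 = q%:Z - 1 by lia.
set B := boundary _ _ _ (q%:Z - 1) _; set B' := boundary _ _ _ (q.+1%:Z - 1) _.
have sB : (B' <= kermx B)%MS by apply/sub_kermxP; apply: boundary_boundary.
have := mxrank_cap_compl (kermx B) B'; rewrite (capmx_idPr sB) mxrank_ker.
set rD := \rank (_ :\: _) => eq.
by rewrite addnAC [(rD + _)%N]addnC eq subnK // rank_leq_row.
Qed.

(** [M *m pinvmx M] differs from the identity by a left multiple of [kermx M]. So [pinvmx M] solves
    the system by a matrix that does not depend on [u], as [col_exact] demands. *)
Lemma kermx_mul_eq0 m n p (M : 'M[K]_(m, n)) (u : 'M_(m, p)) :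
  kermx M *m u = 0 -> M *m (pinvmx M *m u) = u.
Proof.
have MP : M *m pinvmx M = 1%:M - col_ebase M *m kermx M.
  rewrite /kermx /pinvmx -[X in X *m _ = _](mulmx_ebase M) !mulmxA mulmxK ?row_ebase_unit //.
  rewrite -[_ *m pid_mx _ *m pid_mx _]mulmxA pid_mx_id ?rank_leq_col // /copid_mx.
  by rewrite mulmxBr mulmx1 mulmxBl mulmxV ?col_ebase_unit // subKr.
by move=> ku; rewrite mulmxA MP mulmxBl mul1mx -mulmxA ku mulmx0 subr0.
Qed.

Definition pad (R1 R2 : {set T}) (M : 'M[K]_(#|R1|, #|R2|)) G H : K :=
  \sum_a \sum_b (enum_val a == G)%:R * (enum_val b == H)%:R * M a b.

Lemma pad_sum (R1 R2 : {set T}) (M : 'M[K]_(#|R1|, #|R2|)) a (y : T -> K) :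
  \sum_H pad M (enum_val a) H * y H = \sum_b M a b * y (enum_val b).
Proof.
rewrite /pad (eq_bigr (fun H => \sum_b (enum_val b == H)%:R * M a b * y H)) => [|H _].
  rewrite exchange_big; apply: eq_bigr => b _; rewrite (bigD1 (enum_val b)) //= eqxx mul1r.
  by rewrite big1 ?addr0 // => H /negPf nH; rewrite eq_sym nH !mul0r.
rewrite (bigD1 a) //= [X in _ + X]big1 => [|a' /negPf a'a].
  by rewrite addr0 eqxx big_distrl; apply: eq_bigr => b _; rewrite mul1r.
by apply: big1 => b _; rewrite (inj_eq enum_val_inj) a'a !mul0r.
Qed.

(** Vanishing homology says that every row vector in the kernel of [B] is a combination of rows of
    [B']. A column killed by [B'] is then killed by [kermx B] and lies in the image of [B]: this is
    the dual statement for cochains. Conjugation by [o] adjusts the signs. *)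
Lemma link_primitive (A : {set T}) q : A \subset V F ->
  red_homology K D1 G1 (q%:Z - 1) = 0 ->
  exists c : T -> T -> K, forall y : T -> K,
    (forall G, G \in rel_faces D1 G1 (q.+1%:Z - 1) ->
       \sum_(x in V G :\: V F) dsg x ((V G :\: V F) :|: A) *
         (if rm G x \in Gm then 0 else y (rm G x)) = 0) ->
    forall H, H \in rel_faces D1 G1 (q%:Z - 1) ->
      y H = \sum_(x in V H :\: V F) dsg x ((V H :\: V F) :|: A) *
         (if rm H x \in Gm then 0 else \sum_G c (rm H x) G * y G).
Proof.
move=> AF rh0.
pose B := boundary K D1 G1 (q%:Z - 1) (q%:Z - 1 - 1).
pose B' := boundary K D1 G1 (q.+1%:Z - 1) (q%:Z - 1).
have kB : (kermx B <= B')%MS.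
  have := mxrank_cap_compl (kermx B) B'.
  rewrite /red_homology (_ : q%:Z - 1 + 1 = q.+1%:Z - 1) in rh0; last by lia.
  rewrite rh0 mxrank0 addn0 => /eqP; rewrite (mxrank_leqif_eq (capmxSl _ _)) => /andP[_].
  by move/submx_trans; apply; apply: capmxSr.
pose o := orient A.
exists (fun G H => o G * pad (pinvmx B) G H * o H) => y dy H HR.
pose u : 'cV[K]_(#|rel_faces D1 G1 (q%:Z - 1)|) := \col_b (o (enum_val b) * y (enum_val b)).
have B'u : B' *m u = 0.
  apply/matrixP=> a b; rewrite !mxE.
  have := enum_valP a; set G := enum_val a => GR; have := GR.
  rewrite rel_facesP => /and5P[GD GG FG GW /eqP cG].
  transitivity (\sum_(E in rel_faces D1 G1 (q%:Z - 1)) incidence K D1 G E * (o E * y E)).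
    by rewrite [RHS]big_enum_val /=; apply: eq_bigr => i _; rewrite !mxE.
  rewrite sum_incidence //; have := congr1 ( *%R (o G)) (dy G GR); rewrite mulr0.
  apply: etrans; rewrite big_distrr; apply: eq_bigr => x xB /=.
  rewrite (incidence_orient AF) //; case: ifP => _; rewrite ?mulr0 //.
  have := orient_sq A (rm G x); rewrite -/o; move: (o (rm G x)) (dsg x _) => p s pp.
  by transitivity (o G * (s * y (rm G x)) * (p * p)); [ring | rewrite pp mulr1].
have ku : kermx B *m u = 0 by have /submxP[z ->] := kB; rewrite -mulmxA B'u mulmx0.
have {ku} := kermx_mul_eq0 ku; set w := pinvmx B *m u => Bw.
have Hi : enum_val (enum_rank_in HR H) = H by rewrite enum_rankK_in.
have yH : y H = o H * \sum_c B (enum_rank_in HR H) c * w c 0.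
  have /matrixP/(_ (enum_rank_in HR H) 0) := Bw.
  by rewrite !mxE Hi => ->; rewrite mulrA orient_sq mul1r.
have := HR; rewrite rel_facesP => /and5P[HD HG FH HW /eqP cH].
have wE G b : enum_val b = G -> w b 0 = o G * \sum_E (o G * pad (pinvmx B) G E * o E) * y E.
  move=> <-; rewrite mxE -[RHS]/(o _ * _).
  rewrite (eq_bigr (fun E => o (enum_val b) * (pad (pinvmx B) (enum_val b) E * (o E * y E)))) => [|E _]; last by ring.
  rewrite -big_distrr /= mulrA orient_sq mul1r pad_sum.
  by apply: eq_bigr => a _; rewrite !mxE.
pose phi G := o G * \sum_E (o G * pad (pinvmx B) G E * o E) * y E.
have {}yH : y H = o H * \sum_(G in rel_faces D1 G1 (q%:Z - 1 - 1)) incidence K D1 H G * phi G.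
  rewrite yH [in RHS]big_enum_val; congr (_ * _); apply: eq_bigr => b _.
  by rewrite (wE _ b erefl) !mxE Hi.
(* For [q = 0] both sums are empty: degree -2 has no faces, and [H] has no vertex beyond those of
   [F]. *)
rewrite yH; have [q0|q_gt0] := posnP q.
  rewrite big_pred0 => [|G]; last by apply/negP; rewrite q0; apply: rel_faces_neg.
  rewrite mulr0 big_pred0 // => x; apply/negP=> xB.
  have : #|V H :\: V F| = 0%N by rewrite cardsD (setIidPr (vertices_ofS FH)) cH q0 subnn.
  by move/eqP; rewrite cards_eq0 => /eqP B0; rewrite B0 in_set0 in xB.
rewrite [in X in o H * X](_ : q%:Z - 1 - 1 = q.-1%:Z - 1); last by lia.
rewrite sum_incidence ?prednK // big_distrr; apply: eq_bigr => x xB /=.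
rewrite (incidence_orient AF) // /phi -/o; case: ifP => _; rewrite ?mulr0 //.
have := orient_sq A (rm H x); have := orient_sq A H; rewrite -/o.
move: (o H) (o (rm H x)) (dsg x _) (\sum_E _) => p p' s z pp pp'.
by transitivity (s * z * (p * p) * (p' * p')); [ring | rewrite pp pp' !mulr1].
Qed.

End Link.

(** * Vertex links as labelled complexes *)

Section VertexLink.
Variable v : T.
Hypothesis vV : v \in vertices D.
Local Notation X H := (V H :\ v).
Local Notation Xv := (vertices D :\ v).

Definition star : {set T} := [set H in D :\: Gm | (v <= H)%O].

Lemma vD : v \in D. Proof. by have /verticesP[] := vV. Qed.

Lemma starP H : reflect [/\ H \in D, H \notin Gm, (v <= H)%O & v \in V H] (H \in star).
Proof.
rewrite [H \in star]in_set in_setD -andbA; apply: (iffP and3P) => [[HG HD vH]|[HD HG vH _]] //.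
by split=> //; apply/vertices_ofP; have /verticesP[] := vV.
Qed.

Lemma star_card H : H \in star -> #|V H| = #|X H|.+1.
Proof. by case/starP=> _ _ _ vH; rewrite (cardsD1 v) vH. Qed.

Lemma star_rm H x : H \in star -> x \in X H ->
  [/\ rm H x \in D, (rm H x <= H)%O, V (rm H x) = V H :\ x, (v <= rm H x)%O &
      (rm H x \in star) = (rm H x \notin Gm)].
Proof.
case/starP=> HD HG vH vVH /setD1P[xv xH].
have [rD rH Vr] := rmP x HD.
have vr : (v <= rm H x)%O.
  rewrite (@vertices_of_le _ _ H) ?vD // (vertices_of_vertex vV) Vr sub1set in_setD1 vVH.
  by rewrite eq_sym xv.
by split=> //; rewrite in_set in_setD rD vr !andbT.
Qed.

Lemma star_rmX H x : H \in star -> x \in X H -> X (rm H x) = X H :\ x.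
Proof. by move=> Hs /(star_rm Hs)[_ _ -> _ _]; rewrite !setDDl setUC. Qed.

Lemma star_rmC H x y : H \in star -> x \in X H -> y \in X H -> x != y ->
  rm (rm H x) y = rm (rm H y) x.
Proof.
move=> Hs xX yX xy; have [rD rH Vr _ _] := star_rm Hs xX.
have [rD' rH' Vr' _ _] := star_rm Hs yX.
have [r2D r2 V2] := rmP y rD; have [r2D' r2' V2'] := rmP x rD'.
have [HD _ _ _] := starP _ Hs.
apply: (@face_eq _ _ H) => //; [exact: le_trans rH|exact: le_trans rH'|].
by rewrite V2 V2' Vr Vr' !setDDl setUC.
Qed.

Lemma star_rmL H x y : H \in star -> x \in X H -> y \in X H -> x != y ->
  rm (rm H x) y \in star -> rm H x \in star.
Proof.
move=> Hs xX yX xy; have [rD rH _ _ ->] := star_rm Hs xX.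
case/starP=> r2D r2G _ _; apply: contra r2G => rG.
by have [_ r2 _] := rmP y rD; apply: Gm_lower rG r2D r2.
Qed.

Lemma vertices_of_sub H : V H \subset vertices D.
Proof. by apply/subsetP=> x /vertices_ofP[xD rx _]; apply/verticesP. Qed.

Lemma star_XXv H : H \in star -> X H \subset Xv.
Proof. by move=> _; apply/setSD/vertices_of_sub. Qed.

Lemma link_rel_facesP q (W : {set T}) H : W \subset Xv ->
  (H \in rel_faces (lk v (induced D (v |: W))) (lk v (induced Gm (v |: W))) (q%:Z - 1)) =
  [&& H \in star, X H \subset W & #|X H| == q].
Proof.
move=> WX; rewrite rel_facesP ?vD // (vertices_of_vertex vV) cards1 addn1.
apply/and5P/and3P => [[HD HG vH HW /eqP cH]|[Hs HW /eqP cH]].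
  have Hs : H \in star by rewrite in_set in_setD HG HD vH.
  by split=> //; [rewrite subDset | move: cH; rewrite star_card // => -[->]].
by have [HD HG vH _] := starP _ Hs; rewrite -subDset star_card // cH.
Qed.

Variable K : fieldType.

Lemma dim_limg_matrix (aT rT : vectType K) (f : 'Hom(aT, rT)) (U : {vspace aT}) m n
    (M : 'M[K]_(m, n)) (g : 'cV[K]_m -> rT) : linear g ->
  (forall z, z \in U -> exists s : 'cV_n, f z = g (M *m s)) ->
  (\dim (f @: U) <= \rank M)%N.
Proof.
move=> glin fg; pose h (s : 'cV[K]_(\rank M)) := g (col_base M *m s).
have hlin : linear h by move=> a s1 s2; rewrite /h mulmxDr -scalemxAr glin.
pose hL := GRing.isLinear.Build K _ _ _ h hlin.
pose hl : {linear 'cV[K]_(\rank M) -> rT} := HB.pack h hL.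
have sub : (f @: U <= limg (linfun hl))%VS.
  apply/subvP=> _ /memv_imgP[z zU ->]; have [s ->] := fg z zU.
  apply/memv_imgP; exists (row_base M *m s); first exact: memvf.
  by rewrite lfunE /= /h mulmxA mulmx_base.
apply: leq_trans (dimvS sub) _.
apply: (@leq_trans (\dim {: 'cV[K]_(\rank M)})).
  by rewrite -(limg_ker_dim (linfun hl) fullv) leq_addl.
by rewrite dimvf dim_matrix mulr1.
Qed.

Lemma sg_dsg (Y : {set T}) x : x \in Y -> @sg K T x Y = (-1) ^+ #|Y|.-1 * @dsg K T x Y.
Proof.
move=> xY; rewrite (sgD1 K x xY) (dsgD1 K x xY) etaxx !mul1r /sg /dsg.
rewrite (cardsD1 x) xY /= -prodr_const -big_split /=; apply: eq_bigr => y /setD1P[yx _].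
by rewrite mulN1r eta_anti // eq_sym.
Qed.

(** In [Wsp W q] the set [S] is determined by [H], so its elements are cochains of the link of [v]
    in the part induced on [v |: W]. After the sign changes [kap], [o] and (-1)^q, [deltaO] is the
    boundary matrix acting on columns. *)
Lemma dim_Wsp_le (W : {set T}) q : W \subset Xv ->
  (\dim (linfun (@deltaO K T T star (fun H => X H) rm) @:
     @Wsp K T T star (fun H => X H) W q) <= @bd_rank v (v |: W) K q.+1)%N.
Proof.
move=> WX; pose o := @orient v K set0.
pose kap H : K := \prod_(x in X H) sg x W.
pose R i := rel_faces (lk v (induced D (v |: W))) (lk v (induced Gm (v |: W))) i.
pose g (s : 'cV[K]_#|R (q.+1%:Z - 1)|) : {ffun T * {set T} -> K^o} :=
  [ffun HS => if HS.2 == W :\: X HS.1 then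
     \sum_(a | enum_val a == HS.1) kap HS.1 * o HS.1 * (-1) ^+ q * s a 0 else 0].
have glin : linear g.
  move=> c s1 s2; apply/ffunP=> -[H S]; rewrite !ffunE /=; case: ifP => _; last by rewrite scaler0 addr0.
  rewrite scaler_sumr -big_split /=; apply: eq_bigr => a _; rewrite !mxE mulrDr.
  by congr (_ + _); rewrite mulrCA.
apply: dim_limg_matrix glin _ => z /coord_spaceP zW.
exists (\col_b (o (enum_val b) * kap (enum_val b) * z (enum_val b, W :\: X (enum_val b)))).
rewrite lfunE; apply/ffunP=> -[H S]; rewrite !ffunE /=.
have dz : delta (fun H => X H) rm (slice z) H S =
    \sum_(x in X H) if x \in S then 0 else @sg K T x S * z (rm H x, x |: S).
  by rewrite sum_ffunE; apply: eq_bigr => x _; rewrite conxE; case: ifP => // _; rewrite ffunE.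
have zrm x : H \in star -> x \in X H -> x \notin S -> z (rm H x, x |: S) != 0 ->
    [&& H \in star, X H \subset W & #|X H| == q.+1] /\ S = W :\: X H.
  move=> Hs xX xS /zW /= /and4P[rs /eqP cr rW /eqP SW].
  have xW : x \in W.
    by have : x \in x |: S by [rewrite setU11]; rewrite SW => /setDP[].
  rewrite star_rmX // in SW cr rW; split.
    by rewrite Hs -[in X H \subset W](setD1K xX) subUset sub1set xW rW (cardsD1 x (X H)) xX cr /=.
  by rewrite -(setU1K xS) SW setDDl setUC setD1K.
rewrite {}dz; have [/and3P[Hs HW /eqP cX]|nH] := boolP [&& H \in star, X H \subset W & #|X H| == q.+1]; last first.
  transitivity (0 : K).
    case: ifP => // Hs; apply: big1 => x xX; case: ifPn => // xS; apply/eqP.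
    apply: contraNT nH; rewrite mulf_eq0 negb_or => /andP[_ zn].
    by have [] := zrm x Hs xX xS zn.
  apply/esym; case: ifP => // _; apply: big_pred0 => a; apply: contraNF nH => /eqP <-.
  by rewrite -link_rel_facesP //; apply: enum_valP.
rewrite Hs; case: eqP => [SW|nSW]; last first.
  apply: big1 => x xX; case: ifPn => // xS; apply/eqP; case: (eqVneq (z (rm H x, x |: S)) 0) => [->|zn].
    by rewrite mulr0.
  by case: nSW; have [] := zrm x Hs xX xS zn.
have HR : H \in R (q.+1%:Z - 1) by rewrite /R link_rel_facesP // Hs HW cX eqxx.
have [HD HG vH vVH] := starP _ Hs.
have VH : V H :\: V v = X H by rewrite (vertices_of_vertex vV).
have HvW : V H \subset v |: W by rewrite -subDset.
have Hi : enum_val (enum_rank_in HR H) = H by rewrite enum_rankK_in.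
rewrite (big_pred1 (enum_rank_in HR H)) => [|a]; last first.
  by rewrite -{1}Hi (inj_eq enum_val_inj).
rewrite mxE; pose phi G := o G * kap G * z (G, W :\: X G).
transitivity (kap H * o H * (-1) ^+ q *
  \sum_(G in R (q.+1%:Z - 1 - 1)) incidence K (lk v (induced D (v |: W))) H G * phi G); last first.
  by congr (_ * _); rewrite [LHS]big_enum_val; apply: eq_bigr => b _; rewrite !mxE Hi.
rewrite /R (_ : q.+1%:Z - 1 - 1 = q%:Z - 1); last by lia.
rewrite sum_incidence ?vD //; last first.
  by rewrite (vertices_of_vertex vV) cards1 star_card // cX addn1.
rewrite VH big_distrr; apply: eq_bigr => x xX /=.
have xS : x \notin S by rewrite SW in_setD xX.
rewrite (negPf xS); have [_ _ _ _ rs] := star_rm Hs xX.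
rewrite (incidence_orient vD K (sub0set _)) ?VH // setU0.
have Sx : x |: S = W :\: X (rm H x).
  rewrite SW star_rmX //; apply/setP=> y; rewrite in_setU1 !in_setD !in_set1.
  by case: (eqVneq y x) => [->|_] //=; rewrite (subsetP HW x xX).
rewrite Sx; case: ifPn => rG.
  rewrite mulr0 mulr0 (_ : z _ = 0) ?mulr0 //; apply/eqP; apply: contraTT rG => /zW /= /and4P[].
  by rewrite rs.
rewrite /phi; move: (z _) => zz.
(* [S] and [X H] partition [W]. The sign over [W] is absorbed by [kap], the one over [X H] becomes
   [dsg] by [sg_dsg]. *)
have -> : @sg K T x S = @sg K T x W * @sg K T x (X H).
  rewrite -[in sg x W](setID W (X H)) (setIidPr HW) setUC sgU; last first.
    by rewrite disjoints_subset; apply/subsetP=> y; rewrite in_setC in_setD => /andP[].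
  by rewrite -mulrA sg_sq mulr1 SW.
have -> : sg x W = kap H * kap (rm H x).
  by rewrite /kap (big_setD1 x xX) /= star_rmX // -mulrA -big_split big1 ?mulr1 // => y _; apply: sg_sq.
rewrite sg_dsg // cX /=.
have oo G : o G * o G = 1 by apply: orient_sq.
have kk G : kap G * kap G = 1 by rewrite /kap -big_split big1 // => y _; apply: sg_sq.
rewrite -/o; move: (oo H) (oo (rm H x)) (kk (rm H x)).
move: (o H) (o (rm H x)) (kap H) (kap (rm H x)) (dsg x _) ((-1) ^+ q) => o1 o2 k1 k2 s e e1 e2 e3.
transitivity (k1 * k2 * e * s * zz); first by ring.
by transitivity (k1 * k2 * e * s * zz * (o1 * o1) * (o2 * o2)); [rewrite e1 e2 !mulr1 | ring].
Qed.

Lemma induced_vertices : induced D (vertices D) = D.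
Proof. by apply/setP=> H; rewrite in_set vertices_of_sub andbT. Qed.

Lemma induced_vertices_ideal : induced Gm (vertices D) = Gm.
Proof.
apply/setP=> H; rewrite in_set; case: (boolP (H \in Gm)) => //= HG.
by rewrite vertices_of_ideal // vertices_of_sub.
Qed.

Variables (r : int) (d : nat).
Hypothesis hserre : serre K r (lk v D) (lk v Gm).
Hypothesis htop : forall F H, F \in D -> H \in D -> H \notin Gm -> (F <= H)%O ->
  exists G, [/\ G \in D, G \notin Gm, (F <= G)%O & #|V G| = d.+1].

Lemma lk_lk F (D' : {set T}) : (v <= F)%O -> lk F (lk v D') = lk F D'.
Proof.
move=> vF; apply/setP=> G; rewrite !in_set; case FG: (F <= G)%O; rewrite ?andbF //.
by rewrite (le_trans vF FG) andbT.
Qed.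

(** By purity, in the form [htop], some relative face above [F] has [d.+1] vertices, so the link of
    [F] has dimension greater than q - 1 and (S_r) applies. *)
Lemma serre_link F q : F \in D -> (v <= F)%O -> q%:Z < r -> (q + #|V F| <= d)%N ->
  (exists H, [/\ H \in D, H \notin Gm & (F <= H)%O]) ->
  red_homology K (lk F D) (lk F Gm) (q%:Z - 1) = 0.
Proof.
move=> FD vF qr qd [H [HD HG FH]]; have [G [GD GG FG cG]] := htop FD HD HG FH.
rewrite -[in lk F D](@lk_lk F) // -[in lk F Gm](@lk_lk F) //; apply: hserre.
  by rewrite in_set FD vF.
rewrite !lk_lk // lt_min ltrD2r qr /=.
rewrite /rel_dim ltrD2r ltz_nat.
have GR : G \in lk F D :\: lk F Gm by rewrite in_setD !in_set FG GD (negPf GG).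
apply: leq_trans (leq_bigmax_cond _ GR).
have := @face_rank_link F (vertices D) FD G GD FG (vertices_of_sub G).
by rewrite induced_vertices => -[-> _]; rewrite cG; lia.
Qed.

(** The faces whose labels contain [A] fall into groups according to their face [F] with vertices
    [v |: A]; there may be several such [F]. Each group is a link, to which [link_primitive]
    applies. *)
Lemma star_col_exact (A : {set T}) q : q%:Z < r -> (q + #|A| < d)%N ->
  exists c : T -> T -> K, (forall H G, c H G != 0 -> H \in star) /\
    forall y : T -> K, (forall H, H \notin star -> y H = 0) ->
    (forall H, H \in star -> A \subset X H -> #|X H| = (q + #|A|).+1 ->
       \sum_(x in X H :\: A) dsg x (X H) * y (rm H x) = 0) ->
    forall H, H \in star -> A \subset X H -> #|X H| = (q + #|A|)%N ->
       y H = \sum_(x in X H :\: A) dsg x (X H) * \sum_G c (rm H x) G * y G.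
Proof.
move=> qr qd.
have XA H : A \subset X H -> (X H :\: A) :|: A = X H.
  move=> AX; apply/setP=> x; rewrite in_setU in_setD; have := subsetP AX x.
  by case: (x \in A) => [/(_ isT)->|_]; rewrite ?orbF.
have AF F : V F = v |: A -> A \subset V F by move=> ->; apply: subsetUr.
have /fin_all_exists [c cP] : forall F, exists c : T -> T -> K,
    F \in D -> (v <= F)%O -> V F = v |: A -> v \notin A ->
    forall y : T -> K, (forall H, H \notin star -> y H = 0) ->
    (forall H, H \in star -> A \subset X H -> #|X H| = (q + #|A|).+1 ->
       \sum_(x in X H :\: A) dsg x (X H) * y (rm H x) = 0) ->
    forall H, H \in star -> (F <= H)%O -> A \subset X H -> #|X H| = (q + #|A|)%N ->
       y H = \sum_(x in X H :\: A) dsg x (X H) *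
         (if rm H x \in Gm then 0 else \sum_G c (rm H x) G * y G).
  move=> F; have [/and4P[FD vF /eqP VF vA]|nF] :=
    boolP [&& F \in D, (v <= F)%O, V F == v |: A & v \notin A]; last first.
    by exists (fun _ _ => 0) => FD vF VF vA; rewrite FD vF VF vA eqxx in nF.
  have cF : #|V F| = #|A|.+1 by rewrite VF cardsU1 vA.
  have VHF H : V H :\: V F = X H :\: A by rewrite VF setDDl.
  have [/existsP[H0 /and3P[H0D H0G FH0]]|none] :=
    boolP [exists H, [&& H \in D, H \notin Gm & (F <= H)%O]]; last first.
    exists (fun _ _ => 0) => _ _ _ _ y _ _ H /starP[HD HG _ _] FH.
    by case/existsP: none; exists H; rewrite HD HG FH.
  have := @link_primitive F (vertices D) FD K A q (AF F VF).
  rewrite induced_vertices induced_vertices_ideal => -[|c cE].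
    by apply: serre_link => //; [rewrite cF; lia | exists H0].
  exists c => _ _ _ _ y ystar dy H Hs FH AX cX.
  have [HD HG vH vVH] := starP _ Hs.
  rewrite (cE y) => [|G|]; first by rewrite VHF XA.
    move: (@rel_facesP F (vertices D) FD q.+1 G); rewrite induced_vertices induced_vertices_ideal => ->.
    case/and5P=> GD GG FG _ /eqP cG.
    have Gs : G \in star by rewrite in_set in_setD GG GD (le_trans vF FG).
    have AG : A \subset X G by rewrite subsetD1 vA andbT; apply: subset_trans (vertices_ofS FG); apply: AF.
    rewrite VHF XA // -[RHS](dy G Gs AG); last by move: cG; rewrite star_card // cF addnS addSn => -[->].
    apply: eq_bigr => x /setDP[xX _]; congr (_ * _); case: ifP => // rG.
    by rewrite ystar //; have [_ _ _ _ ->] := star_rm Gs xX; rewrite rG.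
  move: (@rel_facesP F (vertices D) FD q H); rewrite induced_vertices induced_vertices_ideal => ->.
  by rewrite HD HG FH vertices_of_sub star_card // cX cF addnS eqxx.
(* The group is read off the first argument; removing a label outside [A] does not change it. *)
exists (fun G H => if G \in star then c (res G (v |: A)) G H else 0).
split=> [H G|y ystar dy H Hs AX cX]; first by case: ifP; rewrite ?eqxx.
have [HD HG vH vVH] := starP _ Hs.
have vAH : v |: A \subset V H by rewrite subUset sub1set vVH (subset_trans AX) ?subD1set.
have [FD FH VF] := resP HD vAH; set F := res H _ in FD FH VF.
have vF : (v <= F)%O.
  by rewrite (@vertices_of_le _ _ H) ?vD // (vertices_of_vertex vV) VF sub1set setU11.
have vA : v \notin A by apply/negP=> /(subsetP AX); rewrite setD11.
rewrite (cP F FD vF VF vA y ystar dy H Hs FH AX cX).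
apply: eq_bigr => x /setDP[xX xA]; congr (_ * _).
have [rD rH Vr vr rs] := star_rm Hs xX; rewrite rs.
case: ifP => rG /=; first by rewrite big1 // => G _; rewrite mul0r.
suff -> : res (rm H x) (v |: A) = F by [].
have Fr : (F <= rm H x)%O.
  rewrite (@vertices_of_le _ _ H) // Vr VF subsetD1 vAH in_setU1 negb_or xA andbT.
  by case/setD1P: xX.
exact: res_eq.
Qed.

Lemma card_supersets (U Y : {set T}) n : Y \subset U ->
  #|[set W : {set T} | (W \subset U) && (#|W| == n) && (Y \subset W)]| =
  (if (#|Y| <= n)%N then 'C(#|U| - #|Y|, n - #|Y|) else 0)%N.
Proof.
move=> YU; case: leqP => Yn; last first.
  apply: eq_card0 => W; rewrite in_set; apply/negP=> /andP[/andP[_ /eqP cW] /subset_leq_card].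
  by rewrite cW leqNgt Yn.
have -> : (#|U| - #|Y|)%N = #|U :\: Y| by rewrite cardsD (setIidPr YU).
rewrite -cards_draws.
rewrite -(card_in_imset (f := fun W => W :\: Y)) => [|W1 W2]; last first.
  rewrite !in_set => /andP[_ Y1] /andP[_ Y2] eW.
  by rewrite -(setID W1 Y) -(setID W2 Y) eW (setIidPr Y1) (setIidPr Y2).
apply: eq_card => S; rewrite in_set; apply/imsetP/andP => [[W]|[SU /eqP cS]].
  rewrite in_set => /andP[/andP[WU /eqP cW] YW] ->.
  by rewrite setSD // cardsD (setIidPr YW) cW.
exists (S :|: Y); last first.
  rewrite setDUl setDv setU0; apply/esym/setDidPl.
  by move: SU; rewrite subsetD => /andP[].
move: SU; rewrite subsetD => /andP[SU dS].
rewrite in_set subUset SU YU subsetUr andbT /= cardsU (disjoint_setI0 dS) cards0 subn0.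
by rewrite cS subnK.
Qed.

Lemma alt_sum_telescope (R : comPzRingType) (a f : nat -> R) I : a 0%N = 0 ->
  \sum_(0 <= q < I.+1) (-1) ^+ (I - q) * (f q - a q - a q.+1) =
  \sum_(0 <= q < I.+1) (-1) ^+ (I - q) * f q - a I.+1.
Proof.
move=> a0; elim: I => [|I IH].
  by rewrite !big_nat1 subnn !mul1r a0 subr0.
have sgn g : \sum_(0 <= q < I.+1) (-1) ^+ (I.+1 - q) * g q = - \sum_(0 <= q < I.+1) (-1) ^+ (I - q) * g q :> R.
  rewrite -sumrN; apply: eq_big_nat => q /andP[_ qI].
  by rewrite subSn // exprS mulN1r mulNr.
rewrite big_nat_recr //= [in RHS]big_nat_recr //= !sgn IH subnn !mul1r.
by ring.
Qed.

Local Notation linkW W := (lk v (induced D (v |: W))).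
Local Notation linkGW W := (lk v (induced Gm (v |: W))).

Lemma vertex_ineq (t : T -> K) I : injective t ->
  (forall H, H \in star -> (#|V H| <= d.+1)%N) -> I%:Z < r -> (I <= d)%N ->
  \sum_(W : {set T} | W \subset Xv) beta #|Xv| #|W| *
    (\sum_(0 <= q < I.+1) (-1) ^+ (I - q) * (betti K (linkW W) (linkGW W) (q%:Z - 1))%:R) <=
  \sum_(0 <= n < I.+1) beta d n * ((-1) ^+ (I - n) * @hL T T star (fun H => X H) d n).
Proof.
move=> t_inj dim_d Ir Id.
pose fW W q := #|rel_faces (linkW W) (linkGW W) (q%:Z - 1)|.
pose aW W q := @bd_rank v (v |: W) K q.
have bE W q : (betti K (linkW W) (linkGW W) (q%:Z - 1))%:R = (fW W q)%:R - (aW W q)%:R - (aW W q.+1)%:R :> rat.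
  by rewrite /fW -(@betti_bd_rank v (v |: W) vD K q) !natrD /aW; ring.
have alt W : \sum_(0 <= q < I.+1) (-1) ^+ (I - q) * (betti K (linkW W) (linkGW W) (q%:Z - 1))%:R =
    \sum_(0 <= q < I.+1) (-1) ^+ (I - q) * (fW W q)%:R - (aW W I.+1)%:R :> rat.
  rewrite -(@alt_sum_telescope _ (fun q => (aW W q)%:R) (fun q => (fW W q)%:R)).
    by apply: eq_bigr => q _; rewrite bE.
  by rewrite /aW bd_rank0 //; exact: vD.
under eq_bigr do rewrite alt.
(* With an empty star [d] might exceed the number of labels; both sides are then zero. *)
have [s0|[H0 H0s]] := set_0Vmem star.
  have fW0 (W : {set T}) q : W \subset Xv -> fW W q = 0%N.
    by move=> WX; apply: eq_card0 => H; rewrite link_rel_facesP // s0 in_set0.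
  rewrite big1 => [|W WX]; last first.
    rewrite big1 => [|q _]; last by rewrite fW0 // mulr0.
    have : (aW W I.+1 <= fW W I.+1)%N by apply: rank_leq_row.
    by rewrite fW0 // leqn0 => /eqP->; rewrite subr0 mulr0.
  rewrite big1 // => n _; rewrite /hL big1 ?mulr0 // => q _.
  by rewrite /fL s0 (_ : [set H in set0 | _] = set0) ?cards0 ?mulr0 //; apply/setP=> H; rewrite !in_set.
have Xd H : H \in star -> (#|X H| <= d)%N.
  by move=> Hs; have := dim_d H Hs; rewrite star_card.
have dX : (d <= #|Xv|)%N.
  have [HD HG vH _] := starP _ H0s; have [G [GD GG vG cG]] := htop vD HD HG vH.
  have Gs : G \in star by rewrite in_set in_setD GG GD.
  have : #|X G| = d by move: cG; rewrite star_card // => -[].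
  by move=> <-; apply/subset_leq_card/star_XXv.
pose N := (#|Xv| - d)%N; have XvN : #|Xv| = (N + d)%N by rewrite subnK.
have qr q : (q < I.+1)%N -> q%:Z < r by move=> qI; apply: le_lt_trans Ir; rewrite lez_nat.
have col (A : {set T}) q (qI : (q < I.+1)%N) (qd : (q + #|A| < d)%N) :=
  @star_col_exact A q (qr q qI) qd.
have main := @sum_beta_tau_le K T T star (fun H => X H) rm Xv t d N star_rmX star_rmC star_rmL
  star_XXv Xd XvN t_inj I.+1 col I (leqnn _) Id.
apply: le_trans main; rewrite -XvN.
rewrite (partition_big (fun W : {set T} => inord #|W| : 'I_#|Xv|.+1) xpredT) //= big_mkord.
apply: ler_sum => n _.
have cn (W : {set T}) : W \subset Xv -> (inord #|W| == n) = (#|W| == n :> nat).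
  by move=> WX; rewrite -val_eqE /= inordK // ltnS subset_leq_card.
rewrite (eq_bigl (fun W : {set T} => (W \subset Xv) && (#|W| == n))) => [|W]; last first.
  by case WX: (W \subset Xv); rewrite //= cn.
rewrite (eq_bigr (fun W : {set T} => beta #|Xv| n * (\sum_(0 <= q < I.+1) (-1) ^+ (I - q) * (fW W q)%:R - (aW W I.+1)%:R))) => [|W /andP[_ /eqP->]] //.
rewrite -big_distrr /=; apply: ler_wpM2l; first exact: beta_ge0.
(* The dimensions agree by counting the pairs with [X H \subset W]; the ranks enter negatively, so
   upper bounds for [rk] suffice. *)
rewrite sumrB /tau; apply: lerB; last first.
  rewrite -natr_sum ler_nat; apply: leq_trans (rk0_le rm t star_XXv n I) _.
  by apply: leq_sum => W /andP[WX _]; apply: dim_Wsp_le.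
rewrite exchange_big le_eqVlt; apply/orP; left; apply/eqP; apply: eq_big_nat => q _.
rewrite -big_distrr /= -natr_sum; congr (_ * _%:R).
rewrite (@dim_Zsp K T T star (fun H => X H) Xv t d N star_XXv Xd XvN t_inj n q 0 (leq0n _)) subn0 -XvN.
transitivity (\sum_(W : {set T} | (W \subset Xv) && (#|W| == n)) \sum_(H in star | #|X H| == q) (X H \subset W : nat))%N.
  apply: eq_bigr => W /andP[WX _]; rewrite -big_mkcondr /= sum1dep_card; apply: eq_card => H.
  by rewrite in_set link_rel_facesP // -andbA; congr (_ && _); rewrite andbC.
rewrite exchange_big /= /fL -sum_nat_const; apply: eq_big => [H|H /andP[Hs /eqP cH]]; first by rewrite in_set.
rewrite -big_mkcondr /= sum1dep_card card_supersets ?star_XXv // cH.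
by [].
Qed.

End VertexLink.
End SimplicialPosetTheory.

(** * Extension of the field and averaging over the orderings *)

Section FieldExtension.
Context {disp : Order.disp_t} {T : finPOrderType disp}.
Variables (K K' : fieldType) (f : {rmorphism K -> K'}).
Implicit Types D Gm : {set T}.

Lemma incidence_map D G H : incidence K' D G H = f (incidence K D G H).
Proof.
rewrite /incidence; case: ifP => _; last by rewrite rmorph0.
by rewrite rmorph_sum; apply: eq_bigr => w _; rewrite rmorphXn rmorphN1.
Qed.

Lemma boundary_map D Gm i j : boundary K' D Gm i j = map_mx f (boundary K D Gm i j).
Proof. by apply/matrixP=> a b; rewrite !mxE incidence_map. Qed.

(** Incidence numbers come from integers, and ranks survive field extension. Hence a small [K] may
    be enlarged until it contains enough distinct nodes. *)
Lemma betti_map D Gm i : betti K' D Gm i = betti K D Gm i.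
Proof.
rewrite /betti /red_homology !boundary_map -map_kermx.
by rewrite -(mxrank_map f (_ :\: _)%MS) map_diffmx.
Qed.

Lemma serre_map r D Gm : serre K r D Gm -> serre K' r D Gm.
Proof.
move=> S F FD i ir; apply/eqP; rewrite -mxrank_eq0 -/(betti _ _ _ _) betti_map.
by rewrite /betti S ?mxrank0.
Qed.

End FieldExtension.

Lemma tofrac_Xn_inj (K : fieldType) :
  injective (fun n : nat => tofrac ('X^n : {poly K})).
Proof.
move=> m n /eqP; rewrite tofrac_eq => /eqP/(congr1 (fun p : {poly K} => size p)).
by rewrite !size_polyXn => -[].
Qed.

(** * Counting orderings by the predecessors of a vertex *)

Section Orderings.
Variables (T : finType) (V : {set T}).
Local Notation n := #|V|.

(** Such an ordering arranges [W], then places [v], then arranges the rest; [Ls] lists each of them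
    once. *)
Lemma card_orderings_at v (W : {set T}) : v \in V -> W \subset V :\ v ->
  #|[set s : n.-tuple T | perm_eq s (enum V) && ([set u in take (index v s) s] == W)]| =
  (#|W|`! * (#|V :\ v| - #|W|)`!)%N.
Proof.
move=> vV WV; pose W2 := (V :\ v) :\: W.
pose Ls := [seq s1 ++ v :: s2 | s1 <- permutations (enum W), s2 <- permutations (enum W2)].
have cW2 : #|W2| = (#|V :\ v| - #|W|)%N by rewrite [LHS]cardsD (setIidPr WV).
have vW : v \notin W by apply/negP=> /(subsetP WV); rewrite setD11.
have LsP s : s \in Ls -> exists s1 s2, [/\ s = s1 ++ v :: s2, perm_eq s1 (enum W) & perm_eq s2 (enum W2)].
  by case/allpairsP=> -[s1 s2] /= []; rewrite !mem_permutations => p1 p2 ->; exists s1, s2.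
have idx s1 s2 : perm_eq s1 (enum W) -> index v (s1 ++ v :: s2) = size s1.
  move=> p1; rewrite index_cat (perm_mem p1) mem_enum (negPf vW) /= eqxx addn0 //.
have szL s : s \in Ls -> size s = n.
  case/LsP=> s1 [s2 [-> /perm_size p1 /perm_size p2]].
  rewrite size_cat /= p1 p2 -!cardE (cardsD1 v V) vV cW2.
  by have := subset_leq_card WV; lia.
have Ls_uniq : uniq Ls.
  apply: allpairs_uniq; rewrite ?permutations_uniq // => -[s1 s2] [s1' s2'].
  case/allpairsP=> -[a b] /= [+ _ [-> ->]]; rewrite mem_permutations => /perm_size p1.
  case/allpairsP=> -[a' b'] /= [+ _ [-> ->]]; rewrite mem_permutations => /perm_size p1'.
  by move/eqP; rewrite eqseq_cat ?p1 ?p1' // => /andP[/eqP-> /eqP[->]].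
have szLs : size Ls = (#|W|`! * (#|V :\ v| - #|W|)`!)%N.
  by rewrite size_allpairs !size_permutations ?enum_uniq // -!cardE cW2.
rewrite -szLs; have <- : size (pmap insub Ls : seq (n.-tuple T)) = size Ls.
  by rewrite size_pmap_sub; apply/eqP; rewrite -all_count; apply/allP=> s /szL->.
rewrite -(card_uniqP (pmap_sub_uniq _ Ls_uniq)); apply: eq_card => s.
rewrite inE mem_pmap_sub; apply/andP/idP => [[ps /eqP sW]|sL]; last first.
  have [s1 [s2 [sE p1 p2]]] := LsP _ sL; rewrite sE idx // take_size_cat //; split.
    apply: uniq_perm; rewrite ?enum_uniq //.
      rewrite cat_uniq /= (perm_uniq p1) (perm_uniq p2) !enum_uniq /= andbT (perm_mem p1).
      rewrite (perm_mem p2) !mem_enum !inE eqxx andbF negb_or (negPf vW) /= andbT.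
      apply/hasPn=> u; rewrite (perm_mem p2) /= (perm_mem p1) !mem_enum.
      by rewrite inE => /andP[].
    move=> u; rewrite mem_cat inE (perm_mem p1) (perm_mem p2) !mem_enum !inE.
    case: (eqVneq u v) => [->|uv] /=; first by rewrite vV orbT.
    by have := subsetP WV u; rewrite !inE uv; case: (u \in W) => [/(_ isT)/= ->|_].
  by apply/eqP/setP=> u; rewrite inE (perm_mem p1) mem_enum.
have us : uniq s by rewrite (perm_uniq ps) enum_uniq.
have vs : v \in val s by rewrite (perm_mem ps) mem_enum.
pose i := index v s; have sE : val s = take i s ++ v :: drop i.+1 s.
  by rewrite -[LHS](cat_take_drop i) (drop_nth v) ?index_mem // nth_index.
have us' := us; rewrite sE cat_uniq /= in us'; case/and4P: us' => u1 hs vd u2.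
apply/allpairsP; exists (take i s, drop i.+1 s); rewrite /= !mem_permutations; split=> //.
  apply: uniq_perm; rewrite ?enum_uniq // => u.
  by rewrite mem_enum -sW inE.
apply: uniq_perm; rewrite ?enum_uniq // => u; rewrite mem_enum !inE -sW inE.
have -> : (u \in V) = [|| u \in take i s, u == v | u \in drop i.+1 s].
  by rewrite -mem_enum -(perm_mem ps) [in LHS]sE mem_cat inE.
rewrite -/i; case: (eqVneq u v) => [->|uv] /=; first by rewrite andbF (negPf vd).
case ud: (u \in drop _ _); last by rewrite orbF andNb.
rewrite orbT andbT.
by apply/esym; move: hs; rewrite negb_or => /andP[_ /hasPn/(_ u ud)].
Qed.

Lemma sum_orderings (g : T -> {set T} -> nat) :
  (\sum_(s : n.-tuple T | perm_eq s (enum V)) \sum_(k < n) g (tnth s k) [set u in take k s] =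
   \sum_(v in V) \sum_(W : {set T} | W \subset V :\ v)
     #|W|`! * (#|V :\ v| - #|W|)`! * g v W)%N.
Proof.
transitivity (\sum_(s : n.-tuple T | perm_eq s (enum V)) \sum_(v in V) g v [set u in take (index v s) s])%N.
  apply: eq_bigr => s ps; have us : uniq s by rewrite (perm_uniq ps) enum_uniq.
  rewrite -[RHS]big_enum -(perm_big _ ps) /= big_tuple; apply: eq_bigr => k _.
  by rewrite (tnth_nth (tnth s k)) index_uniq ?size_tuple.
rewrite exchange_big /=; apply: eq_bigr => v vV.
rewrite (partition_big (fun s : n.-tuple T => [set u in take (index v s) s]) (fun W => W \subset V :\ v)) /=; last first.
  move=> s ps; apply/subsetP=> u; rewrite inE => us; rewrite !inE.
  have us' := mem_take us; rewrite (perm_mem ps) mem_enum in us'; rewrite us' andbT.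
  apply: contraTneq us => ->; rewrite in_take ?ltnn // (perm_mem ps) mem_enum //.
apply: eq_bigr => W WV; rewrite -card_orderings_at // -sum1dep_card big_distrl /=.
by apply: eq_bigr => s /andP[_ /eqP->]; rewrite mul1n.
Qed.

End Orderings.

(** * Face numbers and the sum over the vertices *)

Section FaceNumbers.
Context {disp : Order.disp_t} {T : finPOrderType disp}.
Variables (D Gm : {set T}) (d : nat).
Hypothesis hD : simplicial_poset D.
Hypothesis GmD : Gm \subset D.
Hypothesis Gm_lower : forall F G, G \in Gm -> F \in D -> (F <= G)%O -> F \in Gm.
Local Notation V := (vertices_of D).

Lemma fnumE j : fnum D Gm (j%:Z - 1) = #|[set H in D :\: Gm | #|V H| == j]|.
Proof.
apply: eq_card => H; rewrite [LHS]in_set [RHS]in_set in_setD.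
case HD: (H \in D); rewrite ?andbF //=; congr (_ && _).
by rewrite /face_dim (inj_eq (addIr _)) eqz_nat face_rankE.
Qed.

Definition h_rat n : rat := \sum_(0 <= j < n.+1)
  (-1) ^+ (n - j) * 'C(d.+1 - j, n - j)%:R * (fnum D Gm (j%:Z - 1))%:R.

Lemma hnumE n : rel_dim D Gm = d%:Z -> (hnum D Gm n)%:~R = h_rat n.
Proof.
move=> hd; rewrite /hnum /h_rat rmorph_sum hd; apply: eq_bigr => j _.
rewrite !rmorphM rmorphXn rmorphN1 !rmorph_nat.
by rewrite (_ : `|(d%:Z + 1)%R|%N = d.+1) // -[d%:Z + 1]/(Posz (d + 1)) addn1.
Qed.

Lemma sum_fL q : (\sum_(v in vertices D) fL (star D Gm v) (fun H => V H :\ v) q =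
  q.+1 * fnum D Gm (q.+1%:Z - 1))%N.
Proof.
rewrite fnumE mulnC -sum_nat_const.
transitivity (\sum_(v in vertices D) \sum_(H in [set H in D :\: Gm | #|V H| == q.+1]) (v \in V H : nat))%N.
  apply: eq_bigr => v vV; rewrite -big_mkcondr sum1dep_card; apply: eq_card => H.
  rewrite [LHS]in_set [RHS]in_set [in RHS]in_set.
  apply/andP/andP => [[Hs /eqP cH]|[/andP[HD /eqP cH] vH]].
    have [HD HG vH vVH] := starP Gm vV _ Hs; rewrite in_setD HG HD vVH; split=> //=.
    by rewrite (star_card vV Hs) cH.
  have Hs : H \in star D Gm v.
    by rewrite [H \in star _ _ _]in_set HD; case/vertices_ofP: vH.
  by split=> //; move: cH; rewrite (star_card vV Hs) => -[->].
rewrite exchange_big; apply: eq_bigr => H; rewrite in_set => /andP[_ /eqP cH].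
rewrite -big_mkcondr sum1dep_card -cH; apply: eq_card => v.
by rewrite [LHS]in_set andb_idl // => /(subsetP (vertices_of_sub D H)).
Qed.

(** Absorption of binomials writes the [h_n] part through the terms [c q] of [h_(n+1)], leaving the
    coefficient (n+1) - (n-q) = q+1, the number of stars that count a face with q+1 vertices. The
    terms with the empty face cancel. *)
Lemma sum_hL n : (n <= d)%N ->
  \sum_(v in vertices D) hL (star D Gm v) (fun H => V H :\ v) d n =
  n.+1%:R * h_rat n.+1 + (d.+1 - n)%:R * h_rat n.
Proof.
move=> nd; pose F j : rat := (fnum D Gm (j%:Z - 1))%:R.
pose c q : rat := (-1) ^+ (n - q) * 'C(d - q, n - q)%:R * F q.+1.
have -> : \sum_(v in vertices D) hL (star D Gm v) (fun H => V H :\ v) d n =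
    \sum_(0 <= q < n.+1) q.+1%:R * c q.
  rewrite /hL exchange_big; apply: eq_bigr => q _ /=.
  by rewrite -big_distrr -natr_sum sum_fL natrM /c mulrCA.
have -> : h_rat n.+1 = (-1) ^+ n.+1 * 'C(d.+1, n.+1)%:R * F 0 + \sum_(0 <= q < n.+1) c q.
  by rewrite /h_rat big_nat_recl // !subn0; congr (_ + _); apply: eq_bigr => q _; rewrite !subSS.
have -> : (d.+1 - n)%:R * h_rat n = (-1) ^+ n * (d.+1 - n)%:R * 'C(d.+1, n)%:R * F 0 -
    \sum_(0 <= q < n.+1) (n - q)%:R * c q.
  rewrite /h_rat big_nat_recl // mulrDr !subn0 big_nat_recr //= subnn mul0r addr0; congr (_ + _).
    by rewrite -/(F 0); ring.
  rewrite big_distrr -sumrN /=; apply: eq_big_nat => q /andP[_ qn].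
  rewrite -/(F q.+1) /c; have -> : (n - q = (n - q.+1).+1)%N by lia.
  have := mul_bin_left (d - q) (n - q.+1).
  have -> : (d - q - (n - q.+1) = d.+1 - n)%N by lia.
  move/(congr1 (fun k => k%:R : rat)); rewrite !natrM subSS exprS => e.
  transitivity ((-1) ^+ (n - q.+1) * F q.+1 * ((d.+1 - n)%:R * 'C(d - q, n - q.+1)%:R)); first by ring.
  by rewrite -e; ring.
have := mul_bin_left d.+1 n; move/(congr1 (fun k => k%:R : rat)); rewrite !natrM exprS => e.
rewrite mulrDr addrACA.
rewrite [X in _ = X + _](_ : _ = 0) ?add0r; last first.
  transitivity ((-1) ^+ n * F 0%N * ((d.+1 - n)%:R * 'C(d.+1, n)%:R - n.+1%:R * 'C(d.+1, n.+1)%:R)); first by ring.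
  by rewrite e subrr mulr0.
rewrite big_distrr -sumrB; apply: eq_big_nat => q /andP[_ qn] /=.
by rewrite -mulrBl -natrB; [congr (_%:R * _); lia | lia].
Qed.

Definition h_ratio n : rat := h_rat n / 'C(d.+1, n)%:R.

Lemma sum_beta_hL n : (n <= d)%N ->
  \sum_(v in vertices D) beta d n * hL (star D Gm v) (fun H => V H :\ v) d n = h_ratio n.+1 + h_ratio n.
Proof.
move=> nd; rewrite -big_distrr /= sum_hL // mulrDr.
have nz k : k`!%:R != 0 :> rat by rewrite pnatr_eq0 -lt0n fact_gt0.
have nzS k : k.+1%:R != 0 :> rat by rewrite pnatr_eq0.
have nzC k m : (m <= k)%N -> 'C(k, m)%:R != 0 :> rat by rewrite pnatr_eq0 -lt0n bin_gt0.
have e1 : beta d n * n.+1%:R = 'C(d.+1, n.+1)%:R^-1.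
  have := nzC d.+1 n.+1 nd; rewrite /beta -(bin_fact (nd : n < d.+1)%N) subSS factS !natrM.
  move: (nz n) (nz (d - n)%N) (nzS n); move: (n`!%:R) ((d - n)`!%:R) (n.+1%:R) ('C(_, _)%:R).
  by move=> x y z w x0 y0 z0 w0; field; rewrite x0 y0 z0 w0.
have e2 : beta d n * (d.+1 - n)%:R = 'C(d.+1, n)%:R^-1.
  have := nzC d.+1 n (leqW nd); rewrite /beta -(bin_fact (leqW nd)) subSn // factS !natrM.
  move: (nz n) (nz (d - n)%N) (nzS (d - n)%N).
  move: (n`!%:R) ((d - n)`!%:R) ((d - n).+1%:R) ('C(_, _)%:R).
  by move=> x y z w x0 y0 z0 w0; field; rewrite x0 y0 z0 w0.
by rewrite !mulrA e1 e2 ![_^-1 * _]mulrC.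
Qed.

Lemma alt_sum_h_ratio I : \sum_(0 <= n < I.+1) (-1) ^+ (I - n) * (h_ratio n.+1 + h_ratio n) =
  h_ratio I.+1 + (-1) ^+ I * h_ratio 0 :> rat.
Proof.
elim: I => [|I IH]; first by rewrite big_nat1 subnn !mul1r.
rewrite big_nat_recr //= subnn mul1r (_ : \sum_(0 <= i < I.+1) _ = - (h_ratio I.+1 + (-1) ^+ I * h_ratio 0)).
  by rewrite exprS; ring.
rewrite -IH -sumrN; apply: eq_big_nat => q /andP[_ qI].
by rewrite subSn // exprS mulN1r mulNr.
Qed.

Lemma h_ratio0 : h_ratio 0 = (fnum D Gm (-1))%:R.
Proof. by rewrite /h_ratio /h_rat big_nat1 bin0 divr1 mulr1 subnn mul1r. Qed.

(** [W] is the set of strict predecessors of [v], while [take k.+1] includes [v] itself. Dividing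
    the count of orderings by the factorial of #|V| gives the weight [beta]. *)
Lemma muE (K : fieldType) i : mu K D Gm i = \sum_(v in vertices D)
  \sum_(W : {set T} | W \subset vertices D :\ v) beta #|vertices D :\ v| #|W| *
     (betti K (lk v (induced D (v |: W))) (lk v (induced Gm (v |: W))) (i - 1))%:R.
Proof.
pose g v (W : {set T}) := betti K (lk v (induced D (v |: W))) (lk v (induced Gm (v |: W))) (i - 1).
have := sum_orderings (vertices D) g; move/(congr1 (fun k => (#|vertices D|`!)%:R^-1 * k%:R : rat)).
rewrite /mu; set X := _ * _; set Y := _ * _ => XY.
transitivity X.
  congr (_ * _); rewrite natr_sum; apply: eq_big => [s|s _]; first by rewrite in_set.
  rewrite /mu_ordering; congr _%:R; apply: eq_bigr => k _ /=; rewrite /g.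
  suff -> : [set v in take k.+1 s] = tnth s k |: [set u in take k s] by [].
  apply/setP=> u; rewrite in_setU1 !in_set (take_nth (tnth s k)) ?size_tuple //.
  by rewrite mem_rcons inE -tnth_nth.
rewrite XY /Y natr_sum big_distrr; apply: eq_bigr => v vV.
rewrite natr_sum big_distrr; apply: eq_bigr => W WV /=.
rewrite natrM mulrA; congr (_ * _); rewrite /beta mulrC.
by rewrite (cardsD1 v (vertices D)) vV.
Qed.

Hypothesis hpure : rel_pure D Gm.
Hypothesis hdim : rel_dim D Gm = d%:Z.

Lemma max_face_rank : (\max_(F in D :\: Gm) face_rank D F = d.+1)%N.
Proof.
move: hdim; rewrite /rel_dim => /eqP; rewrite subr_eq => /eqP e.
by have /eqP := e; rewrite -[d%:Z + 1]/(Posz (d + 1)) addn1 eqz_nat => /eqP.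
Qed.

Lemma card_face_le H : H \in D :\: Gm -> (#|V H| <= d.+1)%N.
Proof.
move=> HR; rewrite -max_face_rank -face_rankE //; last by case/setDP: HR.
exact: (@leq_bigmax_cond _ (mem (D :\: Gm)) (face_rank D)).
Qed.

(** A relative face with the most vertices above [H] is maximal, and by purity it has as many
    vertices as a face attaining [rel_dim]. *)
Lemma face_extend F H : F \in D -> H \in D -> H \notin Gm -> (F <= H)%O ->
  exists G, [/\ G \in D, G \notin Gm, (F <= G)%O & #|V G| = d.+1].
Proof.
move=> FD HD HG FH.
have HR : H \in D :\: Gm by rewrite in_setD HG HD.
have maxP G : G \in D :\: Gm ->
    (forall G', G' \in D :\: Gm -> (G <= G')%O -> (#|V G'| <= #|V G|)%N) -> maximal_in (D :\: Gm) G.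
  move=> GR Gmax; split=> // G' G'R GG'; apply/esym/(@face_eq _ _ D hD G G' G') => //.
  - by case/setDP: GR.
  - by case/setDP: G'R.
  - by case/setDP: G'R.
  by apply/eqP; rewrite eqEcard (vertices_ofS D GG') Gmax.
have [G0 G0R G0d] : exists2 G0, G0 \in D :\: Gm & #|V G0| = d.+1.
  have [|G0 G0R e] := @eq_bigmax_cond _ (mem (D :\: Gm)) (face_rank D).
    by apply/card_gt0P; exists H.
  by exists G0; rewrite // -face_rankE -?e ?max_face_rank //; case/setDP: G0R.
have G0max : maximal_in (D :\: Gm) G0.
  by apply: maxP => // G' G'R _; rewrite G0d card_face_le.
pose P := [pred G | (G \in D :\: Gm) && (H <= G)%O].
have PH : P H by rewrite /= HR lexx.
case: (@arg_maxnP _ H P (fun G => #|V G|) PH) => G /= /andP[GR HleG] Gmax.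
have Gm' : maximal_in (D :\: Gm) G.
  apply: maxP => // G' G'R GG'; apply: Gmax; rewrite /= G'R.
  exact: le_trans HleG GG'.
have /setDP[GD GG] := GR; have /setDP[G0D _] := G0R.
have := hpure Gm' G0max; rewrite /face_dim (face_rankE hD GD) (face_rankE hD G0D) G0d.
move/eqP; rewrite (inj_eq (addIr _)) eqz_nat => /eqP cG.
by exists G; split=> //; apply: le_trans HleG.
Qed.

Lemma mu_sum_le (K : fieldType) (r : int) I :
  (forall v, v \in vertices D -> serre K r (lk v D) (lk v Gm)) ->
  I%:Z < r -> (I <= d)%N ->
  \sum_(0 <= q < I.+1) (-1) ^+ (I - q) * mu K D Gm q%:Z <= h_ratio I.+1 + (-1) ^+ I * h_ratio 0.
Proof.
move=> hserre Ir Id; rewrite -alt_sum_h_ratio.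
pose f := GRing.RMorphism.clone _ _ (@tofrac {poly K} \o polyC) _.
(* Distinct powers of X serve as nodes, whatever the size of [K]. *)
pose t (x : T) : {fraction {poly K}} := tofrac 'X^(enum_rank x).
have t_inj : injective t by move=> x y /tofrac_Xn_inj/val_inj/enum_rank_inj.
apply: (@le_trans _ _ (\sum_(v in vertices D) \sum_(0 <= n < I.+1)
    beta d n * ((-1) ^+ (I - n) * hL (star D Gm v) (fun H => V H :\ v) d n))); last first.
  rewrite exchange_big le_eqVlt; apply/orP; left; apply/eqP; apply: eq_big_nat => n /andP[_ nI].
  rewrite -sum_beta_hL; last by lia.
  by rewrite big_distrr; apply: eq_bigr => v _ /=; rewrite mulrCA.
have -> : \sum_(0 <= q < I.+1) (-1) ^+ (I - q) * mu K D Gm q%:Z =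
   \sum_(v in vertices D) \sum_(W : {set T} | W \subset vertices D :\ v) beta #|vertices D :\ v| #|W| *
    (\sum_(0 <= q < I.+1) (-1) ^+ (I - q) *
      (betti {fraction {poly K}} (lk v (induced D (v |: W))) (lk v (induced Gm (v |: W))) (q%:Z - 1))%:R).
  under eq_bigr do rewrite muE big_distrr.
  rewrite exchange_big; apply: eq_bigr => v _ /=.
  under eq_bigr do rewrite big_distrr.
  rewrite exchange_big; apply: eq_bigr => W _ /=; rewrite big_distrr /=.
  by apply: eq_bigr => q _; rewrite mulrCA (betti_map f).
apply: ler_sum => v vV.
apply: (vertex_ineq hD GmD Gm_lower vV (serre_map f (hserre v vV)) face_extend t_inj _ Ir Id).
by move=> H /(starP Gm vV)[HD HG _ _]; apply: card_face_le; rewrite in_setD HG HD.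
Qed.

End FaceNumbers.

Theorem theorem1p4 (K : fieldType) (disp : Order.disp_t)
    (T : finPOrderType disp) (Delta Gamma : {set T}) (d : int)
    (hrel : relative_simplicial_poset Delta Gamma)
    (hpure : rel_pure Delta Gamma)
    (hdim : rel_dim Delta Gamma = d) :
  (forall r : int, r <= d ->
     (forall v : T, v \in vertices Delta ->
        serre K r (lk v Delta) (lk v Gamma)) ->
     forall i : nat, i%:Z <= r ->
       ('C(`|(d + 1)%R|%N, i))%:R *
         (\sum_(1 <= j < i.+1) (-1) ^+ (i - j) * mu K Delta Gamma (j%:Z - 1)
          + (-1) ^+ i * (fnum Delta Gamma (-1))%:R)
       <= (hnum Delta Gamma i)%:~R :> rat) /\
  (buchsbaum K Delta Gamma ->
     forall i : nat, i%:Z <= d ->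
       ('C(`|(d + 1)%R|%N, i))%:R *
         (\sum_(1 <= j < i.+1) (-1) ^+ (i - j) * mu K Delta Gamma (j%:Z - 1)
          + (-1) ^+ i * (fnum Delta Gamma (-1))%:R)
       <= (hnum Delta Gamma i)%:~R :> rat).
Proof.
have [hD GmD Gm_lower] := hrel.
have main (r : int) : r <= d ->
     (forall v : T, v \in vertices Delta ->
        serre K r (lk v Delta) (lk v Gamma)) ->
     forall i : nat, i%:Z <= r ->
       ('C(`|(d + 1)%R|%N, i))%:R *
         (\sum_(1 <= j < i.+1) (-1) ^+ (i - j) * mu K Delta Gamma (j%:Z - 1)
          + (-1) ^+ i * (fnum Delta Gamma (-1))%:R)
       <= (hnum Delta Gamma i)%:~R :> rat.
  move=> rd hserre i ir.
  have [m dm] : exists m : nat, d = m%:Z.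
    by exists `|d|%N; rewrite gez0_abs //; apply: le_trans rd; apply: le_trans ir.
  have im : (i <= m)%N by rewrite -lez_nat -dm; apply: le_trans rd.
  rewrite dm in hdim rd *; rewrite (hnumE _ hdim).
  have -> : `|(m%:Z + 1)%R|%N = m.+1 by rewrite -[m%:Z + 1]/(Posz (m + 1)) addn1.
  have C_gt0 : 0 < 'C(m.+1, i)%:R :> rat by rewrite ltr0n bin_gt0 leqW.
  rewrite mulrC -ler_pdivlMr // -/(h_ratio Delta Gamma m i) -(h_ratio0 Delta Gamma m).
  (* For [i = 0] the sum is empty and both sides are the number of empty faces. For [i = I.+1] the
     shift of [j] by one leads to [mu_sum_le]. *)
  case: i => [|I] in ir im C_gt0 *; first by rewrite big_nil add0r mul1r.
  rewrite big_add1 /= -lerBrDr exprS mulN1r mulNr opprK.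
  apply: le_trans (mu_sum_le hD GmD Gm_lower hpure hdim hserre ir (ltnW im)).
  rewrite le_eqVlt; apply/orP; left; apply/eqP; apply: eq_bigr => q _.
  by rewrite subSS (_ : q.+1%:Z - 1 = q%:Z) // -addn1 PoszD addrK.
split=> // -[_ hbuchs] i id.
(* Cohen-Macaulay links have no homology at all below their dimension, so [r = d] is allowed. *)
apply: (main d) => // v vV F FD j; rewrite lt_min => /andP[_].
exact: hbuchs.
Qed.
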